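(* Let $V$ be a finitely generated VOA over $\mathbb{Q}$ with $\dim V_0=1$. Let $N\le\mathrm{Aut}(V)$ be a finite group with a normal subgroup $E\cong(\mathbb{Z}/2)^r$, $r\ge3$, such that $N$ acts doubly transitively on the nontrivial linear characters of $E$. Let $D\le E$ with $\mathrm{rank}(E/D)\ge2$, let $W=V^D$ be the fixed-point subVOA, and suppose there is an IVOA $A$ in $W$ invariant under $N_N(D)$. If $A$ is nearly lattice integral, then there exists an $N$-invariant IVOA $B$ in $V$ which is nearly lattice integral.
   Context: $V$ carries its natural (nondegenerate invariant) bilinear form $\langle\ ,\ \rangle$; $\mathbf{1}$ is the vacuum and $\omega$ the conformal vector. An integral form (IF) in a VOA is an additive subgroup which is the $\mathbb{Z}$-span of a $\mathbb{Q}$-basis, closed under all products $a_kb$ ($k\in\mathbb{Z}$), and containing a positive integer multiple of $\mathbf{1}$ and of $\omega$; an IVOA is an IF containing $\mathbf{1}$. An additive subgroup $A$ is lattice integral if $\langle A,A\rangle\subseteq\mathbb{Z}$ and nearly lattice integral if $mA$ is lattice integral for some integer $m>0$. *)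

(* Defs.v *)
From HB Require Import structures.
From mathcomp Require Import all_boot all_order all_algebra all_fingroup all_solvable all_field all_character.
Set Implicit Arguments. Unset Strict Implicit. Unset Printing Implicit Defensive.
Import Order.TTheory GRing.Theory Num.Theory.
Local Open Scope ring_scope.

Definition binz (m : int) (i : nat) : rat :=
  (\prod_(j < i) (m%:~R - (j : nat)%:R)) / (i`!)%:R.

Section VOADefs.
Variable V : lmodType rat.

Definition Qspan (s : seq V) (v : V) : Prop :=
  exists c : seq rat, v = \sum_(i < size s) c`_i *: s`_i.

Definition Vir (Y : V -> int -> V -> V) (om : V) (n : int) : V -> V := Y om (n + 1).

(* Y a n b is the mode product a_n b ;  vac the vacuum, om the conformal vector *)
Record is_VOA (Y : V -> int -> V -> V) (vac om : V) : Prop := {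
  voa_linr : forall a n (q : rat) u w, Y a n (q *: u + w) = q *: Y a n u + Y a n w;
  voa_linl : forall b n (q : rat) u w, Y (q *: u + w) n b = q *: Y u n b + Y w n b;
  voa_trunc : forall a b, exists N : int, forall n, N <= n -> Y a n b = 0;
  voa_vacl : forall n a, Y vac n a = if n == -1 then a else 0;
  voa_creation : forall a, Y a (-1) vac = a /\ (forall n, 0 <= n -> Y a n vac = 0);
  (* Borcherds (Jacobi) identity; T is any bound beyond which all terms vanish *)
  voa_borcherds : forall a b c (m k n : int) (T : nat),
    (forall i : nat, (T <= i)%N -> Y a (k + i%:Z) b = 0) ->
    (forall i : nat, (T <= i)%N -> Y b (n + i%:Z) c = 0) ->
    (forall i : nat, (T <= i)%N -> Y a (m + i%:Z) c = 0) ->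
    \sum_(i < T) binz m i *: Y (Y a (k + i%:Z) b) (m + n - i%:Z) c =
    \sum_(i < T) ((-1) ^+ i * binz k i) *:
        (Y a (m + k - i%:Z) (Y b (n + i%:Z) c)
         - ((-1 : rat) ^ k) *: Y b (n + k - i%:Z) (Y a (m + i%:Z) c));
  voa_virasoro : exists cc : rat, forall (m n : int) v,
    Vir Y om m (Vir Y om n v) - Vir Y om n (Vir Y om m v) =
      (m - n)%:~R *: Vir Y om (m + n) v
      + (if m + n == 0 then (m ^+ 3 - m)%:~R / 12%:R * cc else 0) *: v;
  voa_deriv : forall a n b, Y (Vir Y om (-1) a) n b = - (n%:~R) *: Y a (n - 1) b;
  voa_grading : forall v, exists s : seq (int * V),
    (forall p, p \in s -> Vir Y om 0 p.2 = p.1%:~R *: p.2) /\ v = \sum_(p <- s) p.2;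
  voa_findim : forall k : int, exists s : seq V,
    forall v, Vir Y om 0 v = k%:~R *: v -> Qspan s v;
  voa_bounded : exists N : int, forall (k : int) v,
    k < N -> Vir Y om 0 v = k%:~R *: v -> v = 0
}.

Definition dim_V0_one (Y : V -> int -> V -> V) (om : V) : Prop :=
  exists v0 : V, v0 != 0 /\ Vir Y om 0 v0 = 0 /\
    forall v, Vir Y om 0 v = 0 -> exists q : rat, v = q *: v0.

Definition VOA_fin_gen (Y : V -> int -> V -> V) (vac : V) : Prop :=
  exists S : seq V, forall P : V -> Prop,
    (forall s, s \in S -> P s) -> P vac ->
    (forall (q : rat) u w, P u -> P w -> P (q *: u + w)) ->
    (forall a n b, P a -> P b -> P (Y a n b)) ->
    forall v, P v.

Definition is_VOA_aut (Y : V -> int -> V -> V) (om : V) (g : V -> V) : Prop :=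
  [/\ forall (q : rat) u w, g (q *: u + w) = q *: g u + g w,
      bijective g,
      forall a n b, g (Y a n b) = Y (g a) n (g b) &
      g om = om].

Record is_inv_form (Y : V -> int -> V -> V) (vac om : V) (bil : V -> V -> rat) : Prop := {
  bil_linl : forall (q : rat) u w v, bil (q *: u + w) v = q * bil u v + bil w v;
  bil_sym : forall u v, bil u v = bil v u;
  bil_nondeg : forall u, (forall v, bil u v = 0) -> u = 0;
  bil_vac : bil vac vac = 1;
  (* <Y(a,z)b,c> = <b, Y(e^{zL(1)}(-z^{-2})^{L(0)}a, z^{-1})c>, in modes,
     for a homogeneous of weight k *)
  bil_inv : forall a (k : int) (J : nat) n b c,
    Vir Y om 0 a = k%:~R *: a -> iter J (Vir Y om 1) a = 0 ->
    bil (Y a n b) c = ((-1 : rat) ^ k) *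
      \sum_(j < J) ((j`!)%:R)^-1 *
         bil b (Y (iter j (Vir Y om 1) a) (2 * k - n - (j : nat)%:Z - 2) c)
}.

Definition Qindep (Bs : V -> Prop) : Prop :=
  forall s : seq (V * rat), uniq (map fst s) -> (forall p, p \in s -> Bs p.1) ->
    \sum_(p <- s) p.2 *: p.1 = 0 -> forall p, p \in s -> p.2 = 0.

Definition Qspan_set (Bs : V -> Prop) (v : V) : Prop :=
  exists s : seq (V * rat), (forall p, p \in s -> Bs p.1) /\ v = \sum_(p <- s) p.2 *: p.1.

Definition Zspan_set (Bs : V -> Prop) (v : V) : Prop :=
  exists s : seq (V * int), (forall p, p \in s -> Bs p.1) /\ v = \sum_(p <- s) p.1 *~ p.2.

(* A is an integral form in the VOA U (a subVOA of V with vacuum vac and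
   conformal vector om) *)
Definition is_IF (Y : V -> int -> V -> V) (vac om : V) (U A : V -> Prop) : Prop :=
  [/\ exists Bs : V -> Prop, [/\ forall x, Bs x -> U x, Qindep Bs,
                                 forall v, U v <-> Qspan_set Bs v &
                                 forall v, A v <-> Zspan_set Bs v],
      forall a n b, A a -> A b -> A (Y a n b),
      exists m : nat, (0 < m)%N /\ A (vac *+ m) &
      exists m : nat, (0 < m)%N /\ A (om *+ m)].

Definition is_IVOA (Y : V -> int -> V -> V) (vac om : V) (U A : V -> Prop) : Prop :=
  is_IF Y vac om U A /\ A vac.

Definition lattice_integral (bil : V -> V -> rat) (A : V -> Prop) : Prop :=
  forall a b, A a -> A b -> bil a b \is a Num.int.

Definition nearly_lattice_integral (bil : V -> V -> rat) (A : V -> Prop) : Prop :=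
  exists m : nat, (0 < m)%N /\ lattice_integral bil (fun v => exists a, A a /\ v = a *+ m).

End VOADefs.

Definition fixed_pts (V : lmodType rat) (gT : finGroupType) (rho : gT -> V -> V)
  (D : {set gT}) (v : V) : Prop := forall d, d \in D -> rho d v = v.

Definition nontriv_lin (gT : finGroupType) (E : {group gT}) (chi : 'CF(E)) : Prop :=
  chi \is a linear_char /\ chi != 1.

Definition doubly_trans_lin (gT : finGroupType) (N E : {group gT}) : Prop :=
  forall x1 x2 y1 y2 : 'CF(E),
    nontriv_lin x1 -> nontriv_lin x2 -> nontriv_lin y1 -> nontriv_lin y2 ->
    x1 != x2 -> y1 != y2 ->
    exists2 n, n \in N & cfConjg n x1 = y1 /\ cfConjg n x2 = y2.

(* Main.v *)
Require Import Defs.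
From HB Require Import structures.
From mathcomp Require Import all_boot all_order all_algebra all_fingroup all_solvable all_field all_character.
From mathcomp Require Import zify ring lra.
From Stdlib Require Import Classical ClassicalEpsilon FunctionalExtensionality.
Import Order.TTheory GRing.Theory Num.Theory.
Local Open Scope ring_scope.

(** Write a_n b for the modes and let y be homogeneous of weight h with D acting on y by signs, so that every y_n y lies in V^D.
    Call y good if K^(m+1) y_(2h-1-m) y lies in A for all m, for some K > 0.

    If y_(2h-1) y is a nonzero multiple c 1 of the vacuum 1, then y is good.  The coefficients
    N(e1,e2,e3,e4) of prod_(i<j) (z_i - z_j)^(2h) y(z1) y(z2) y(z3) y(z4) 1 are symmetric, and Taylor
    expansion at z1 = z2 and z3 = z4 turns their binomial sums into products of the vectors
    y_(2h-1-i) y with small i.  Interpolation then puts a fixed multiple of N in the span of such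
    products, while c y_(2h-1-m) y is a combination of the N; so the denominators grow geometrically in m.
    Nondegeneracy of the form makes good vectors span every weight space.

    Take finitely many good letters spanning the weights of the generators.  If a word of length k in
    them equals q 1, then its square contains each letter an even number of times; collapsing pairs of equal
    letters that are neighbours in the order of their exponents puts K^(ck) q^2 1 in A, and as A is nearly
    lattice integral, C^k q is an integer.  Hence after rescaling the letters the Z-span T of all words is
    closed under products and, by invariance of the form, lattice integral.  B is the intersection of the
    N-translates of T; integral functionals bil(b, -) provide a basis of it, one weight at a time. *)

Set Implicit Arguments.
Unset Strict Implicit.
Unset Printing Implicit Defensive.

(** Rescaling can repair only geometric growth: multiplying every letter by C multiplies a word of
    length k by C^k, whatever its modes. So the denominator of a weight zero word must be bounded by
    an exponential in k, although its modes are arbitrary. The correlator, the product of the fields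
    times prod (z_i - z_j)^P, overcomes this: it is symmetric, has no negative powers, and in weight
    zero invariance of the form makes its degree in each variable at most linear in k. Collapsing
    two copies of a letter costs K to the power one plus the gap of their exponents; between
    neighbours in sorted order the gaps telescope, so the total cost is linear in k. A sees a letter
    outside V^D only through its products with itself, whence the pairing of equal letters and the
    squaring of words. Four copies of y are needed because c y_(2h-1-m) y = (y_(2h-1) y)_(-1)
    (y_(2h-1-m) y). Only weight zero words have to be controlled, as invariance turns the pairing of
    two words into pairings of 1 with words. *)

Section Subgroups.
Variable V : zmodType.
Implicit Types (P G : V -> Prop) (u v : V).

Definition subgroup P := P 0 /\ forall u v, P u -> P v -> P (u - v).

Inductive Zgen G : V -> Prop :=
| Zgen0 : Zgen G 0
| Zgen_in v : G v -> Zgen G v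
| ZgenB u v : Zgen G u -> Zgen G v -> Zgen G (u - v).

Lemma Zgen_subgroup G : subgroup (Zgen G).
Proof. by split; [exact: Zgen0 | exact: ZgenB]. Qed.

Lemma Zgen_min G P : subgroup P -> (forall v, G v -> P v) -> forall v, Zgen G v -> P v.
Proof. by move=> [P0 PB] GP v; elim=> [|u /GP //|u w _ Pu _ Pw] //; exact: PB. Qed.

Lemma Zgen_mono G G' : (forall v, G v -> Zgen G' v) -> forall v, Zgen G v -> Zgen G' v.
Proof. exact: (Zgen_min (Zgen_subgroup G')). Qed.

Section Closure.
Variables (P : V -> Prop) (HP : subgroup P).

Lemma sg0 : P 0. Proof. by case: HP. Qed.
Lemma sgB u v : P u -> P v -> P (u - v). Proof. by case: HP => _; apply. Qed.
Lemma sgN u : P u -> P (- u). Proof. by move=> Pu; rewrite -sub0r; apply: sgB => //; exact: sg0. Qed.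
Lemma sgD u v : P u -> P v -> P (u + v).
Proof. by move=> Pu Pv; rewrite -[v]opprK; apply: sgB => //; apply: sgN. Qed.
Lemma sgMn u k : P u -> P (u *+ k).
Proof. by move=> Pu; elim: k => [|k IH]; rewrite ?mulr0n ?mulrS; [exact: sg0 | exact: sgD]. Qed.
Lemma sgMz u (k : int) : P u -> P (u *~ k).
Proof. by move=> Pu; case: k => k /=; [exact: sgMn | apply: sgN; exact: sgMn]. Qed.
Lemma sg_sum I (r : seq I) (Q : pred I) F : (forall i, Q i -> P (F i)) -> P (\sum_(i <- r | Q i) F i).
Proof. by move=> PF; elim/big_ind: _ => [|u v|i /PF] //; [exact: sg0 | exact: sgD]. Qed.
Lemma sg_sumS (I : eqType) (r : seq I) F : (forall i, i \in r -> P (F i)) -> P (\sum_(i <- r) F i).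
Proof. by move=> PF; rewrite big_seq; apply: sg_sum. Qed.
Lemma sg_addl u v : P u -> P (u + v) -> P v.
Proof. by move=> Pu Puv; rewrite -[v](addKr u); apply: sgD => //; apply: sgN. Qed.
Lemma sg_addr u v : P v -> P (u + v) -> P u.
Proof. by rewrite addrC; exact: sg_addl. Qed.
End Closure.

End Subgroups.

Lemma subgroup_Mn (V : zmodType) (P : V -> Prop) k : subgroup P -> subgroup (fun v => P (v *+ k)).
Proof.
move=> HP; split; first by rewrite mul0rn; exact: sg0 HP.
by move=> u v Pu Pv; rewrite mulrnBl; exact: sgB.
Qed.

(** * Integer-valued polynomials and symmetric arrays *)
Section Newton.

(** Integer-valued polynomials of degree less than [d]. *)
Definition newton (d : nat) (w : nat -> int) :=
  exists c : nat -> int, forall e, w e = \sum_(i < d) c i * 'C(e, i)%:Z.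

Lemma newton_ext d w w' : w =1 w' -> newton d w -> newton d w'.
Proof. by move=> eqw [c Hc]; exists c => e; rewrite -eqw. Qed.

Lemma newton_bin i d : (i < d)%N -> newton d (fun e => 'C(e, i)%:Z).
Proof.
move=> lti; exists (fun j => (j == i)%:Z) => e.
rewrite (bigD1 (Ordinal lti)) //= eqxx mul1r big1 ?addr0 // => j nej.
by rewrite (_ : (j : nat) == i = false) ?mul0r //; apply: contra_neqF nej => /eqP ej; apply/val_inj.
Qed.

Lemma newton_lin d (a b : int) w w' :
  newton d w -> newton d w' -> newton d (fun e => a * w e + b * w' e).
Proof.
move=> [c Hc] [c' Hc']; exists (fun i => a * c i + b * c' i) => e.
rewrite Hc Hc' !mulr_sumr -big_split /=; apply: eq_bigr => i _; ring.
Qed.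

Lemma newton_ind d (Q : (nat -> int) -> Prop) :
  (forall w w', w =1 w' -> Q w -> Q w') ->
  Q (fun=> 0) -> (forall (a : int) w w', Q w -> Q w' -> Q (fun e => a * w e + w' e)) ->
  (forall i, (i < d)%N -> Q (fun e => 'C(e, i)%:Z)) -> forall w, newton d w -> Q w.
Proof.
move=> Qext Q0 Qlin Qbin w [c Hc]; apply: (Qext (fun e => \sum_(i < d) c i * 'C(e, i)%:Z)) => [e|]; first by rewrite Hc.
elim: {w Hc} d Qbin => [|d IH] Qbin; first by apply: Qext Q0 => e; rewrite big_ord0.
apply: (Qext (fun e => c d * 'C(e, d)%:Z + \sum_(i < d) c i * 'C(e, i)%:Z)).
  by move=> e; rewrite big_ord_recr addrC.
by apply: Qlin; [exact: Qbin | apply: IH => i lti; apply: Qbin; exact: ltnW].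
Qed.

Lemma newton_shift d w k : newton d w -> newton d (fun e => w (e + k)%N).
Proof.
elim: k w => [|k IH] w Hw; first by apply: newton_ext Hw => e; rewrite addn0.
apply: (@newton_ext _ (fun e => (fun e' => w e'.+1) (e + k)%N)) => [e|]; first by rewrite addnS.
apply: (IH (fun e => w e.+1)); move: w Hw; apply: (@newton_ind d (fun w => newton d (fun e => w e.+1))) => [w w' eqw|||[|i] lti].
- by apply: newton_ext => e; rewrite eqw.
- by exists (fun=> 0) => e; rewrite big1 // => i _; rewrite mul0r.
- by move=> a w w' H H'; apply: newton_ext (newton_lin a 1 H H') => e; rewrite mul1r.
- by apply: newton_ext (newton_bin lti) => e; rewrite !bin0.
- apply: newton_ext (newton_lin 1 1 (newton_bin lti) (newton_bin (ltnW lti))) => e.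
  by rewrite !mul1r binS PoszD.
Qed.

Lemma newton_mulX d w : newton d w -> newton d.+1 (fun e => e%:Z * w e).
Proof.
move: w; apply: (@newton_ind d (fun w => newton d.+1 (fun e => e%:Z * w e))) => [w w' eqw|||i lti].
- by apply: newton_ext => e; rewrite eqw.
- by exists (fun=> 0) => e; rewrite mulr0 big1 // => i _; rewrite mul0r.
- by move=> a w w' H H'; apply: newton_ext (newton_lin a 1 H H') => e; ring.
- have lti1 : (i.+1 < d.+1)%N by [].
  have lti0 : (i < d.+1)%N by exact: ltnW.
  (* e C(e,i) = (i+1) C(e,i+1) + i C(e,i). *)
  apply: newton_ext (newton_lin i.+1%:Z i%:Z (newton_bin lti1) (newton_bin lti0)) => e.
  rewrite -!PoszM -PoszD mul_bin_left -mulnDl.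
  case: (leqP i e) => [lie|ltei]; first by rewrite subnK.
  by rewrite bin_small // !muln0.
Qed.

Lemma newton_poly d (p : {poly int}) : (size p <= d)%N -> newton d (fun e => p.[e%:Z]).
Proof.
elim/poly_ind: p d => [|p c IH] d sp.
  by exists (fun=> 0) => e; rewrite horner0 big1 // => i _; rewrite mul0r.
case: d sp => [|d]; rewrite size_MXaddC.
  by case: ifP => // /andP[/eqP -> /eqP ->] _; exists (fun=> 0) => e; rewrite mul0r addr0 horner0 big_ord0.
move=> sp; have Hp : newton d.+1 (fun e => e%:Z * p.[e%:Z]).
  case: (eqVneq p 0) sp => [-> _|p0].
    by exists (fun=> 0) => e; rewrite horner0 mulr0 big1 // => i _; rewrite mul0r.
  by rewrite (_ : (_ && _) = false) //= ltnS => sp; apply: newton_mulX; exact: IH.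
apply: newton_ext (newton_lin 1 c Hp (newton_bin (ltn0Sn d))) => e.
by rewrite !hornerE bin0; ring.
Qed.

(** The witness is the polynomial C(e - b, d). Used as a weight on the first of two exponents with
    sum 2b + d, it keeps (b + d, b) with coefficient 1 and otherwise leaves only pairs that lie
    further apart. *)
Lemma newton_spike b d :
  exists2 w, newton d.+1 w & (forall e, (b <= e < b + d)%N -> w e = 0) /\ w (b + d)%N = 1.
Proof.
elim: b => [|b [w Hw [w0 w1]]].
  exists (fun e => 'C(e, d)%:Z); first exact: newton_bin.
  by split=> [e|]; rewrite add0n ?binn // => lte; rewrite bin_small.
suff [w' Hw' eqw] : exists2 w', newton d.+1 w' & forall e, w' e.+1 = w e.
  exists w' => //; split=> [[|e]|] //; last by rewrite addSn eqw.
  by rewrite !ltnS eqw; exact: w0.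
move: w Hw {w0 w1}; apply: (@newton_ind d.+1 (fun w => exists2 w', newton d.+1 w' & forall e, w' e.+1 = w e)) => [w w' eqw [w1 H1 H]|||i].
- by exists w1 => // e; rewrite H.
- by exists (fun=> 0) => //; exists (fun=> 0) => e; rewrite big1 // => i _; rewrite mul0r.
- move=> a w w' [v Hv ev] [v' Hv' ev']; exists (fun e => a * v e + 1 * v' e); first exact: newton_lin.
  by move=> e; rewrite ev ev' mul1r.
- elim: i => [|i IH] lti.
    by exists (fun e => 'C(e, 0)%:Z) => [|e]; [exact: newton_bin | rewrite !bin0].
  have [u Hu eu] := IH (ltnW lti).
  (* Pascal's rule in the form C(e,i+1) = C(e+1,i+1) - C(e,i) shifts the argument backwards. *)
  exists (fun e => 1 * 'C(e, i.+1)%:Z + (-1) * u e); first by apply: newton_lin => //; exact: newton_bin.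
  by move=> e; rewrite eu binS PoszD; ring.
Qed.

Variables (V : zmodType) (P : V -> Prop) (HP : subgroup P).

Lemma newton_span A d (f : nat -> V) w :
  (forall i, (i < d)%N -> P (\sum_(e < A.+1) f e *~ 'C(e, i)%:Z)) ->
  newton d w -> P (\sum_(e < A.+1) f e *~ w e).
Proof.
move=> Hf; move: w; apply: (@newton_ind d (fun w => P (\sum_(e < A.+1) f e *~ w e))) => [w w' eqw||a w w' H H'|i lti].
- by congr P; apply: eq_bigr => i _; rewrite eqw.
- by rewrite big1 => [|i _]; [exact: sg0 HP | rewrite mulr0z].
- rewrite (_ : \sum_(_ < _) _ = (\sum_(e < A.+1) f e *~ w e) *~ a + \sum_(e < A.+1) f e *~ w' e).
    by apply: sgD => //; exact: sgMz.
  rewrite mulrz_suml -big_split; apply: eq_bigr => i _ /=.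
  by rewrite mulrzDr mulrC mulrzA.
- exact: Hf.
Qed.

(** The matrix of the C(e, i) is unitriangular, so descending induction on e isolates each entry. *)
Lemma bin_inversion A (f : nat -> V) :
  (forall i, (i <= A)%N -> P (\sum_(e < A.+1) f e *~ 'C(e, i)%:Z)) ->
  forall e, (e <= A)%N -> P (f e).
Proof.
move=> Hf; suff H k e : (e <= A)%N -> (A - e <= k)%N -> P (f e) by move=> e leA; exact: (H (A - e)%N).
elim: k e => [|k IH] e leA lek; have := Hf e leA.
  have -> : e = A by apply/eqP; rewrite eqn_leq leA -subn_eq0 -leqn0.
  rewrite big_ord_recr big1 /= ?add0r ?binn //.
  by move=> i _; rewrite bin_small //.
have ltA : (e < A.+1)%N by rewrite ltnS.
rewrite (bigD1 (Ordinal ltA)) //= binn mulr1z.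
apply: sg_addr => //; apply: sg_sum => // i nei.
case: (ltngtP i e) => [ltie|ltei|eie].
- by rewrite bin_small //; exact: sg0.
- apply: sgMz => //; apply: IH; first by rewrite -ltnS.
  by rewrite leq_subLR (leq_trans _ (leq_add ltei (leqnn k))) // addSnnS -leq_subLR.
- by case/eqP: nei; apply/val_inj.
Qed.

End Newton.

(** Lagrange interpolation over the integers. Each factor vanishing at some b != b0 is scaled to
    take the value delta! at b0, and the constant delta! replaces the missing factor, so the value
    at b0 is the same for every b0. *)
Lemma isolating_poly delta b0 : (b0 <= delta)%N ->
  exists2 p : {poly int}, (size p <= delta.+1)%N &
    p.[b0%:Z] = (delta`! ^ delta.+1)%N%:Z /\
    forall b : nat, (b <= delta)%N -> b != b0 -> p.[b%:Z] = 0.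
Proof.
move=> le0.
pose c (b : nat) : int :=
  if (b < b0)%N then (delta`! %/ (b0 - b))%N%:Z else - (delta`! %/ (b - b0))%N%:Z.
have cP b : (b <= delta)%N -> b != b0 -> c b * (b0%:Z - b%:Z) = delta`!%:Z.
  move=> leb neb; rewrite /c; case: ltngtP neb => // ltb _.
    by rewrite subzn 1?ltnW // -PoszM divnK // dvdn_fact // subn_gt0 ltb /=; lia.
  by rewrite mulNr -mulrN opprB subzn 1?ltnW // -PoszM divnK // dvdn_fact // subn_gt0 ltb /=; lia.
pose F (b : 'I_delta.+1) : {poly int} :=
  if (b : nat) == b0 then (delta`!%:Z)%:P else c b *: ('X - b%:Z%:P).
exists (\prod_b F b); last split.
- apply: leq_trans (size_prod_leq _ _) _.
  rewrite cardT size_enum_ord leq_subLR addSn ltnS.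
  have lt0 : (b0 < delta.+1)%N by [].
  rewrite (bigD1 (Ordinal lt0)) //= {1}/F eqxx.
  have h1 : (size (delta`!%:Z%:P : {poly int}) <= 1)%N by exact: size_polyC_leq1.
  have h2 : (\sum_(i < delta.+1 | i != Ordinal lt0) size (F i) <= \sum_(i < delta.+1 | i != Ordinal lt0) 2)%N.
    apply: leq_sum => i nei; rewrite /F ifF; last by apply: contra_neqF nei => /eqP ei; apply/val_inj.
    by apply: leq_trans (size_scale_leq _ _) _; rewrite size_XsubC.
  by apply: leq_trans (leq_add h1 h2) _; rewrite sum_nat_const cardC1 card_ord add1n addnS ltnS muln2 addnn.
- have -> : (delta`! ^ delta.+1)%N%:Z = delta`!%:Z ^+ delta.+1 by rewrite -!natz natrX.
  rewrite horner_prod -[in RHS](card_ord delta.+1) -prodr_const; apply: eq_bigr => b _.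
  rewrite /F; case: eqVneq => [_|neb]; first by rewrite hornerC.
  by rewrite !hornerE cP // -ltnS.
- move=> b leb neb; have ltb : (b < delta.+1)%N by [].
  by rewrite horner_prod (bigD1 (Ordinal ltb)) //= /F (negbTE neb) !hornerE subrr mulr0 mul0r.
Qed.

Section FourPoint.
Variables (V : zmodType) (P : V -> Prop) (HP : subgroup P).
Variables (n : nat -> nat -> nat -> nat -> V) (D delta g : nat).
Hypothesis s12 : forall a b c d, n a b c d = n b a c d.
Hypothesis s23 : forall a b c d, n a b c d = n a c b d.
Hypothesis s34 : forall a b c d, n a b c d = n a b d c.
Hypothesis Dg : D = (g + delta)%N.
Hypothesis hg : (2 * delta < g)%N.
Hypothesis hD : (4 * delta + 3 < D)%N.
Hypothesis H : forall A B i j, (A + B = D)%N -> (i < g)%N -> (j < g)%N ->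
  P (\sum_(e < A.+1) \sum_(k < B.+1) n e (A - e) k (B - k) *~ ('C(e, i) * 'C(k, j))%:Z).

(** As B < g, all binomial moments in the second pair are available, and inversion separates its
    entries. *)
Let half A B i k : (A + B = D)%N -> (B < g)%N -> (i < g)%N -> (k <= B)%N ->
  P (\sum_(e < A.+1) n e (A - e) k (B - k) *~ 'C(e, i)%:Z).
Proof.
move=> AB ltB lti; move: k.
apply: (bin_inversion HP (f := fun k => \sum_(e < A.+1) n e (A - e) k (B - k) *~ 'C(e, i)%:Z)) => j lej.
have := H AB lti (leq_ltn_trans lej ltB); rewrite exchange_big /=; congr P.
apply: eq_bigr => k _; rewrite mulrz_suml; apply: eq_bigr => e _.
by rewrite PoszM mulrzA.
Qed.

(** Since D = g + delta, each of the two bounds puts the opposite sum below g, so both pairs can be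
    inverted. *)
Let close a b c d : (a + b + c + d = D)%N -> (delta < a + b)%N -> (delta < c + d)%N -> P (n a b c d).
Proof.
move=> e1 lt1 lt2.
suff Hi i : (i <= a + b)%N -> P (\sum_(e < (a + b).+1) n e (a + b - e) c d *~ 'C(e, i)%:Z).
  by have := bin_inversion HP (f := fun e => n e (a + b - e)%N c d) Hi (leq_addr b a); rewrite addKn.
by move=> lei; have := @half (a + b) (c + d) i c; rewrite addKn; apply; lia.
Qed.

Let halfw A c d w : (A + c + d = D)%N -> (c + d <= delta)%N -> newton g w ->
  P (\sum_(e < A.+1) n e (A - e) c d *~ w e).
Proof.
move=> e1 lecd; apply: (newton_span HP (f := fun e => n e (A - e) c d)) => i lti.
by have := @half A (c + d) i c; rewrite addKn; apply; lia.
Qed.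

(* By [close], modulo P an entry survives only if one index is large and the other three have pairwise
   sums at most delta. [x] lists these entries, and their moments [K] against three polynomials, one of
   them evaluated at the large index, are antisymmetric in p, q and symmetric in q, s, hence 2-torsion. *)
Let x b r d := n (D - b - r - d) b r d.
Let J (p q : {poly int}) r d :=
  \sum_(b < delta.+1) x b r d *~ (p.[(D - b - r - d)%N%:Z] * q.[b%:Z]).

(** For small r + d, the weight p(e) q(A - e) has degree at most 2 delta < g. Modulo P its moment
    retains only e <= delta and e >= A - delta, and these two ends are [J q p] and [J p q]. *)
Let anti (p q : {poly int}) r d : (size p <= delta.+1)%N -> (size q <= delta.+1)%N -> (r <= delta)%N -> (d <= delta)%N ->
  P (J p q r d + J q p r d).
Proof.
move=> sp sq ler led; case: (leqP (r + d) delta) => [lerd|ltrd]; last first.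
  by apply: sgD => //; apply: sg_sum => // b _; apply: sgMz => //; have lb := ltn_ord b; apply: close; lia.
pose A := (D - r - d)%N.
pose w (e : nat) : int := p.[e%:Z] * q.[A%:Z - e%:Z].
have Hw : newton g w.
  apply: (@newton_ext _ (fun e => (p * (q \Po (A%:Z%:P - 'X))).[e%:Z])).
    by move=> e; rewrite hornerM horner_comp !hornerE.
  apply: newton_poly; apply: leq_trans (size_polyMleq _ _) _.
  rewrite size_comp_poly2; first by rewrite -subn1 leq_subLR; apply: leq_trans (leq_add sp sq) _; lia.
  by rewrite -opprB size_polyN size_XsubC.
have := @halfw A r d w _ lerd Hw.
have -> : (A + r + d = D)%N by rewrite /A; lia.
move/(_ erefl).
have lA : (2 * delta < A)%N by rewrite /A; lia.
rewrite -(big_mkord xpredT (fun e => n e (A - e)%N r d *~ w e)).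
rewrite (big_cat_nat (n := delta.+1)) /=; [|by []|by lia].
rewrite (big_cat_nat (m := delta.+1) (n := (A - delta)%N)) /=; [|by lia|by lia].
set S1 := \sum_(0 <= _ < _) _; set S2 := \sum_(_ <= _ < A - delta) _; set S3 := \sum_(_ <= _ < A.+1) _.
have PS2 : P S2.
  rewrite /S2 big_seq; apply: sg_sum => // e; rewrite mem_index_iota => /andP[l1 l2]; apply: sgMz => //.
  by rewrite s23; apply: close; rewrite /A in l2 *; lia.
have -> : S1 = J q p r d.
  rewrite /S1 big_mkord; apply: eq_bigr => b _; have lb := ltn_ord b.
  rewrite s12 /x /w (_ : (A - b = D - b - r - d)%N); last by rewrite /A; lia.
  by rewrite mulrC; congr (_ *~ (q.[_] * _)); rewrite /A; lia.
have -> : S3 = J p q r d.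
  rewrite /S3 -{1}(add0n (A - delta)%N) big_addn (_ : A.+1 - (A - delta) = delta.+1)%N; last by lia.
  rewrite big_mkord (reindex_inj rev_ord_inj) /=; apply: eq_bigr => b _; have lb := ltn_ord b.
  rewrite /x /w (_ : (delta.+1 - b.+1 + (A - delta) = D - b - r - d)%N); last by rewrite /A; lia.
  rewrite (_ : (A - (D - b - r - d) = b)%N); last by rewrite /A; lia.
  by congr (_ *~ (_ * q.[_])); rewrite /A; lia.
by rewrite addrCA; move/(sg_addl HP PS2); rewrite addrC.
Qed.

Let K (p q s : {poly int}) d := \sum_(r < delta.+1) J p q r d *~ s.[r%:Z].

Let K_anti (p q s : {poly int}) d : (size p <= delta.+1)%N -> (size q <= delta.+1)%N -> (d <= delta)%N ->
  P (K p q s d + K q p s d).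
Proof.
move=> sp sq led; rewrite /K -big_split; apply: sg_sum => // r _ /=.
by rewrite -mulrzDl; apply: sgMz => //; apply: anti => //; rewrite -ltnS.
Qed.

Let K_sym p q s d : K p q s d = K p s q d.
Proof.
rewrite /K /J.
under eq_bigr do rewrite mulrz_suml; under [RHS]eq_bigr do rewrite mulrz_suml.
rewrite exchange_big /=; apply: eq_bigr => b _; apply: eq_bigr => r _.
rewrite /x s23 (_ : (D - b - r - d = D - r - b - d)%N); last by lia.
by rewrite -!mulrzA mulrAC.
Qed.

Let L := (delta`! ^ delta.+1)%N.

Let x_tors b r d : (b <= delta)%N -> (r <= delta)%N -> (d <= delta)%N -> P (x b r d *+ (2 * L ^ 2)).
Proof.
move=> leb ler led.
have [p sp [p1 p0]] := isolating_poly leb; have [q sq [q1 q0]] := isolating_poly ler.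
have s1 : (size (1%R : {poly int}) <= delta.+1)%N by rewrite size_poly1.
(* The polynomials p and q isolate b and r with a factor L each; the constant 1 sits at the large
   index. *)
have -> : x b r d *+ (2 * L ^ 2) = K 1%R p q d + K 1%R p q d.
  rewrite -mulr2n /K; have ltr : (r < delta.+1)%N by []; have ltb : (b < delta.+1)%N by [].
  rewrite (bigD1 (Ordinal ltr)) //= big1 ?addr0 => [|i nei]; last first.
    by rewrite q0 ?mulr0z // -ltnS.
  rewrite /J (bigD1 (Ordinal ltb)) //= big1 ?addr0 => [|i nei]; last first.
    by rewrite p0 ?mulr0 ?mulr0z // -ltnS.
  by rewrite hornerC mul1r p1 q1 -!pmulrn -!mulrnA /L; congr (_ *+ _); ring.
(* The three moments K(1,p,q), K(p,q,1), K(q,1,p) have pairwise sums in P, hence twice the first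
   lies in P. *)
have e1 := K_anti q s1 sp led; have e2 := K_anti (1 : {poly int}) sp sq led; have e3 := K_anti p sq s1 led.
rewrite (K_sym p 1%R q) in e1; rewrite (K_sym q p 1%R) in e2; rewrite (K_sym 1%R q p) in e3.
have := sgD HP (sgB HP e1 e2) e3; congr P.
by rewrite opprD !addrA addrK subrK.
Qed.

(** Here 4a >= D > 4 delta + 3, so any pair containing a has sum above delta; if two of the other
    indices also do, [close] applies after a permutation. *)
Let big_first a b c d : (a + b + c + d = D)%N -> (b <= a)%N -> (c <= a)%N -> (d <= a)%N ->
  P (n a b c d *+ (2 * L ^ 2)).
Proof.
move=> eD lb lc ld.
case: (leqP (b + c) delta) => [lebc|ltbc]; last first.
  by apply: sgMn => //; rewrite s34 s23; apply: close; lia.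
case: (leqP (b + d) delta) => [lebd|ltbd]; last first.
  by apply: sgMn => //; rewrite s23; apply: close; lia.
case: (leqP (c + d) delta) => [lecd|ltcd]; last first.
  by apply: sgMn => //; apply: close; lia.
have -> : n a b c d = x b c d by rewrite /x; congr (n _ _ _ _); lia.
by apply: x_tors; lia.
Qed.

Lemma four_point a b c d : (a + b + c + d = D)%N -> P (n a b c d *+ (2 * L ^ 2)).
Proof.
move=> eD.
have [la|] := boolP [&& b <= a, c <= a & d <= a]%N; first by case/and3P: la => *; exact: big_first.
move=> h1; have [lb|] := boolP [&& a <= b, c <= b & d <= b]%N.
  by case/and3P: lb => *; rewrite s12; apply: big_first => //; lia.
move=> h2; have [lc|] := boolP [&& a <= c, b <= c & d <= c]%N.
  by case/and3P: lc => *; rewrite s23 s12; apply: big_first => //; lia.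
move=> h3; rewrite s34 s23 s12; apply: big_first; lia.
Qed.

End FourPoint.

(** * Vertex algebra basics *)
Section BinZ.

Lemma binz0 m : binz m 0 = 1.
Proof. by rewrite /binz big_ord0 fact0 divr1. Qed.

Lemma binzS m i : binz m i.+1 = binz m i * (m%:~R - i%:R) / i.+1%:R.
Proof.
rewrite /binz big_ord_recr /= factS natrM invfM [i.+1%:R^-1 * _]mulrC mulrA.
by rewrite [_ * (m%:~R - _) / _]mulrAC.
Qed.

Lemma binz_nat (m i : nat) : binz m%:Z i = 'C(m, i)%:R.
Proof.
elim: i => [|i IH]; first by rewrite binz0 bin0.
rewrite binzS IH; apply: (@mulIf _ i.+1%:R); first by rewrite pnatr_eq0.
rewrite divfK ?pnatr_eq0 // -natrM [('C(_, i.+1) * _)%N]mulnC mul_bin_left.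
case: (leqP i m) => [lim|ltmi]; last by rewrite bin_small // mul0r muln0.
by rewrite natrM natrB // mulrC.
Qed.

Lemma binz_0S i : binz 0 i.+1 = 0.
Proof. by rewrite (binz_nat 0) bin_small. Qed.

Lemma binz_neg (k i : nat) : binz (- k.+1%:Z) i = (-1) ^+ i * 'C(k + i, i)%:R.
Proof.
elim: i => [|i IH]; first by rewrite binz0 bin0 expr0 mul1r.
rewrite binzS IH; apply: (@mulIf _ i.+1%:R); first by rewrite pnatr_eq0.
rewrite divfK ?pnatr_eq0 // -[RHS]mulrA -natrM [('C(_, i.+1) * _)%N]mulnC -mul_bin_diag addnS.
have -> : ((- k.+1%:Z)%:~R : rat) = - (k%:R + 1) by rewrite rmorphN /= -pmulrn natr1.
by rewrite exprS natrM /= -natr1 natrD; ring.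
Qed.

Lemma binz_pascal m i : binz (m + 1) i.+1 = binz m i.+1 + binz m i.
Proof.
have e : \prod_(j < i.+1) ((m + 1)%:~R - j%:R) = (m + 1)%:~R * \prod_(j < i) (m%:~R - j%:R) :> rat.
  rewrite big_ord_recl /= subr0; congr (_ * _); apply: eq_bigr => j _.
  by rewrite /bump /= add1n -natr1 rmorphD /=; ring.
have -> : binz (m + 1) i.+1 = (m + 1)%:~R / i.+1%:R * binz m i.
  by rewrite /binz e factS natrM invfM mulrACA.
by rewrite binzS rmorphD /= -natr1; field; rewrite natr1 pnatr_eq0.
Qed.

Lemma binz_int m i : exists z : int, binz m i = z%:~R.
Proof.
case: m => m; first by exists 'C(m, i); rewrite binz_nat.
by exists ((-1) ^+ i * 'C(m + i, i)%:Z); rewrite NegzE binz_neg rmorphM rmorphXn rmorphN.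
Qed.

Lemma sgnz_int (k : int) : exists z : int, (-1 : rat) ^ k = z%:~R.
Proof.
case: k => k; first by exists ((-1) ^+ k); rewrite -exprnP rmorphXn rmorphN.
exists ((-1) ^+ k.+1); rewrite NegzE -exprnN rmorphXn rmorphN.
by rewrite -exprVn invrN invr1.
Qed.

End BinZ.

Section VOA.
Variables (V : lmodType rat) (Y : V -> int -> V -> V) (vac om : V).
Hypothesis H : is_VOA Y vac om.

Lemma YrD a n u v : Y a n (u + v) = Y a n u + Y a n v.
Proof. by rewrite -{1}[u]scale1r (voa_linr H) scale1r. Qed.
Lemma Yr0 a n : Y a n 0 = 0.
Proof. by apply: (@addrI _ (Y a n 0)); rewrite -YrD !addr0. Qed.
Lemma YrZ a n q u : Y a n (q *: u) = q *: Y a n u.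
Proof. by rewrite -[q *: u]addr0 (voa_linr H) Yr0 addr0. Qed.
Lemma YrN a n u : Y a n (- u) = - Y a n u.
Proof. by rewrite -scaleN1r YrZ scaleN1r. Qed.
Lemma YrB a n u v : Y a n (u - v) = Y a n u - Y a n v.
Proof. by rewrite YrD YrN. Qed.
Lemma Yr_sum a n I (r : seq I) (Q : pred I) F :
  Y a n (\sum_(i <- r | Q i) F i) = \sum_(i <- r | Q i) Y a n (F i).
Proof. by apply: (big_morph (Y a n)); [exact: YrD | exact: Yr0]. Qed.
Lemma YrMn a n u k : Y a n (u *+ k) = Y a n u *+ k.
Proof. by rewrite -scaler_nat YrZ scaler_nat. Qed.
Lemma YrMz a n u k : Y a n (u *~ k) = Y a n u *~ k.
Proof. by rewrite -!scaler_int YrZ. Qed.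

Lemma YlD b n u v : Y (u + v) n b = Y u n b + Y v n b.
Proof. by rewrite -{1}[u]scale1r (voa_linl H) scale1r. Qed.
Lemma Yl0 b n : Y 0 n b = 0.
Proof. by apply: (@addrI _ (Y 0 n b)); rewrite -YlD !addr0. Qed.
Lemma YlZ b n q u : Y (q *: u) n b = q *: Y u n b.
Proof. by rewrite -[q *: u]addr0 (voa_linl H) Yl0 addr0. Qed.
Lemma YlN b n u : Y (- u) n b = - Y u n b.
Proof. by rewrite -scaleN1r YlZ scaleN1r. Qed.
Lemma YlB b n u v : Y (u - v) n b = Y u n b - Y v n b.
Proof. by rewrite YlD YlN. Qed.
Lemma YlMn b n u k : Y (u *+ k) n b = Y u n b *+ k.
Proof. by rewrite -scaler_nat YlZ scaler_nat. Qed.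
Lemma trunc_nat a b (k : int) : exists T : nat, forall i : nat, (T <= i)%N -> Y a (k + i%:Z) b = 0.
Proof. by have [N HN] := voa_trunc H a b; exists `|N - k|%N => i lei; apply: HN; lia. Qed.

Lemma borcherds_ev a b c (m k n : int) : exists T0 : nat, forall T : nat, (T0 <= T)%N ->
  \sum_(i < T) binz m i *: Y (Y a (k + i%:Z) b) (m + n - i%:Z) c =
  \sum_(i < T) ((-1) ^+ i * binz k i) *:
    (Y a (m + k - i%:Z) (Y b (n + i%:Z) c)
     - ((-1 : rat) ^ k) *: Y b (n + k - i%:Z) (Y a (m + i%:Z) c)).
Proof.
have [T1 H1] := trunc_nat a b k; have [T2 H2] := trunc_nat b c n; have [T3 H3] := trunc_nat a c m.
exists (maxn T1 (maxn T2 T3)) => T; rewrite !geq_max => /and3P[l1 l2 l3].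
by apply: (voa_borcherds H) => i lei; [apply: H1|apply: H2|apply: H3]; exact: leq_trans lei.
Qed.

(** The commutator formula: Borcherds' identity with k = 0, where only the leading term on the right
    survives. *)
Lemma comm_nat a b c (m : nat) (n : int) :
  Y a m%:Z (Y b n c) - Y b n (Y a m%:Z c) =
  \sum_(i < m.+1) 'C(m, i)%:R *: Y (Y a i%:Z b) (m%:Z + n - i%:Z) c.
Proof.
have [T0 HT] := borcherds_ev a b c m%:Z 0 n.
have := HT (maxn T0 m.+1) (leq_maxl _ _).
set T := maxn T0 m.+1; have lT : (m.+1 <= T)%N by exact: leq_maxr.
have [T' eT] : exists T', T = T'.+1 by exists T.-1; lia.
move=> E; apply/esym; transitivity (\sum_(i < T) binz m%:Z i *: Y (Y a (0 + i%:Z) b) (m%:Z + n - i%:Z) c).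
  rewrite (big_ord_widen T (fun i => 'C(m, i)%:R *: Y (Y a i%:Z b) (m%:Z + n - i%:Z) c) lT) big_mkcond /=.
  apply: eq_bigr => i _; rewrite add0r binz_nat; case: ltnP => // lti.
  by rewrite bin_small // scale0r.
rewrite E eT big_ord_recl big1 ?addr0 => [|i _].
  by rewrite /= binz0 expr0 mul1r scale1r expr0z scale1r.
by rewrite lift0 binz_0S mulr0 scale0r.
Qed.

(** The associativity formula: Borcherds' identity with m = 0. *)
Lemma iterate_ev a b c (k n : int) : exists T0 : nat, forall T : nat, (T0 <= T)%N ->
  Y (Y a k b) n c = \sum_(i < T) ((-1) ^+ i * binz k i) *:
    (Y a (k - i%:Z) (Y b (n + i%:Z) c) - ((-1 : rat) ^ k) *: Y b (n + k - i%:Z) (Y a i%:Z c)).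
Proof.
have [T0 HT] := borcherds_ev a b c 0 k n; exists T0.+1 => -[//|T] lT.
have := HT T.+1 (ltnW lT); rewrite big_ord_recl big1 ?addr0 => [|i _]; last first.
  by rewrite lift0 binz_0S scale0r.
rewrite /= binz0 scale1r add0r => ->; apply: eq_bigr => i _.
by rewrite !add0r.
Qed.

Lemma iterate_Z (P : V -> Prop) a b c k n : subgroup P ->
  (forall i j, P (Y a i (Y b j c))) -> (forall i j, P (Y b i (Y a j c))) -> P (Y (Y a k b) n c).
Proof.
move=> HP Pab Pba; have [T0 HT] := iterate_ev a b c k n.
rewrite (HT T0) //; apply: sg_sum => // i _.
have [z ->] := binz_int k i; have [s ->] := sgnz_int k.
rewrite (_ : (-1) ^+ i * z%:~R = ((-1) ^+ i * z)%:~R); last by rewrite rmorphM rmorphXn rmorphN.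
by rewrite !scaler_int; apply: sgMz => //; apply: sgB => //; exact: sgMz.
Qed.

Notation L n := (Vir Y om n).
Definition wt (k : int) (v : V) := L 0 v = k%:~R *: v.

Lemma wt_lin k q u v : wt k u -> wt k v -> wt k (q *: u + v).
Proof. by rewrite /wt /Vir (voa_linr H) => -> ->; rewrite scalerDr !scalerA mulrC. Qed.
Lemma wt0 k : wt k 0.
Proof. by rewrite /wt /Vir Yr0 scaler0. Qed.
Lemma wtZ k q u : wt k u -> wt k (q *: u).
Proof. by move=> wu; rewrite -[q *: u]addr0; apply: wt_lin => //; exact: wt0. Qed.
Lemma wtD k u v : wt k u -> wt k v -> wt k (u + v).
Proof. by move=> wu wv; rewrite -[u]scale1r; exact: wt_lin. Qed.
Lemma wtB k u v : wt k u -> wt k v -> wt k (u - v).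
Proof. by move=> wu wv; rewrite addrC -scaleN1r; exact: wt_lin. Qed.
Lemma wt_sum k I (r : seq I) (Q : pred I) F : (forall i, Q i -> wt k (F i)) ->
  wt k (\sum_(i <- r | Q i) F i).
Proof. by move=> wF; elim/big_ind: _ => [|u v|i /wF] //; [exact: wt0 | exact: wtD]. Qed.

Lemma Lm1_Y a n b : L (-1) (Y a n b) = Y (L (-1) a) n b + Y a n (L (-1) b).
Proof.
have := comm_nat om a b 0 n; rewrite big_ord_recl big_ord0 addr0 bin0 scale1r => /eqP.
by rewrite subr_eq /= add0r subr0 => /eqP.
Qed.

Lemma wt_Y k l a n b : wt k a -> wt l b -> wt (k + l - n - 1) (Y a n b).
Proof.
move=> wa wb; have E : Y om 1 (Y a n b) = Y (Y om 0 a) (1 + n) b + Y (Y om 1 a) n b + Y a n (Y om 1 b).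
  have := comm_nat om a b 1 n; rewrite !big_ord_recl big_ord0 /= !scale1r addr0 => /eqP.
  rewrite subr_eq => /eqP ->; congr (_ + _ + _); rewrite addr0; congr (Y _ _ _); rewrite /bump /=; lia.
have e1 : Y om 1 a = k%:~R *: a by rewrite -wa /Vir add0r.
have e2 : Y om 1 b = l%:~R *: b by rewrite -wb /Vir add0r.
have e0 := voa_deriv H a (1 + n) b; rewrite /Vir addNr addrAC subrr add0r in e0.
rewrite /wt /Vir add0r E e0 e1 e2 YrZ YlZ -!scalerDl; congr (_ *: _).
by rewrite !rmorphB !rmorphD /=; ring.
Qed.

Lemma L_vac n : -1 <= n -> L n vac = 0.
Proof. by move=> ln; rewrite /Vir; apply: (proj2 (voa_creation H om)); lia. Qed.

Lemma wt_vac : wt 0 vac.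
Proof. by rewrite /wt L_vac // scale0r. Qed.

Lemma wt_om : wt 2 om.
Proof.
have e : om = L (-2) vac by rewrite /Vir; have [->] := voa_creation H om.
have [cc E] := voa_virasoro H; have := E 0 (-2) vac.
by rewrite add0r sub0r opprK /= (L_vac (n := 0)) // -e /Vir Yr0 subr0 scale0r addr0.
Qed.

Lemma L_wt n k v : wt k v -> wt (k - n) (L n v).
Proof. by move=> wv; have := wt_Y (n + 1) wt_om wv; congr (wt _ _); lia. Qed.

(** This reduces invariance of the form for the modes of om to one term, which gives
    self-adjointness of L(0). *)
Lemma L1_om : L 1 om = 0.
Proof.
have e : om = L (-2) vac by rewrite /Vir; have [->] := voa_creation H om.
have [cc E] := voa_virasoro H; have := E 1 (-2) vac.
rewrite (_ : 1 + -2 = -1 :> int) // -e (L_vac (n := 1)) // (L_vac (n := -1)) //.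
by rewrite /Vir Yr0 subr0 /= scale0r addr0 scaler0.
Qed.

Lemma wt_uniq k l v : wt k v -> wt l v -> k != l -> v = 0.
Proof.
rewrite /wt => -> e nkl; have /eqP : (k - l)%:~R *: v = 0 by rewrite rmorphB scalerBl e subrr.
by rewrite scaler_eq0 intr_eq0 subr_eq0 (negbTE nkl) => /eqP.
Qed.

End VOA.

(** * The invariant form and the weight grading *)

Section Form.
Variables (V : lmodType rat) (Y : V -> int -> V -> V) (vac om : V) (bil : V -> V -> rat).
Hypotheses (H : is_VOA Y vac om) (HV0 : dim_V0_one Y om) (HB : is_inv_form Y vac om bil).
Notation L n := (Vir Y om n).
Notation wt := (wt Y om).

Lemma bilDl u w v : bil (u + w) v = bil u v + bil w v.
Proof. by rewrite -{1}[u]scale1r (bil_linl HB) mul1r. Qed.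
Lemma bil0l v : bil 0 v = 0.
Proof. by apply: (@addrI _ (bil 0 v)); rewrite -bilDl !addr0. Qed.
Lemma bilZl q u v : bil (q *: u) v = q * bil u v.
Proof. by rewrite -[q *: u]addr0 (bil_linl HB) bil0l addr0. Qed.
Lemma bilDr u v w : bil u (v + w) = bil u v + bil u w.
Proof. by rewrite !(bil_sym HB u) bilDl. Qed.
Lemma bil0r u : bil u 0 = 0. Proof. by rewrite (bil_sym HB) bil0l. Qed.
Lemma bilZr q u v : bil u (q *: v) = q * bil u v.
Proof. by rewrite !(bil_sym HB u) bilZl. Qed.
Lemma bilBl u w v : bil (u - w) v = bil u v - bil w v.
Proof. by rewrite bilDl -scaleN1r bilZl mulN1r. Qed.
Lemma bilBr u v w : bil u (v - w) = bil u v - bil u w.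
Proof. by rewrite !(bil_sym HB u) bilBl. Qed.
Lemma bil_sumr I (r : seq I) (Q : pred I) F u :
  bil u (\sum_(i <- r | Q i) F i) = \sum_(i <- r | Q i) bil u (F i).
Proof. by apply: (big_morph (bil u)) => [v w|]; [exact: bilDr | exact: bil0r]. Qed.

Lemma vac_neq0 : vac != 0.
Proof. by apply: contra_eq_neq (bil_vac HB) => ->; rewrite bil0l. Qed.

Lemma L0_adj u v : bil (L 0 u) v = bil u (L 0 v).
Proof.
have E := @bil_inv _ _ _ _ _ HB om 2 1 1 u v (wt_om H) (L1_om H).
rewrite big_ord_recl big_ord0 addr0 /= fact0 invr1 mul1r in E.
by rewrite /Vir add0r E mul1r.
Qed.

Lemma bil_wt k l u v : wt k u -> wt l v -> k != l -> bil u v = 0.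
Proof.
move=> wu wv nkl; have := L0_adj u v; rewrite wu wv bilZl bilZr => /eqP.
by rewrite -subr_eq0 -mulrBl mulf_eq0 -rmorphB intr_eq0 subr_eq0 (negbTE nkl) => /eqP.
Qed.

Lemma wt0E v : wt 0 v -> v = bil v vac *: vac.
Proof.
move=> wv; have [v0 [_ [_ Hv0]]] := HV0.
have [q eq] : exists q : rat, v = q *: v0 by apply: Hv0; rewrite wv scale0r.
have [q0 eq0] : exists q : rat, vac = q *: v0 by apply: Hv0; rewrite (wt_vac H) scale0r.
have q0n : q0 != 0 by apply: contra_neq vac_neq0 => q00; rewrite eq0 q00 scale0r.
have e : v = (q / q0) *: vac by rewrite eq0 scalerA divfK.
by rewrite e bilZl (bil_vac HB) mulr1.
Qed.

(** The sl(2) relation [L(1), L(-1)] = 2 L(0), iterated on a lowest weight vector; the central term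
    vanishes for these indices. *)
Lemma L1_chain k v j : wt k v -> L 1 v = 0 ->
  L 1 (iter j.+1 (L (-1)) v) = (j.+1%:R * (2 * k%:~R + j%:R)) *: iter j (L (-1)) v.
Proof.
move=> wv v0.
have wti i : wt (k + i%:Z) (iter i (L (-1)) v).
  by elim: i => [|i IH]; rewrite ?addr0 //=; have := L_wt H (-1) IH; congr (wt _ _); lia.
have step w l : wt l w -> L 1 (L (-1) w) = L (-1) (L 1 w) + (2 * l%:~R) *: w.
  move=> ww; have [cc E] := voa_virasoro H; have := E 1 (-1) w.
  rewrite subrr ww /= !mul0r scale0r addr0 scalerA => /eqP.
  by rewrite subr_eq addrC => /eqP.
elim: j => [|j IH] /=; first by rewrite (step _ k) // v0 /Vir (Yr0 H) add0r addr0 mul1r.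
rewrite (step _ (k + j.+1%:Z)) //.
rewrite IH /Vir (YrZ H) -/(Vir Y om (-1) _) -scalerDl; congr (_ *: _).
by rewrite rmorphD /= -!pmulrn -!natr1; ring.
Qed.

(* A vector of minimal negative weight k is killed by L(1), so L(-1) raises it injectively until the
   chain reaches weight 0, where V_0 is spanned by the vacuum, which L(-1) kills. *)
Lemma wt_lt0 k v : k < 0 -> wt k v -> v = 0.
Proof.
have [N HN] := voa_bounded H.
suff H' m : forall k v, k < N + m%:Z -> k < 0 -> wt k v -> v = 0.
  by move=> k0; apply: (H' `|k - N|.+1%N) => //; lia.
elim: m {k v} => [|m IH] k v lk k0 wv; first by apply: (HN k) => //; rewrite addr0 in lk.
have L1v : L 1 v = 0 by apply: (IH (k - 1)); [lia|lia|exact: (L_wt H 1 wv)].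
apply/eqP/negPn/negP => v0.
have nz j : (j%:Z <= - k + 1) -> iter j (L (-1)) v != 0.
  elim: j => [|j IHj] // lj; apply: contra_neq (IHj _) => [e|]; last by lia.
  have /esym/eqP := L1_chain j wv L1v; rewrite /= in e; rewrite /= e /Vir (Yr0 H) scaler_eq0.
  case/orP => [|/eqP //]; rewrite mulf_eq0 pnatr_eq0 /= (_ : _ + _ = (2 * k + j%:Z)%:~R).
    by rewrite intr_eq0 => /eqP; lia.
  by rewrite rmorphD rmorphM.
have wti i : wt (k + i%:Z) (iter i (L (-1)) v).
  by elim: i => [|i IHi]; rewrite ?addr0 //=; have := L_wt H (-1) IHi; congr (wt _ _); lia.
have [i ki] : exists i : nat, k = - i%:Z by exists `|k|%N; lia.
have := wti i; rewrite ki addNr => /wt0E e.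
have : iter i.+1 (L (-1)) v != 0 by apply: nz; lia.
by rewrite /= e /Vir (YrZ H) -/(Vir Y om (-1) vac) (L_vac H) // scaler0 eqxx.
Qed.

Lemma Y_top k l a b n : wt k a -> wt l b -> k + l <= n -> Y a n b = 0.
Proof. by move=> wa wb ln; apply: wt_lt0 (wt_Y H n wa wb); lia. Qed.

Lemma L1_iter_wt k v j : wt k v -> wt (k - j%:Z) (iter j (L 1) v).
Proof.
move=> wv; elim: j => [|j IH]; first by rewrite subr0.
by have := L_wt H 1 IH; congr (wt _ _); lia.
Qed.

(** The sum can stop at j = h because L(1)^(h+1) a has negative weight. *)
Lemma bil_inv_wt (h : nat) a n b c : wt h a ->
  bil (Y a n b) c = (-1) ^+ h * \sum_(j < h.+1) (j`!%:R)^-1 *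
     bil b (Y (iter j (L 1) a) (2 * h%:Z - n - j%:Z - 2) c).
Proof.
move=> wa; apply: (bil_inv HB _ _ _ wa).
by apply: (wt_lt0 _ (L1_iter_wt h.+1 wa)); lia.
Qed.

(* By invariance of the form, <x_n w, 1> = <w, x'_(n') 1> with n' >= 0. *)
Lemma adj_vanish (h : nat) x n w : wt h x -> wt 0 (Y x n w) -> n <= h%:Z - 2 -> Y x n w = 0.
Proof.
move=> wx w0 len; rewrite (wt0E w0) (bil_inv_wt _ _ _ wx) big1 ?mulr0 ?scale0r // => j _.
rewrite (proj2 (voa_creation H _)) ?bil0r ?mulr0 //.
by have := ltn_ord j; lia.
Qed.

End Form.

(** * Projections onto the weight spaces *)

Section Projection.
Variables (V : lmodType rat) (Y : V -> int -> V -> V) (vac om : V).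
Hypothesis (H : is_VOA Y vac om).
Notation L n := (Vir Y om n).
Notation wt := (wt Y om).

Lemma wt_indep (ls : seq int) (u : int -> V) : uniq ls -> (forall l, wt l (u l)) ->
  \sum_(l <- ls) u l = 0 -> forall l, l \in ls -> u l = 0.
Proof.
elim: ls u => [|l0 ls IH] u //= /andP[l0n uls] wu; rewrite big_cons => e.
have Hls l : l \in ls -> u l = 0.
  move=> lin; have /eqP : (l - l0)%:~R *: u l = 0.
    apply: (IH (fun l => (l - l0)%:~R *: u l)) => // [l'|]; first exact: (wtZ H).
    have : L 0 (u l0 + \sum_(l <- ls) u l) - l0%:~R *: (u l0 + \sum_(l <- ls) u l) = 0.
      by rewrite e /Vir (Yr0 H) scaler0 subr0.
    rewrite {1}/Vir (YrD H) (Yr_sum H) scalerDr scaler_sumr -/(Vir Y om 0 _) wu opprD addrACA subrr add0r.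
    move=> e0; apply: etrans e0; rewrite -sumrB; apply: eq_bigr => l' _.
    by rewrite -/(Vir Y om 0 _) wu rmorphB scalerBl.
  rewrite scaler_eq0 intr_eq0 subr_eq0 => /orP[/eqP ll|/eqP //].
  by rewrite -ll lin in l0n.
move=> l; rewrite inE => /orP[/eqP ->|]; last exact: Hls.
by move: e; rewrite big_seq big1 ?addr0.
Qed.

Let homog (s : seq (int * V)) := forall p, p \in s -> wt p.1 p.2.

Let dec v : seq (int * V) := proj1_sig (constructive_indefinite_description _ (voa_grading H v)).
Let decP v : homog (dec v) /\ v = \sum_(p <- dec v) p.2.
Proof. exact: (proj2_sig (constructive_indefinite_description _ (voa_grading H v))). Qed.

(** Read off from a homogeneous decomposition picked by choice; [pr_unique] removes the dependence
    on it. *)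
Definition pr (k : int) (v : V) : V := \sum_(p <- dec v | p.1 == k) p.2.

Let wt_part k s : homog s -> wt k (\sum_(p <- s | p.1 == k) p.2).
Proof.
move=> hs; rewrite big_seq_cond; apply: (wt_sum H) => p /andP[/hs wp /eqP <-] //.
Qed.

Let sum_parts s (ls : seq int) : uniq ls -> {subset map fst s <= ls} ->
  \sum_(l <- ls) \sum_(p <- s | p.1 == l) p.2 = \sum_(p <- s) p.2 :> V.
Proof.
move=> uls sub; rewrite (exchange_big_dep xpredT) //= big_seq [RHS]big_seq.
apply: eq_bigr => p ps; have pl : p.1 \in ls by apply: sub; apply: map_f.
by rewrite -big_filter (@eq_filter _ _ (pred1 p.1)) ?filter_pred1_uniq ?big_seq1 // => l; rewrite /= eq_sym.
Qed.

Lemma pr_unique v (s : seq (int * V)) k : (forall p, p \in s -> wt p.1 p.2) ->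
  v = \sum_(p <- s) p.2 -> pr k v = \sum_(p <- s | p.1 == k) p.2.
Proof.
move=> hs ev; have [hd ed] := decP v.
pose ls := undup (k :: map fst s ++ map fst (dec v)).
have kin : k \in ls by rewrite mem_undup inE eqxx.
have uls : uniq ls by exact: undup_uniq.
apply/eqP; rewrite -subr_eq0; apply/eqP.
apply: (wt_indep (u := fun l => pr l v - \sum_(p <- s | p.1 == l) p.2) uls) => // [l|].
  by apply: (wtB H); exact: wt_part.
rewrite sumrB !sum_parts // -?ed -?ev ?subrr // => l lin; rewrite mem_undup inE mem_cat lin ?orbT //.
Qed.

Lemma pr_wt k v : wt k (pr k v). Proof. by apply: wt_part; case: (decP v). Qed.

Lemma pr_hom k l v : wt l v -> pr k v = if k == l then v else 0.
Proof.
move=> wv; rewrite (@pr_unique v [:: (l, v)] k) ?big_cons ?big_nil ?addr0 /= 1?eq_sym //.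
by move=> p; rewrite inE => /eqP ->.
Qed.

Lemma pr_lin k q u v : pr k (q *: u + v) = q *: pr k u + pr k v.
Proof.
have [hu eu] := decP u; have [hv ev] := decP v.
rewrite (@pr_unique _ ([seq (p.1, q *: p.2) | p <- dec u] ++ dec v)).
- by rewrite big_cat big_map /= /pr scaler_sumr.
- by move=> p; rewrite mem_cat => /orP[/mapP[p' /hu wp ->]|/hv //]; exact: (wtZ H).
- by rewrite big_cat big_map /= -scaler_sumr -eu -ev.
Qed.

Lemma prD k u v : pr k (u + v) = pr k u + pr k v.
Proof. by rewrite -{1}[u]scale1r pr_lin scale1r. Qed.
Lemma pr0 k : pr k 0 = 0.
Proof. by rewrite (pr_hom k (wt0 H k)) eqxx. Qed.
Lemma prZ k q u : pr k (q *: u) = q *: pr k u.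
Proof. by rewrite -[q *: u]addr0 pr_lin pr0 addr0. Qed.
Lemma prB k u v : pr k (u - v) = pr k u - pr k v.
Proof. by rewrite addrC -scaleN1r pr_lin scaleN1r addrC. Qed.
Lemma pr_sum k I (r : seq I) (Q : pred I) F :
  pr k (\sum_(i <- r | Q i) F i) = \sum_(i <- r | Q i) pr k (F i).
Proof. by apply: (big_morph (pr k)); [exact: prD | exact: pr0]. Qed.

Lemma pr_dec v : exists ls : seq int, uniq ls /\ v = \sum_(l <- ls) pr l v.
Proof.
have [hd ed] := decP v; exists (undup (map fst (dec v))); split; first exact: undup_uniq.
by rewrite {1}ed -(@sum_parts _ (undup (map fst (dec v)))) ?undup_uniq // => l; rewrite mem_undup.
Qed.

Lemma pr_P k (P : V -> Prop) G : subgroup P -> (forall v, G v -> P (pr k v)) ->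
  forall v, Zgen G v -> P (pr k v).
Proof.
move=> HP GP v Gv; apply: (Zgen_min (P := fun v => P (pr k v)) _ GP Gv).
by split=> [|u w Pu Pw]; rewrite ?pr0 ?prB; [exact: sg0 | exact: sgB].
Qed.

End Projection.

Section Automorphism.
Variables (V : lmodType rat) (Y : V -> int -> V -> V) (vac om : V).
Hypothesis (H : is_VOA Y vac om).
Variables (g : V -> V) (Hg : is_VOA_aut Y om g).
Notation wt := (wt Y om).

Lemma autD u v : g (u + v) = g u + g v.
Proof. by case: Hg => gl _ _ _; rewrite -{1}[u]scale1r gl scale1r. Qed.
Lemma aut0 : g 0 = 0.
Proof. by apply: (@addrI _ (g 0)); rewrite -autD !addr0. Qed.
Lemma autZ q u : g (q *: u) = q *: g u.
Proof. by case: Hg => gl _ _ _; rewrite -[q *: u]addr0 gl aut0 addr0. Qed.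
Lemma autN u : g (- u) = - g u.
Proof. by rewrite -scaleN1r autZ scaleN1r. Qed.
Lemma autB u v : g (u - v) = g u - g v.
Proof. by rewrite autD autN. Qed.
Lemma autMn u k : g (u *+ k) = g u *+ k.
Proof. by rewrite -!scaler_nat autZ. Qed.
Lemma autY a n b : g (Y a n b) = Y (g a) n (g b).
Proof. by case: Hg. Qed.
Lemma aut_sum I (r : seq I) (Q : pred I) F :
  g (\sum_(i <- r | Q i) F i) = \sum_(i <- r | Q i) g (F i).
Proof. by apply: (big_morph g); [exact: autD | exact: aut0]. Qed.

(** With f the inverse of g, g vac = (g vac)_(-1) g (f vac) = g (vac_(-1) (f vac)) = g (f vac) =
    vac. *)
Lemma aut_vac : g vac = vac.
Proof.
have [e _] := voa_creation H (g vac); rewrite -e.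
case: (Hg) => _ [f fK gK] gY _.
by rewrite -{2}(gK vac) -gY (voa_vacl H) eqxx gK.
Qed.

Lemma aut_wt k v : wt k v -> wt k (g v).
Proof.
case: (Hg) => _ _ gY gom; rewrite /wt /Vir -{2}gom -gY => ->.
by rewrite autZ.
Qed.

Lemma aut_pr k v : pr H k (g v) = g (pr H k v).
Proof.
have [ls [uls e]] := pr_dec H v.
rewrite {1}e aut_sum pr_sum.
rewrite (eq_bigr (fun l => if k == l then g (pr H l v) else 0)); last first.
  by move=> l _; apply: pr_hom; apply: aut_wt; exact: pr_wt.
case kin : (k \in ls).
  rewrite (bigD1_seq k) //= eqxx big1 ?addr0 // => l; rewrite eq_sym => /negbTE -> //.
rewrite big_seq big1 => [|l lin]; last by case: eqP => // kl; rewrite kl lin in kin.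
suff -> : pr H k v = 0 by rewrite aut0.
rewrite {1}e pr_sum big_seq big1 // => l lin; rewrite (pr_hom _ _ (pr_wt H l v)).
by case: eqP => // kl; rewrite kl lin in kin.
Qed.

End Automorphism.

(** * Correlators *)
Section TwoVariables.
Variable V : lmodType rat.
Implicit Type g : int -> int -> V.

(** [g m1 m2] is the coefficient of [z1^(-m1-1) z2^(-m2-1)]; [D2] is multiplication by [z1 - z2]. *)
Definition D2 g (m1 m2 : int) := g (m1 + 1) m2 - g m1 (m2 + 1).

Lemma D2_iterE k g m1 m2 : iter k D2 g m1 m2 =
  \sum_(t < k.+1) g (m1 + (k - t)%N%:Z) (m2 + t%:Z) *~ ((-1) ^+ t * 'C(k, t)%:Z).
Proof.
elim: k m1 m2 => [|k IH] m1 m2.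
  by rewrite big_ord_recl big_ord0 /= !addr0 mulr1z.
rewrite iterS /D2 !IH [RHS]big_ord_recl /= subn0 bin0 mulr1 expr0 mulr1z addr0.
rewrite big_ord_recl /= subn0 bin0 mulr1 expr0 mulr1z addr0 -[m1 + 1 + _]addrA (_ : 1 + k%:Z = k.+1); last by lia.
rewrite -addrA; congr (_ + _).
have -> : \sum_(i < k) g (m1 + 1 + (k - bump 0 i)%N%:Z) (m2 + (bump 0 i)%:Z) *~ ((-1) ^+ bump 0 i * 'C(k, bump 0 i)%:Z) =
  \sum_(i < k.+1) g (m1 + (k - i)%N%:Z) (m2 + i.+1%:Z) *~ ((-1) ^+ i.+1 * 'C(k, i.+1)%:Z).
  rewrite [RHS]big_ord_recr /= bin_small // mulr0 mulr0z addr0; apply: eq_bigr => i _.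
  have := ltn_ord i; rewrite /bump /= add1n => lti.
  by congr (_ *~ _); congr (g _ _); lia.
rewrite -sumrB; apply: eq_bigr => i _; rewrite /bump /= add1n subSS.
rewrite binS PoszD mulrDr mulrzDr; congr (_ + _).
by rewrite exprS mulN1r mulNr mulrNz; congr (- (_ *~ _)); congr (g _ _); lia.
Qed.

Lemma D2_ext g g' : (forall m1 m2, g m1 m2 = g' m1 m2) -> forall m1 m2, D2 g m1 m2 = D2 g' m1 m2.
Proof. by move=> e m1 m2; rewrite /D2 !e. Qed.

Lemma D2_iter_ext k g g' : (forall m1 m2, g m1 m2 = g' m1 m2) ->
  forall m1 m2, iter k D2 g m1 m2 = iter k D2 g' m1 m2.
Proof. by move=> e; elim: k => // k IH m1 m2; rewrite !iterS; exact: D2_ext. Qed.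

Lemma D2_iter_swap k g m1 m2 :
  iter k D2 (fun a b => g b a) m1 m2 = iter k D2 g m2 m1 *~ (-1) ^+ k.
Proof.
elim: k m1 m2 => [|k IH] m1 m2 //; rewrite !iterS {1}/D2 !IH exprS mulN1r mulrNz.
by rewrite /D2 -mulrzBl -mulNrz opprB.
Qed.

(** The coefficient at modes (m0, n0) of (z1 - z2)^k g, where (z1 - z2)^k, k possibly negative, is
    expanded in nonnegative powers of z2 and cut after T terms. *)
Definition tail_sum (T : nat) (k m0 n0 : int) g : V :=
  \sum_(t < T) ((-1) ^+ t * binz k t) *: g (m0 + k - t%:Z) (n0 + t%:Z).

Lemma tail_sum_D2 T k m0 n0 g : (forall m1 m2, n0 + T%:Z <= m2 -> g m1 m2 = 0) ->
  tail_sum T (k + 1) m0 n0 g = tail_sum T k m0 n0 (D2 g).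
Proof.
case: T => [|T] gT; first by rewrite /tail_sum !big_ord0.
rewrite /tail_sum /D2; under [RHS]eq_bigr do rewrite scalerBr.
rewrite sumrB big_ord_recl [X in _ = X - _]big_ord_recl.
rewrite [X in _ = _ - X]big_ord_recr /= [g _ (n0 + T%:Z + 1)]gT; last by lia.
rewrite scaler0 addr0 !binz0 -[RHS]addrA; congr (_ + _).
  by congr (_ *: g _ _); lia.
rewrite addr0 -sumrB; apply: eq_bigr => t _; rewrite /bump /= add1n binz_pascal mulrDr scalerDl.
congr (_ + _); first by congr (_ *: g _ _); lia.
by rewrite exprS mulN1r mulNr scaleNr; congr (- (_ *: g _ _)); lia.
Qed.

Lemma tail_sum_D2_iter T k m0 n0 g P : (forall m1 m2, n0 + T%:Z <= m2 -> g m1 m2 = 0) ->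
  tail_sum T (k + P%:Z) m0 n0 g = tail_sum T k m0 n0 (iter P D2 g).
Proof.
elim: P k => [|P IH] k gT; first by rewrite addr0.
rewrite (_ : k + P.+1%:Z = (k + 1) + P%:Z); last by lia.
rewrite IH // tail_sum_D2 -?iterS // => m1 m2 l2.
by rewrite D2_iterE big1 // => t _; rewrite gT ?mul0rz //; lia.
Qed.

End TwoVariables.

Section Locality.
Variables (V : lmodType rat) (Y : V -> int -> V -> V) (vac om : V).
Hypothesis H : is_VOA Y vac om.
Variables (P : nat) (evP : ~~ odd P).

Let sgnPQ : (-1 : rat) ^ P%:Z = 1.
Proof. by rewrite -exprnP -signr_odd (negbTE evP). Qed.

(** Borcherds' identity with k = P: the side with products of a and b vanishes, and as P is even,
    reversing the other sum brings no sign. *)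
Lemma weak_comm a b c m1 m2 : (forall n : int, P%:Z <= n -> Y a n b = 0) ->
  iter P (@D2 V) (fun m1 m2 => Y a m1 (Y b m2 c)) m1 m2 =
  iter P (@D2 V) (fun m1 m2 => Y b m2 (Y a m1 c)) m1 m2.
Proof.
move=> loc; have [T0 HT] := borcherds_ev H a b c m1 P%:Z m2.
have := HT (T0 + P.+1)%N (leq_addr _ _).
rewrite big1 => [|i _]; last by rewrite loc ?(Yl0 H) ?scaler0 //; lia.
move/esym; rewrite [\sum_(i < T0 + P.+1) _](_ : _ = \sum_(i < P.+1) ((-1) ^+ i * 'C(P, i)%:R) *:
  (Y a (m1 + P%:Z - i%:Z) (Y b (m2 + i%:Z) c) - Y b (m2 + P%:Z - i%:Z) (Y a (m1 + i%:Z) c))); last first.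
  rewrite addnC big_split_ord /= [X in _ + X]big1 ?addr0 => [|i _].
    by apply: eq_bigr => i _; rewrite binz_nat sgnPQ scale1r.
  by rewrite binz_nat bin_small ?mulr0 ?scale0r //; lia.
under eq_bigr do rewrite scalerBr.
rewrite sumrB => /eqP; rewrite subr_eq0 => /eqP E; rewrite !D2_iterE.
have coef i : (-1) ^+ i * 'C(P, i)%:R = ((-1) ^+ i * 'C(P, i)%:Z)%:~R :> rat.
  by rewrite rmorphM rmorphXn rmorphN.
transitivity (\sum_(i < P.+1) ((-1) ^+ i * 'C(P, i)%:R) *: Y a (m1 + P%:Z - i%:Z) (Y b (m2 + i%:Z) c)).
  apply: eq_bigr => i _; rewrite coef scaler_int; congr (Y _ _ _ *~ _).
  by have := ltn_ord i; lia.
rewrite E (reindex_inj rev_ord_inj) /=; apply: eq_bigr => i _; have li := ltn_ord i.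
rewrite coef scaler_int subSS bin_sub -1?ltnS //; congr (_ *~ (_ * _)).
  by congr (Y _ _ (Y _ _ _)); lia.
by rewrite -[LHS]signr_odd oddB -1?ltnS // (negbTE evP) addFb signr_odd.
Qed.

Lemma borcherds_list a b (al : seq (int * (nat * nat) * V)) (k n0 : int) :
  exists T0 : nat, forall T : nat, (T0 <= T)%N -> forall p, p \in al ->
    [/\ \sum_(i < T) binz p.1.2.1%:Z i *: Y (Y a (k + i%:Z) b) (p.1.2.1%:Z + (n0 + p.1.2.2%:Z) - i%:Z) p.2 =
      \sum_(i < T) ((-1) ^+ i * binz k i) *:
        (Y a (p.1.2.1%:Z + k - i%:Z) (Y b (n0 + p.1.2.2%:Z + i%:Z) p.2)
        - ((-1 : rat) ^ k) *: Y b (n0 + p.1.2.2%:Z + k - i%:Z) (Y a (p.1.2.1%:Z + i%:Z) p.2)),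
      (p.1.2.1 < T)%N,
      (forall n : int, n0 + T%:Z <= n -> Y b (n + p.1.2.2%:Z) p.2 = 0) &
      (forall n : int, T%:Z <= n -> Y a (n + p.1.2.1%:Z) p.2 = 0)].
Proof.
elim: al => [|[[c [a1 a2]] v] al [T1 H1]]; first by exists 0%N.
have [T2 H2] := borcherds_ev H a b v a1%:Z k (n0 + a2%:Z).
have [T3 H3] := trunc_nat H b v n0; have [T4 H4] := trunc_nat H a v 0.
exists (T1 + T2 + T3 + T4 + a1.+1)%N => T lT p'; rewrite inE => /orP[/eqP ->|pin]; last first.
  by apply: H1 => //; apply: leq_trans lT; rewrite -!addnA leq_addr.
have [l2 l3 l4 l1] : [/\ (T2 <= T)%N, (T3 <= T)%N, (T4 <= T)%N & (a1 < T)%N] by clear -lT; split; lia.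
split=> //=; first exact: H2.
- move=> n ln; have [i ei li] : exists2 i : nat, n + a2%:Z = n0 + i%:Z & (T3 <= i)%N.
    by exists (absz (n + a2%:Z - n0)%R); lia.
  by rewrite ei H3.
- move=> n ln; have [i ei li] : exists2 i : nat, n + a1%:Z = 0 + i%:Z & (T4 <= i)%N.
    by exists (absz (n + a1%:Z)%R); lia.
  by rewrite ei H4.
Qed.

(** The left side is the coefficient of z2^(A-i0) in the divided z1-derivative of order i0 of (z1 -
    z2)^P g along z1 = z2. It is a residue of (z1 - z2)^(P-1-i0) g, computed by Borcherds' identity;
    the expansion in powers of z1 / z2 contributes nothing because (z1 - z2)^P g has no negative
    powers of z1. *)
Lemma collapse2 a b (al : seq (int * (nat * nat) * V)) :
  (forall n : int, P%:Z <= n -> Y a n b = 0) ->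
  let g m1 m2 := \sum_(p <- al) Y a (m1 + p.1.2.1%:Z) (Y b (m2 + p.1.2.2%:Z) p.2) *~ p.1.1 in
  (forall m1 m2, 0 <= m1 -> iter P (@D2 V) g m1 m2 = 0) ->
  (forall m1 m2, 0 <= m2 -> iter P (@D2 V) g m1 m2 = 0) ->
  forall A i0 : nat,
  \sum_(e < A.+1) iter P (@D2 V) g (- e%:Z - 1) (- (A - e)%N%:Z - 1) *~ 'C(e, i0)%:Z =
  \sum_(p <- al) (\sum_(t < p.1.2.1.+1)
     Y (Y a (P%:Z - 1 - i0%:Z + t%:Z) b) (p.1.2.1%:Z + (i0%:Z - A%:Z - 1) + p.1.2.2%:Z - t%:Z) p.2
       *~ 'C(p.1.2.1, t)%:Z) *~ p.1.1.
Proof.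
move=> loc g Z1 Z2 A i0; pose n0 : int := i0%:Z - A%:Z - 1; pose k : int := -1 - i0%:Z.
pose g' m1 m2 := \sum_(p <- al) Y b (m2 + p.1.2.2%:Z) (Y a (m1 + p.1.2.1%:Z) p.2) *~ p.1.1.
have gg' m1 m2 : iter P (@D2 V) g m1 m2 = iter P (@D2 V) g' m1 m2.
  rewrite !D2_iterE /g /g'.
  under eq_bigr do rewrite mulrz_suml; under [RHS]eq_bigr do rewrite mulrz_suml.
  rewrite exchange_big [RHS]exchange_big; apply: eq_bigr => p _ /=.
  have := weak_comm p.2 (m1 + p.1.2.1%:Z) (m2 + p.1.2.2%:Z) loc.
  rewrite !D2_iterE => /(congr1 (fun v => v *~ p.1.1)); rewrite !mulrz_suml.
  move=> E; have {}E := E; apply: etrans (etrans _ E) _; last first.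
  - by apply: eq_bigr => t _; rewrite mulrzAC (addrAC m1) (addrAC m2).
  - by apply: eq_bigr => t _; rewrite mulrzAC (addrAC m1) (addrAC m2).
have [T0 HT] := borcherds_list a b al (k + P%:Z) n0.
pose T := (T0 + A.+1)%N; have {HT} HT p : p \in al -> _ := HT T (leq_addr _ _) p.
have gT m1 m2 : n0 + T%:Z <= m2 -> g m1 m2 = 0.
  move=> l2; rewrite /g big_seq big1 // => p /HT[_ _ Hb _].
  by rewrite Hb // (Yr0 H) mul0rz.
have g'T m1 m2 : T%:Z <= m1 -> g' m1 m2 = 0.
  move=> l2; rewrite /g' big_seq big1 // => p /HT[_ _ _ Ha].
  by rewrite Ha // (Yr0 H) mul0rz.
transitivity (tail_sum T (k + P%:Z) 0 n0 g - (-1 : rat) ^ (k + P%:Z) *: tail_sum T (k + P%:Z) n0 0 (fun m1 m2 => g' m2 m1)).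
  rewrite !tail_sum_D2_iter; last 2 first.
  - by move=> m1 m2; rewrite add0r; exact: g'T.
  - exact: gT.
  have -> : tail_sum T k n0 0 (iter P (@D2 V) (fun m1 m2 => g' m2 m1)) = 0.
    rewrite /tail_sum big1 // => t _; rewrite D2_iter_swap -gg' Z1 ?mul0rz ?scaler0 //; lia.
  rewrite scaler0 subr0 /tail_sum.
  transitivity (\sum_(i0 <= e < i0 + T) iter P (@D2 V) g (- e%:Z - 1) (e%:Z - A%:Z - 1) *~ 'C(e, i0)%:Z).
    transitivity (\sum_(0 <= e < i0 + T) iter P (@D2 V) g (- e%:Z - 1) (e%:Z - A%:Z - 1) *~ 'C(e, i0)%:Z).
      have lA : (A.+1 <= i0 + T)%N by rewrite /T; lia.
      rewrite (big_cat_nat (n := A.+1)) //= [X in _ + X]big_seq [X in _ + X]big1 ?addr0 => [|e]; last first.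
        by rewrite mem_index_iota => /andP[l1 _]; rewrite Z2 ?mul0rz //; lia.
      rewrite big_mkord; apply: eq_bigr => e _; have := ltn_ord e => le.
      by congr (iter _ _ _ _ _ *~ _); lia.
    rewrite (big_cat_nat (n := i0)) //= ?leq_addr // big_seq big1 ?add0r // => e.
    by rewrite mem_index_iota => /andP[_ l1]; rewrite bin_small // mulr0z.
  rewrite -{1}[i0]add0n big_addn addnC addnK big_mkord; apply: eq_bigr => t _.
  rewrite /k (_ : -1 - i0%:Z = - i0.+1%:Z); last by lia.
  rewrite binz_neg mulrA -exprMn mulrNN mulr1 expr1n mul1r.
  rewrite -[_%:R]/(_%:Z%:~R) scaler_int addnC -{1}[X in 'C(_, X)](addnK t i0) bin_sub ?leq_addl //.
  by congr (iter _ _ _ _ _ *~ _); rewrite /n0; lia.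
rewrite /tail_sum scaler_sumr -sumrB.
transitivity (\sum_(t < T) \sum_(p <- al) (((-1) ^+ t * binz (k + P%:Z) t) *:
        (Y a (p.1.2.1%:Z + (k + P%:Z) - t%:Z) (Y b (n0 + p.1.2.2%:Z + t%:Z) p.2)
        - ((-1 : rat) ^ (k + P%:Z)) *: Y b (n0 + p.1.2.2%:Z + (k + P%:Z) - t%:Z) (Y a (p.1.2.1%:Z + t%:Z) p.2))) *~ p.1.1).
  apply: eq_bigr => t _; rewrite [X in _ - X]scalerA [X in _ - X *: _]mulrC -[X in _ - X]scalerA -scalerBr /g /g' scaler_sumr.
  rewrite -sumrB scaler_sumr; apply: eq_bigr => p _.
  rewrite -!scaler_int [X in _ - X]scalerA [X in _ - X *: _]mulrC -[X in _ - X]scalerA -scalerBr !scalerA mulrC.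
  congr (_ *: (Y _ _ (Y _ _ _) - _ *: Y _ _ (Y _ _ _))); lia.
rewrite exchange_big big_seq [RHS]big_seq; apply: eq_bigr => p /HT[E lT _ _].
rewrite -mulrz_suml -E; congr (_ *~ _).
rewrite (big_ord_widen T (fun t => Y (Y a (P%:Z - 1 - i0%:Z + t%:Z) b)
   (p.1.2.1%:Z + (i0%:Z - A%:Z - 1) + p.1.2.2%:Z - t%:Z) p.2 *~ 'C(p.1.2.1, t)%:Z) lT) [RHS]big_mkcond /=.
apply: eq_bigr => t _; rewrite binz_nat; case: ltnP => [lt|lt]; last by rewrite bin_small // scale0r.
rewrite -[_%:R]/(_%:Z%:~R) scaler_int; congr (Y (Y _ _ _) _ _ *~ _); rewrite /k /n0; lia.
Qed.

End Locality.

Section Correlator.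
Variables (V : lmodType rat) (Y : V -> int -> V -> V) (vac om : V).
Hypothesis H : is_VOA Y vac om.
Variables (P : nat) (evP : ~~ odd P) (x : nat -> V).
Hypothesis loc : forall i j (n : int), P%:Z <= n -> Y (x i) n (x j) = 0.

Implicit Types (n : nat -> int) (F G : (nat -> int) -> V) (i j k l : nat) (s : seq nat).

(** A family [F n], with [n] assigning a mode to each label, stands for the formal series
    [sum_n F n prod_i z_i^(-n_i-1)].  [Dop i j] is multiplication by [z_i - z_j], [DP] by its [P]-th power,
    and [corr s] is [prod (z_i - z_j)^P] applied to the product of the fields [x i], [i] in [s], on the vacuum. *)
Definition sh i n : nat -> int := fun l => n l + (l == i)%:Z.
Definition nadd n (a : nat -> nat) : nat -> int := fun l => n l + (a l)%:Z.
Definition upd i j (m1 m2 : int) n : nat -> int :=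
  fun l => if l == i then m1 else if l == j then m2 else n l.

Definition Dop i j F n := F (sh i n) - F (sh j n).
Definition DP i j F := iter P (Dop i j) F.
Definition DD i s F := foldr (fun j F => DP i j F) F s.

Fixpoint corr s n : V :=
  if s is i :: s' then DD i s' (fun n => Y (x i) (n i) (corr s' n)) n else vac.

Fixpoint word s n : V := if s is i :: s' then Y (x i) (n i) (word s' n) else vac.

Lemma sh_comm i j n : sh i (sh j n) = sh j (sh i n).
Proof. by apply: functional_extensionality => l; rewrite /sh addrAC. Qed.

Lemma Dop_comm i j k l F : Dop i j (Dop k l F) = Dop k l (Dop i j F).
Proof.
apply: functional_extensionality => n; rewrite /Dop (sh_comm k i) (sh_comm k j) (sh_comm l i) (sh_comm l j).
by rewrite !opprB addrACA [RHS]addrACA; congr (_ + _); exact: addrC.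
Qed.

Lemma iter_Dop_comm i j k l F m : iter m (Dop i j) (Dop k l F) = Dop k l (iter m (Dop i j) F).
Proof. by elim: m => // m IH; rewrite !iterS IH Dop_comm. Qed.

Lemma DP_comm i j k l F : DP i j (DP k l F) = DP k l (DP i j F).
Proof.
rewrite /DP; elim: {2 3}P => // m IH; rewrite !iterS iter_Dop_comm; congr (Dop _ _ _); exact: IH.
Qed.

Lemma DP_DD i j k s F : DP i j (DD k s F) = DD k s (DP i j F).
Proof. by elim: s => //= l s IH; rewrite DP_comm IH. Qed.

Lemma DD_comm i j s s' F : DD i s (DD j s' F) = DD j s' (DD i s F).
Proof. by elim: s => //= k s IH; rewrite IH DP_DD. Qed.

Lemma DD_perm i s s' F : perm_eq s s' -> DD i s F = DD i s' F.
Proof.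
elim: s s' => [|j s IH] s' /=.
  by rewrite perm_sym => /perm_nilP ->.
move=> pss'; have js' : j \in s' by rewrite -(perm_mem pss') mem_head.
have {}pss' : perm_eq s (rem j s') by rewrite -(perm_cons j) (permPl pss') perm_to_rem.
rewrite (IH _ pss').
elim: s' js' {s IH pss'} => //= k s' IH; rewrite inE eq_sym; case: eqVneq => [->|nkj] //=.
by move=> /IH <-; rewrite DP_comm.
Qed.

Lemma Dop_outer a i j k G : i != j -> i != k ->
  Dop j k (fun n => Y a (n i) (G n)) = fun n => Y a (n i) (Dop j k G n).
Proof.
move=> nij nik; apply: functional_extensionality => n; rewrite /Dop (YrB H) {1 3}/sh.
by rewrite (negbTE nij) (negbTE nik) !addr0.
Qed.

Lemma DD_outer a i j s G : i != j -> i \notin s ->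
  DD j s (fun n => Y a (n i) (G n)) = fun n => Y a (n i) (DD j s G n).
Proof.
move=> nij; elim: s => //= k s IH; rewrite inE negb_or => /andP[nik nis].
rewrite IH // /DP; elim: P => // m IHm; rewrite !iterS IHm Dop_outer //.
Qed.

Lemma Dop_upd m i j F n : i != j ->
  iter m (Dop i j) F n = iter m (@D2 V) (fun m1 m2 => F (upd i j m1 m2 n)) (n i) (n j).
Proof.
move=> nij; suff E m1 m2 : iter m (Dop i j) F (upd i j m1 m2 n) =
    iter m (@D2 V) (fun m1 m2 => F (upd i j m1 m2 n)) m1 m2.
  rewrite -E; congr (iter _ _ _ _); apply: functional_extensionality => l.
  by rewrite /upd; case: eqVneq => [->//|_]; case: eqVneq => [->//|_].
elim: m m1 m2 => // m IH m1 m2; rewrite !iterS /D2 -!IH /Dop.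
congr (_ - _); congr (iter m _ F _); apply: functional_extensionality => l; rewrite /sh /upd.
  by case: eqVneq => // _; rewrite addr0.
case: (eqVneq l i) => [->|_]; first by rewrite (negbTE nij) addr0.
by case: eqVneq => // _; rewrite addr0.
Qed.

Definition agree s n n' := forall l, l \in s -> n l = n' l.

Lemma DD_agree i s s0 F : (forall n n', agree s0 n n' -> F n = F n') ->
  forall n n', agree s0 n n' -> DD i s F n = DD i s F n'.
Proof.
move=> HF; elim: s => //= j s IH; rewrite /DP; elim: P => // m IHm n n' a; rewrite !iterS /Dop.
by congr (_ - _); apply: IHm => l ls; rewrite /sh a.
Qed.

Lemma corr_agree s n n' : agree s n n' -> corr s n = corr s n'.
Proof.
elim: s n n' => // i s IH n n' /=; apply: DD_agree => {}n {}n' a.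
by rewrite (IH n n') ?(a i) ?mem_head // => l ls; apply: a; rewrite inE ls orbT.
Qed.

(** The factor (z_i - z_j)^P is exactly what weak commutativity of the two fields requires; the
    remaining factors commute with everything. *)
Lemma corr_swap i j s : i != j -> i \notin s -> j \notin s -> corr [:: i, j & s] = corr [:: j, i & s].
Proof.
move=> nij nis njs.
have E k l : k != l -> k \notin s -> corr [:: k, l & s] =
    DP k l (DD k s (DD l s (fun n => Y (x k) (n k) (Y (x l) (n l) (corr s n))))).
  move=> nkl nks; apply: functional_extensionality => n /=.
  by rewrite (DD_outer _ (i := k) (j := l)).
rewrite !E //; last by rewrite eq_sym.
rewrite (DD_comm j) !DP_DD; congr (DD _ _ (DD _ _ _)); apply: functional_extensionality => n.
have nji : j != i by rewrite eq_sym.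
rewrite /DP !Dop_upd //.
have eupd (m1 m2 : int) : upd j i m1 m2 n = upd i j m2 m1 n.
  apply: functional_extensionality => l; rewrite /upd; case: (eqVneq l j) => // ->.
  by rewrite (negbTE nji).
transitivity (iter P (@D2 V) (fun m1 m2 => Y (x i) m1 (Y (x j) m2 (corr s n))) (n i) (n j)).
  apply: D2_iter_ext => m1 m2; rewrite {1 2}/upd eqxx (negbTE nji) eqxx; congr (Y _ _ (Y _ _ _)).
  by apply: corr_agree => l ls; rewrite /upd; case: eqVneq => [el|_]; [|case: eqVneq => // el];
    rewrite -el ls in nis njs *.
rewrite (weak_comm H evP (corr s n) (n i) (n j) (loc i j)).
have /= := D2_iter_swap P (fun m1 m2 => Y (x j) m2 (Y (x i) m1 (corr s n))) (n j) (n i).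
rewrite -signr_odd (negbTE evP) expr0 mulr1z => <-.
apply: D2_iter_ext => m1 m2; rewrite {1 2}/upd eqxx (negbTE nij) eqxx; congr (Y _ _ (Y _ _ _)).
by apply: corr_agree => l ls; rewrite /upd; case: eqVneq => [el|_]; [|case: eqVneq => // el];
  rewrite -el ls in nis njs *.
Qed.

Lemma corr_front s i : uniq s -> i \in s -> corr s = corr (i :: rem i s).
Proof.
elim: s => // j s IH; rewrite cons_uniq inE => /andP[njs us]; rewrite eq_sym.
case: (eqVneq j i) => [-> _|nji ins]; first by congr corr; rewrite /= eqxx.
have -> : rem i (j :: s) = j :: rem i s by rewrite /= (negbTE nji).
rewrite -(corr_swap nji); last 2 first.
- by rewrite mem_rem_uniq // inE /= (negbTE njs) andbF.
- by rewrite mem_rem_uniq // inE /= eqxx.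
apply: functional_extensionality => n /=.
by rewrite IH // (DD_perm j _ (perm_to_rem ins)).
Qed.

Lemma corr_perm s s' : uniq s -> perm_eq s s' -> corr s = corr s'.
Proof.
elim: s s' => [|i s IH] s'; first by rewrite perm_sym => _ /perm_nilP ->.
move=> /= /andP[nis us] pss'; have us' : uniq s' by rewrite -(perm_uniq pss') /= nis.
have is' : i \in s' by rewrite -(perm_mem pss') mem_head.
have ps : perm_eq s (rem i s') by rewrite -(perm_cons i) (permPl pss') perm_to_rem.
rewrite (corr_front us' is') /=; apply: functional_extensionality => n /=.
by rewrite (IH _ us ps) (DD_perm i _ ps).
Qed.

Lemma DD_vanish i s F n : (forall n', (forall l, n l <= n' l) -> F n' = 0) -> DD i s F n = 0.
Proof.
elim: s F n => [|j s IH] F n Fn /=; first exact: Fn.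
rewrite /DP; elim: P n Fn => [|m IHm] n Fn; first exact: IH.
rewrite iterS /Dop !IHm ?subr0 // => n' le; apply: Fn => l; apply: le_trans (le l);
  by rewrite /sh lerDl.
Qed.

(** By symmetry some other label can be brought to the front, until i alone stands next to the
    vacuum and the creation axiom applies. Hence correlators have no negative powers in any
    variable. *)
Lemma corr_vanish s i n : uniq s -> i \in s -> 0 <= n i -> corr s n = 0.
Proof.
elim: {s}(size s) {-2}s (leqnn (size s)) n => [|m IH] [|j s] // ls n us ins ni.
case: (altP (s =P [:: ])) => [s0|s0].
  by move: ins; rewrite s0 inE => /eqP <-; apply: (proj2 (voa_creation H _)).
suff [k kj ks] : exists2 k, k != i & k \in j :: s.
  rewrite (corr_front us ks) /=; apply: DD_vanish => n' len.
  rewrite IH ?(Yr0 H) //.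
  - by have := size_rem ks; rewrite /= => ->.
  - exact: (rem_uniq k us).
  - by have := mem_rem_uniq k us i; rewrite /= => ->; rewrite inE ins andbT eq_sym.
  - exact: le_trans (len i).
case: (eqVneq j i) => [eji|nji]; last by exists j; rewrite ?mem_head.
case: s s0 us {ls ins} => // k s _ us; exists k; last by rewrite !inE eqxx orbT.
by move: us; rewrite /= inE negb_or -eji eq_sym => /andP[/andP[]].
Qed.

(** Division by z_i - z_j, expanded in powers of z_j / z_i: each step lowers the mode of i and
    raises that of j, and the process ends once the latter is nonnegative. *)
Lemma Dop_inv i j F : i != j -> (forall n, 0 <= n j -> F n = 0) ->
  forall n, Zgen (fun v => exists n', v = Dop i j F n') (F n).
Proof.
move=> nij F0 n; pose m := absz (n j); have lm : - m%:Z <= n j by rewrite /m; lia.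
move: m lm => m; elim: m n => [|m IH] n lm; first by rewrite F0; [exact: Zgen0 | move: lm; rewrite oppr0].
case: (lerP 0 (n j)) => [n0|nj]; first by rewrite F0 //; exact: Zgen0.
pose n1 : nat -> int := fun l => n l - (l == i)%:Z.
have e1 : sh i n1 = n by apply: functional_extensionality => l; rewrite /sh /n1 subrK.
have -> : F n = Dop i j F n1 + F (sh j n1) by rewrite /Dop e1 subrK.
apply: (sgD (Zgen_subgroup _)); first by apply: Zgen_in; exists n1.
by apply: IH; rewrite /sh /n1 eqxx eq_sym (negbTE nij); lia.
Qed.

Lemma DD_inv i s F : i \notin s -> (forall j n, j \in s -> 0 <= n j -> F n = 0) ->
  forall n, Zgen (fun v => exists n', v = DD i s F n') (F n).
Proof.
elim: s F => [|j s IH] F /=; first by move=> _ _ n; apply: Zgen_in; exists n.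
rewrite inE negb_or => /andP[nij nis] F0 n.
have := IH F nis _ n; move/(_ (fun k n ks => F0 k n (mem_behead (s := j :: s) ks))).
apply: Zgen_mono => _ [n' ->].
have G0 n1 : 0 <= n1 j -> DD i s F n1 = 0.
  by move=> l1; apply: DD_vanish => n2 l2; apply: (F0 j); rewrite ?mem_head //; exact: le_trans (l2 j).
rewrite /DP; elim: P n' => [|m IHm] n'; first by apply: Zgen_in; exists n'.
have := IHm n'; apply: Zgen_mono => _ [n2 ->]; apply: Dop_inv => // n3.
elim: m {IHm} n3 => [|m IHm] n3 l3; first exact: G0.
by rewrite /= /Dop !IHm ?subr0 // /sh; lia.
Qed.

(** The factors (z_i - z_j)^P are divided out label by label, which is possible because the inner
    correlator vanishes at nonnegative modes. *)
Lemma word_corr s : uniq s -> forall n, Zgen (fun v => exists n', v = corr s n') (word s n).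
Proof.
elim: s => [|i s IH] /=; first by move=> _ n; apply: Zgen_in; exists n.
move=> /andP[nis us] n.
have : Zgen (fun v => exists n', v = Y (x i) (n' i) (corr s n')) (Y (x i) (n i) (word s n)).
  pose Q u := Zgen (fun v => exists n', v = Y (x i) (n' i) (corr s n')) (Y (x i) (n i) u).
  move: (IH us n); apply: (@Zgen_min _ _ Q) => [|_ [n' ->]]; rewrite /Q.
    split=> [|u v Hu Hv]; first by rewrite (Yr0 H); exact: Zgen0.
    by rewrite (YrB H); exact: ZgenB.
  apply: Zgen_in; exists (fun l => if l == i then n i else n' l); rewrite eqxx; congr (Y _ _ _).
  by apply: corr_agree => l ls; case: eqVneq => // el; rewrite -el ls in nis.
apply: Zgen_mono => _ [n' ->].
apply: (DD_inv (F := fun n => Y (x i) (n i) (corr s n)) nis) => j n1 js n10.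
by rewrite (corr_vanish us js) // (Yr0 H).
Qed.

Lemma op_exp i s : exists al : seq (int * (nat -> nat)),
  forall F n, DD i s F n = \sum_(p <- al) F (nadd n p.2) *~ p.1.
Proof.
have n0 n : nadd n (fun=> 0%N) = n by apply: functional_extensionality => l; rewrite /nadd addr0.
have step k (Op : ((nat -> int) -> V) -> (nat -> int) -> V) :
    (exists al : seq (int * (nat -> nat)), forall F n, Op F n = \sum_(p <- al) F (nadd n p.2) *~ p.1) ->
  exists al : seq (int * (nat -> nat)), forall F n, Dop i k (Op F) n = \sum_(p <- al) F (nadd n p.2) *~ p.1.
  move=> [al Hal].
  exists ([seq (p.1, fun l => (p.2 l + (l == i))%N) | p <- al] ++ [seq (- p.1, fun l => (p.2 l + (l == k))%N) | p <- al]).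
  move=> F n; rewrite /Dop !Hal big_cat !big_map /=; congr (_ + _).
    by apply: eq_bigr => p _; congr (F _ *~ _); apply: functional_extensionality => l; rewrite /nadd /sh; lia.
  rewrite -sumrN; apply: eq_bigr => p _; rewrite mulrNz; congr (- (F _ *~ _)).
  by apply: functional_extensionality => l; rewrite /nadd /sh PoszD addrAC addrA.
elim: s => [|k s IH] /=.
  by exists [:: (1, fun=> 0%N)] => F n; rewrite big_seq1 n0 mulr1z.
by rewrite /DP; elim: P => [|m IHm] //; apply: step.
Qed.

(* Taylor expansion of [(z_i - z_j)^P x_i(z_i) x_j(z_j)] along [z_i = z_j]. *)
Lemma collapse i j s A i0 : i != j -> i \notin s -> j \notin s -> uniq s ->
  exists be : seq (int * (nat * int) * (nat -> nat)), forall n,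
   \sum_(e < A.+1) corr [:: i, j & s] (upd i j (- e%:Z - 1) (- (A - e)%N%:Z - 1) n) *~ 'C(e, i0)%:Z =
    \sum_(b <- be) Y (Y (x i) (P%:Z - 1 - (i0 - b.1.2.1)%N%:Z) (x j)) b.1.2.2 (corr s (nadd n b.2)) *~ b.1.1.
Proof.
move=> nij nis njs us; have nji : j != i by rewrite eq_sym.
have [al Hal] := op_exp i s; have [al' Hal'] := op_exp j s.
pose al2 : seq (int * (nat -> nat)) :=
  [seq (p.1 * p'.1, fun l => (p.2 l + p'.2 l)%N) | p <- al, p' <- al'].
have H2 F n : DD i s (DD j s F) n = \sum_(p <- al2) F (nadd n p.2) *~ p.1.
  rewrite Hal big_allpairs_dep; apply: eq_bigr => p _; rewrite Hal' mulrz_suml.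
  apply: eq_bigr => p' _; rewrite mulrC mulrzA; congr (F _ *~ _ *~ _).
  by apply: functional_extensionality => l; rewrite /nadd PoszD addrA.
pose be1 (p : int * (nat -> nat)) : seq (int * (nat * int) * (nat -> nat)) :=
  [seq (p.1 * 'C(p.2 i, t)%:Z, (t, (p.2 i)%:Z + (i0%:Z - A%:Z - 1) + (p.2 j)%:Z - t%:Z), p.2) |
     t <- iota 0 (p.2 i).+1 & (t <= i0)%N].
exists (flatten (map be1 al2)) => n.
pose gl : seq (int * (nat * nat) * V) := [seq (p.1, (p.2 i, p.2 j), corr s (nadd n p.2)) | p <- al2].
pose g m1 m2 := \sum_(p <- gl) Y (x i) (m1 + p.1.2.1%:Z) (Y (x j) (m2 + p.1.2.2%:Z) p.2) *~ p.1.1.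
have corrE m1 m2 : corr [:: i, j & s] (upd i j m1 m2 n) = iter P (@D2 V) g m1 m2.
  have -> : corr [:: i, j & s] = DP i j (DD i s (DD j s (fun n => Y (x i) (n i) (Y (x j) (n j) (corr s n))))).
    by apply: functional_extensionality => n' /=; rewrite (DD_outer _ (i := i) (j := j)).
  have ui : upd i j m1 m2 n i = m1 by rewrite /upd eqxx.
  have uj : upd i j m1 m2 n j = m2 by rewrite /upd (negbTE nji) eqxx.
  rewrite /DP Dop_upd // ui uj.
  apply: D2_iter_ext => a1 a2; rewrite H2 /g /gl big_map; apply: eq_bigr => p _ /=.
  have -> : upd i j a1 a2 (upd i j m1 m2 n) = upd i j a1 a2 n.
    by apply: functional_extensionality => l; rewrite /upd; case: eqVneq => // _; case: eqVneq.
  rewrite /nadd /upd !eqxx (negbTE nji); congr (Y _ _ (Y _ _ _) *~ _).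
  by apply: corr_agree => l ls; case: eqVneq => [el|_]; [|case: eqVneq => // el];
    rewrite -el ls in nis njs *.
have us2 : uniq [:: i, j & s] by rewrite /= inE negb_or nij nis njs us.
have Z1 m1 m2 : 0 <= m1 -> iter P (@D2 V) g m1 m2 = 0.
  by move=> l1; rewrite -corrE; apply: (corr_vanish us2 (i := i)); rewrite ?mem_head // /upd eqxx.
have Z2 m1 m2 : 0 <= m2 -> iter P (@D2 V) g m1 m2 = 0.
  move=> l1; rewrite -corrE; apply: (corr_vanish us2 (i := j)); rewrite ?inE ?eqxx ?orbT //.
  by rewrite /upd (negbTE nji) eqxx.
under eq_bigr do rewrite corrE.
rewrite (collapse2 H evP (al := gl) (loc i j) Z1 Z2 A i0).
rewrite /gl big_map [RHS]big_flatten [RHS]big_map; apply: eq_bigr => p _ /=.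
rewrite /be1 big_map big_filter -[iota _ _]/(index_iota 0 (p.2 i).+1) big_mkord.
rewrite mulrz_suml [RHS]big_mkcond; apply: eq_bigr => t _ /=.
(* For t > i0 the inner mode is at least P, so locality kills the term. *)
case: leqP => [le|lt]; last by rewrite loc ?(Yl0 H) ?mul0rz //; lia.
rewrite [in RHS]mulrC mulrzA; congr (Y (Y _ _ _) _ _ *~ _ *~ _); lia.
Qed.

(** Here m counts the linear factors still to be expanded. Each of them raises the mode of one label
    by one, and T is an invariant of such steps. *)
Lemma DD_ind (Q : V -> Prop) (T : nat -> (nat -> int) -> Prop) i s F n : subgroup Q ->
  (forall m n l, l \in i :: s -> T m.+1 n -> T m (sh l n)) -> (forall n, T 0 n -> Q (F n)) ->
  T (size s * P)%N n -> Q (DD i s F n).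
Proof.
move=> HQ; elim: s T n => [|j s IH] T n TS TF /=; first by rewrite mul0n; exact: TF.
rewrite mulSn addnC /DP; elim: {2 3}P n => [|m IHm] n Tn.
  rewrite addn0 in Tn; apply: (IH T) => // m n' l ls; apply: TS.
  by move: ls; rewrite !inE => /orP[->|->]; rewrite ?orbT.
rewrite addnS in Tn; rewrite /= /Dop; apply: sgB => //; apply: IHm; apply: TS Tn; rewrite !inE eqxx ?orbT //.
Qed.

Lemma sum_sh s l n : uniq s -> l \in s -> \sum_(k <- s) sh l n k = \sum_(k <- s) n k + 1.
Proof.
move=> us ls; rewrite big_split /=; congr (_ + _); rewrite (bigD1_seq l) //= eqxx big1 ?addr0 // => k /negbTE -> //.
Qed.

Lemma corr_wt (h : nat -> int) s n : uniq s -> (forall i, wt Y om (h i) (x i)) ->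
  wt Y om (\sum_(i <- s) (h i - 1) - \sum_(i <- s) n i - (P * 'C(size s, 2))%N%:Z) (corr s n).
Proof.
move=> + wx; elim: s n => [|i s IH] n.
  by move=> _; rewrite !big_nil muln0; exact: wt_vac H.
move=> us; have /= /andP[nis us'] := us.
pose T m (n' : nat -> int) := \sum_(k <- i :: s) n' k = \sum_(k <- i :: s) n k + (size s * P)%N%:Z - m%:Z.
set k := (_ - _ - _); apply: (DD_ind (Q := wt Y om k) (T := T)).
- by split; [exact: (wt0 H) | exact: (wtB H)].
- by move=> m n' l ls; rewrite /T sum_sh // => ->; lia.
- move=> n'; rewrite /T !big_cons => Tn; have := wt_Y H (n' i) (wx i) (IH n' us').
  congr (wt _ _ _ _); rewrite /k !big_cons /= binS bin1 mulnDr (mulnC P (size s)) PoszD.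
  move: Tn; rewrite subr0 -addrA; move: (\sum_(j <- s) n' j) (\sum_(j <- s) n j) (\sum_(j <- s) _).
  by move=> a b c; clear; lia.
- by rewrite /T addrK.
Qed.

(** With i at the front, the factors raise its mode by at most P for every other label, so it stays
    at most h - 2 and [adj_vanish] applies. This bounds the exponents in a nonzero correlator of
    weight zero. *)
Lemma corr_adj_vanish (bil : V -> V -> rat) (h : nat -> nat) s i n :
  dim_V0_one Y om -> is_inv_form Y vac om bil ->
  uniq s -> (forall i, wt Y om (h i)%:Z (x i)) -> i \in s -> wt Y om 0 (corr s n) ->
  n i + ((size s).-1 * P)%N%:Z <= (h i)%:Z - 2 -> corr s n = 0.
Proof.
move=> HV0 HB us wx ins w0; have := corr_wt n us wx; set k := (_ - _ - _) => wk len.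
have [k0|k0] := eqVneq k 0; last by exact: (wt_uniq wk w0 k0).
move: w0 {wk}; rewrite (corr_front us ins) /= => _.
have us' := rem_uniq i us; have nis : i \notin rem i s by rewrite mem_rem_uniq // inE eqxx.
have pis := perm_to_rem ins; have ur : uniq (i :: rem i s) by rewrite /= nis us'.
have sz := size_rem ins.
have ssz : size s = (size (rem i s)).+1 by rewrite sz prednK //; case: (s) ins.
pose T m (n' : nat -> int) := n' i + m%:Z <= n i + (size (rem i s) * P)%N%:Z /\
  \sum_(k <- i :: rem i s) n' k = \sum_(k <- i :: rem i s) n k + (size (rem i s) * P)%N%:Z - m%:Z.
apply: (DD_ind (Q := eq^~ 0) (T := T)).
- by split=> // u v -> ->; rewrite subr0.
- move=> m n' l ls [T1 T2]; split; last by rewrite sum_sh // T2; clear; lia.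
  by rewrite /sh; case: eqP => _; move: T1; clear; lia.
- move=> n' [T1 T2]; apply: (adj_vanish H HV0 HB (wx i)); last first.
    by move: T1 len; rewrite sz addr0; exact: le_trans.
  have := wt_Y H (n' i) (wx i) (corr_wt n' us' wx); congr (wt _ _ _ _).
  move: k0; rewrite /k !(perm_big _ pis) /= !big_cons ssz binS bin1 mulnDr (mulnC P (size _)) PoszD.
  move: T2; rewrite !big_cons subr0 -addrA.
  move: (\sum_(j <- rem i s) n' j) (\sum_(j <- rem i s) n j) (\sum_(j <- rem i s) _).
  by move=> a b c; lra.
- by split; rewrite ?addrK.
Qed.

(** A pair of labels to be collapsed, the sum of their exponents [e = - n - 1], and the weight, of degree
    at most [pair_deg], against which the exponent of the first label is summed. *)
Record wpair := WPair { fst_label : nat; snd_label : nat; pair_sum : nat; pair_deg : nat; pair_weight : nat -> int }.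

Implicit Types (p : wpair) (M : seq wpair).

Fixpoint allp (Q : wpair -> Prop) M : Prop := if M is p :: M' then Q p /\ allp Q M' else True.

Fixpoint labels M : seq nat := if M is p :: M' then [:: fst_label p, snd_label p & labels M'] else [::].

Definition Lam1 p F n : V := \sum_(e < (pair_sum p).+1)
  F (upd (fst_label p) (snd_label p) (- e%:Z - 1) (- (pair_sum p - e)%N%:Z - 1) n) *~ pair_weight p e.

Fixpoint Lam M F : (nat -> int) -> V := if M is p :: M' then Lam M' (Lam1 p F) else F.

(** Nested products of the collapsed pairs. Only the order i' of a collapse affects denominators;
    the outer mode l is free because A is closed under all modes. *)
Fixpoint Qs M : V -> Prop :=
  if M is p :: M' then
    Zgen (fun v => exists i' (l : int) u, [/\ (i' <= pair_deg p)%N, Qs M' u &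
      v = Y (Y (x (fst_label p)) (P%:Z - 1 - i'%:Z) (x (snd_label p))) l u])
  else Zgen (fun v => v = vac).

Lemma Qs_subgroup M : subgroup (Qs M).
Proof. by case: M => [|p M]; exact: Zgen_subgroup. Qed.

Lemma Lam_Y M a (l : int) F : Lam M (fun n => Y a l (F n)) = fun n => Y a l (Lam M F n).
Proof.
elim: M F => //= p M IH F; rewrite -IH; congr (Lam M _); apply: functional_extensionality => n.
by rewrite /Lam1 (Yr_sum H); apply: eq_bigr => e _; rewrite (YrMz H).
Qed.

Lemma Lam_lin M F G (z : int) : Lam M (fun n => F n *~ z + G n) = fun n => Lam M F n *~ z + Lam M G n.
Proof.
elim: M F G => //= p M IH F G; rewrite -IH; congr (Lam M _); apply: functional_extensionality => n.
rewrite /Lam1 mulrz_suml -big_split /=; apply: eq_bigr => e _.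
by rewrite mulrzDl -!mulrzA mulrC.
Qed.

Lemma Lam_0 M n : Lam M (fun=> 0) n = 0.
Proof.
have := Lam_lin M (fun=> 0) (fun=> 0) (-1) => /(congr1 (fun f => f n)).
by rewrite mul0rz addr0 mulrNz mulr1z addNr.
Qed.

Lemma Lam_sum M I (r : seq I) (F : I -> (nat -> int) -> V) (z : I -> int) :
  Lam M (fun n => \sum_(b <- r) F b n *~ z b) = fun n => \sum_(b <- r) Lam M (F b) n *~ z b.
Proof.
elim: r => [|b r IH].
  apply: functional_extensionality => n; rewrite big_nil -[RHS](Lam_0 M n); congr (Lam M _ n).
  by apply: functional_extensionality => n'; rewrite big_nil.
transitivity (Lam M (fun n => F b n *~ z b + \sum_(b <- r) F b n *~ z b)).
  by congr (Lam M _); apply: functional_extensionality => n'; rewrite big_cons.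
by rewrite Lam_lin IH; apply: functional_extensionality => n'; rewrite big_cons.
Qed.

(** The shift lowers both exponents, and terms where one becomes negative vanish. What remains is a
    sum of the same kind, with smaller total and translated weight. *)
Lemma Lam1_shift i j A d w s a n : i != j -> uniq [:: i, j & s] ->
  Lam1 (WPair i j A d w) (fun n => corr [:: i, j & s] (nadd n a)) n =
  if (a i + a j <= A)%N then
    \sum_(e < (A - a j - a i).+1) corr [:: i, j & s]
      (upd i j (- e%:Z - 1) (- (A - a j - a i - e)%N%:Z - 1) (nadd n a)) *~ w (e + a i)%N
  else 0.
Proof.
move=> nij us; rewrite /Lam1 /=.
pose f e := corr [:: i, j & s] (upd i j (- e%:Z - 1 + (a i)%:Z) (- (A - e)%N%:Z - 1 + (a j)%:Z) (nadd n a)) *~ w e.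
have Hf e : corr [:: i, j & s] (nadd (upd i j (- e%:Z - 1) (- (A - e)%N%:Z - 1) n) a) *~ w e = f e.
  congr (corr _ _ *~ _); apply: functional_extensionality => l; rewrite /nadd /upd.
  by case: (eqVneq l i) => [->//|_]; case: (eqVneq l j) => [->|].
under eq_bigr do rewrite Hf.
have f0 e : (e < a i)%N -> f e = 0.
  move=> le; rewrite /f (corr_vanish us (i := i)) ?mul0rz ?mem_head //.
  by rewrite /upd eqxx; lia.
have f1 e : (A - e < a j)%N -> f e = 0.
  move=> le; rewrite /f (corr_vanish us (i := j)) ?mul0rz ?inE ?eqxx ?orbT //.
  by rewrite /upd eq_sym (negbTE nij) eqxx; lia.
case: leqP => le; last first.
  by apply: big1 => -[e le'] _ /=; case: (ltnP e (a i)) => le2; [exact: f0 | apply: f1; lia].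
rewrite -(big_mkord xpredT f) (@big_cat_nat _ _ _ (a i)) //=; last by lia.
rewrite big_nat_cond big1 ?add0r; last by move=> e; rewrite andbT => /andP[_ le2]; exact: f0.
rewrite (@big_cat_nat _ _ _ (A - a j).+1) //=; [|lia|lia].
rewrite [X in _ + X]big_nat_cond [X in _ + X]big1 ?addr0; last first.
  by move=> e; rewrite andbT => /andP[le2 le3]; apply: f1; lia.
rewrite -{1}[a i]add0n big_addn subSn ?big_mkord; last by lia.
apply: eq_bigr => -[e le2] _ /=; rewrite /f; congr (corr _ (upd _ _ _ _ _) *~ _); lia.
Qed.

(** The shift a must be arbitrary for the induction, since collapsing the first pair leaves shifted
    correlators of the remaining labels. *)
Lemma Lam_Qs M : uniq (labels M) -> allp (fun p => newton (pair_deg p).+1 (pair_weight p)) M ->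
  forall a n, Qs M (Lam M (fun n => corr (labels M) (nadd n a)) n).
Proof.
elim: M => [|[i j A d w] M IH]; first by move=> _ _ a n; apply: Zgen_in.
move=> us [/= Hd Hw] a n.
have {IH} IH : forall a n, Qs M (Lam M (fun n => corr (labels M) (nadd n a)) n).
  by apply: IH => //; case/and3P: us.
have nij : i != j by case/and3P: us; rewrite inE negb_or => /andP[].
have nis : i \notin labels M by case/and3P: us; rewrite inE negb_or => /andP[].
have njs : j \notin labels M by case/and3P: us.
have us' : uniq (labels M) by case/and3P: us.
pose Q := Qs (WPair i j A d w :: M); have HQ : subgroup Q by exact: Qs_subgroup.
change (Q (Lam M (Lam1 (WPair i j A d w) (fun n => corr [:: i, j & labels M] (nadd n a))) n)).
rewrite (functional_extensionality _ _ (fun n' => Lam1_shift A d w a n' nij us)).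
case: leqP => _; last by rewrite Lam_0; exact: sg0.
pose W e := w (e + a i)%N; have HW : newton d.+1 W by exact: newton_shift.
rewrite -/W; move: (A - _ - _)%N => A'.
change (Q (Lam M (fun n => \sum_(e < A'.+1) corr [:: i, j & labels M] (upd i j (- e%:Z - 1) (- (A' - e)%N%:Z - 1) (nadd n a)) *~ W e) n)).
move: W HW; apply: (@newton_ind d.+1 (fun W => Q (Lam M (fun n => \sum_(e < A'.+1) corr [:: i, j & labels M] (upd i j (- e%:Z - 1) (- (A' - e)%N%:Z - 1) (nadd n a)) *~ W e) n))).
- move=> W W' eW; congr (Q (Lam M _ n)); apply: functional_extensionality => n'.
  by apply: eq_bigr => e _; rewrite eW.
- set F := (fun _ => _); have -> : F = fun=> 0; last by rewrite Lam_0; exact: sg0.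
  by apply: functional_extensionality => n'; rewrite /F big1 // => e _; rewrite mulr0z.
- move=> z W W' QW QW'; set F := (fun _ => _).
  have -> : F = fun n => (\sum_(e < A'.+1) corr [:: i, j & labels M] (upd i j (- e%:Z - 1) (- (A' - e)%N%:Z - 1) (nadd n a)) *~ W e) *~ z +
     (\sum_(e < A'.+1) corr [:: i, j & labels M] (upd i j (- e%:Z - 1) (- (A' - e)%N%:Z - 1) (nadd n a)) *~ W' e).
    apply: functional_extensionality => n'; rewrite /F mulrz_suml -big_split /=; apply: eq_bigr => e _.
    by rewrite mulrzDr mulrC mulrzA.
  by rewrite Lam_lin; apply: sgD => //; exact: sgMz.
move=> t lt; have [be Hbe] := collapse A' t nij nis njs us'.
set F := (fun _ => _); have -> : F = fun n => \sum_(b <- be)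
    Y (Y (x i) (P%:Z - 1 - (t - b.1.2.1)%N%:Z) (x j)) b.1.2.2 (corr (labels M) (nadd n (fun l => a l + b.2 l)%N)) *~ b.1.1.
  apply: functional_extensionality => n'; rewrite /F Hbe; apply: eq_bigr => b _.
  congr (Y _ _ (corr _ _) *~ _); apply: functional_extensionality => l.
  by rewrite /nadd PoszD addrA.
rewrite Lam_sum; apply: sg_sum => // b _; apply: sgMz => //.
have -> := Lam_Y M (Y (x i) (P%:Z - 1 - (t - b.1.2.1)%N%:Z) (x j)) b.1.2.2 (fun n => corr (labels M) (nadd n (fun l => a l + b.2 l)%N)).
apply: Zgen_in; exists (t - b.1.2.1)%N, b.1.2.2; eexists; split; last by [].
  by apply: leq_trans (leq_subr _ _) _.
exact: IH.
Qed.

Lemma Qs_mem (A : V -> Prop) (K : nat) M v : subgroup A -> A vac ->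
  (forall a b (l : int), A a -> A b -> A (Y a l b)) -> 
  allp (fun p => forall m, (m <= pair_deg p)%N ->
     A (Y (x (fst_label p)) (P%:Z - 1 - m%:Z) (x (snd_label p)) *+ K ^ m.+1)) M ->
  Qs M v -> A (v *+ K ^ (\sum_(p <- M) (pair_deg p).+1)).
Proof.
move=> HA A1 AY; elim: M v => [|p M IH] v AM /=.
  rewrite big_nil; elim=> [|u ->|u w _ Au _ Aw] //; first exact: sg0.
  by rewrite mulrnBl; exact: sgB.
rewrite big_cons expnD; elim=> [|_ [m [l [u [lm Qu ->]]]]|u w _ Au _ Aw]; last 1 first.
- by rewrite mulrnBl; exact: sgB.
- by rewrite mul0rn; exact: sg0.
have {AM} [/(_ m lm) Ap AM] := AM.
have {IH AM} Au := IH _ AM Qu.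
rewrite mulrnA -(YlMn H u) -(YrMn H _ _ u); apply: AY => //.
by rewrite -(subnK (n := (pair_deg p).+1) (m := m.+1)) // expnD mulnC mulrnA; exact: sgMn.
Qed.

End Correlator.

(** * Denominators of the products of a letter with itself *)
Section Relabel.
Variables (V : lmodType rat) (Y : V -> int -> V -> V) (vac : V) (P : nat) (x : nat -> V).
Variables (f : nat -> nat) (f_inj : injective f) (xf : forall i, x (f i) = x i).

Lemma sh_relabel i (n : nat -> int) : sh (f i) n \o f = sh i (n \o f).
Proof. by apply: functional_extensionality => l; rewrite /sh /= (inj_eq f_inj). Qed.

Lemma DD_relabel i s (F F' : (nat -> int) -> V) n : (forall n, F n = F' (n \o f)) ->
  DD P (f i) (map f s) F n = DD P i s F' (n \o f).
Proof.
move=> FF'; elim: s n => //= j s IH n; rewrite /DP; elim: {1 3}P n => // m IHm n.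
by rewrite /= /Dop !IHm !sh_relabel.
Qed.

(** When all labels carry one letter, this turns symmetry in the order of the labels into symmetry
    in the exponents. *)
Lemma corr_relabel s n : corr Y vac P x (map f s) n = corr Y vac P x s (n \o f).
Proof.
elim: s n => //= i s IH n; apply: (DD_relabel _ _ (F' := fun n => Y (x i) (n i) (corr Y vac P x s n))).
by move=> n'; rewrite xf IH.
Qed.
End Relabel.

Section SelfCorrelation.
Variables (V : lmodType rat) (Y : V -> int -> V -> V) (vac om : V).
Hypotheses (H : is_VOA Y vac om).
Variables (bil : V -> V -> rat) (HV0 : dim_V0_one Y om) (HB : is_inv_form Y vac om bil).
Variables (h : nat) (y : V) (wy : wt Y om h%:Z y).
Let P := h.*2.
Let x (i : nat) := y.
Let cor := corr Y vac P x.
Let q (m : nat) := Y y (P%:Z - 1 - m%:Z) y.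
Let s4 := [:: 0; 1; 2; 3]%N.
Let arr (a b c d : nat) (l : nat) : int := - (nth 0%N [:: a; b; c; d] l)%:Z - 1.
Let N a b c d := cor s4 (arr a b c d).

Let evP : ~~ odd P. Proof. by rewrite odd_double. Qed.
Let loc i j (n : int) : P%:Z <= n -> Y (x i) n (x j) = 0.
Proof. by move=> ln; apply: (Y_top H HV0 HB wy wy); move: ln; rewrite /P; lia. Qed.

Let swap i l := if l == i then i.+1 else if l == i.+1 then i else l.
Let swap_inj i : injective (swap i).
Proof. move=> a b; rewrite /swap; case: (a == i) / eqP => ?; case: (b == i) / eqP => ?; do ?[case: (_ == i.+1) / eqP => ?]; lia. Qed.

Let N_swap i a b c d a' b' c' d' : (i < 3)%N ->
  (forall l, arr a' b' c' d' l = arr a b c d (swap i l)) -> N a b c d = N a' b' c' d'.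
Proof.
move=> li e; have -> : N a' b' c' d' = cor s4 (arr a b c d \o swap i).
  by congr (cor _ _); apply: functional_extensionality => l; rewrite e.
rewrite /cor -(corr_relabel _ _ _ (@swap_inj i)) // /N /cor; congr (_ _); apply: (corr_perm H evP loc) => //.
by move: i li {e} => [|[|[|]]].
Qed.

Let sym12 a b c d : N a b c d = N b a c d.
Proof. by apply: (@N_swap 0) => // -[|[|[|[|l]]]]. Qed.
Let sym23 a b c d : N a b c d = N a c b d.
Proof. by apply: (@N_swap 1) => // -[|[|[|[|l]]]]. Qed.
Let sym34 a b c d : N a b c d = N a b d c.
Proof. by apply: (@N_swap 2) => // -[|[|[|[|l]]]]. Qed.

(** The bound on i + j comes from the vanishing of binomial sums of order above A or B, where A + B
    = D; the induction on denominators depends on it. *)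
Definition pair_products (g D : nat) (v : V) :=
  exists i j (l l' : int), [/\ (i < g)%N, (j < g)%N, (i + j <= D)%N & v = Y (q i) l (Y (q j) l' vac)].

Let two_collapses g D A B i j : (A + B)%N = D -> (i < g)%N -> (j < g)%N ->
  Zgen (pair_products g D)
    (\sum_(e < A.+1) \sum_(k < B.+1) N e (A - e) k (B - k) *~ ('C(e, i) * 'C(k, j))%:Z).
Proof.
move=> eD li lj; have HZ := Zgen_subgroup (pair_products g D).
case: (leqP i A) => [lA|lA]; last first.
  rewrite big1 => [|e _]; first exact: sg0.
  by rewrite big1 // => k _; rewrite (@bin_small e) ?mul0n ?mulr0z //; apply: leq_ltn_trans lA; rewrite -ltnS.
case: (leqP j B) => [lB|lB]; last first.
  rewrite big1 => [|e _]; first exact: sg0.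
  by rewrite big1 // => k _; rewrite (@bin_small k) ?muln0 ?mulr0z //; apply: leq_ltn_trans lB; rewrite -ltnS.
pose M := [:: WPair 0 1 A i (fun e => 'C(e, i)%:Z); WPair 2 3 B j (fun e => 'C(e, j)%:Z)].
have wM : allp (fun p => newton (pair_deg p).+1 (pair_weight p)) M.
  by split; [|split=> //]; exact: newton_bin.
have := Lam_Qs H evP loc (M := M) erefl wM (fun=> 0%N) (fun=> -1).
set S := Lam _ _ _; set S' := \sum_(_ < _) _; have -> : S = S'.
  have -> : S = \sum_(k < B.+1) (\sum_(e < A.+1) cor s4 (nadd (upd 0 1 (- e%:Z - 1) (- (A - e)%N%:Z - 1)
      (upd 2 3 (- k%:Z - 1) (- (B - k)%N%:Z - 1) (fun=> -1))) (fun=> 0%N)) *~ 'C(e, i)) *~ 'C(k, j) by [].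
  rewrite /S' [RHS]exchange_big; apply: eq_bigr => k _.
  rewrite mulrz_suml; apply: eq_bigr => e _; rewrite PoszM mulrzA; congr (_ *~ _ *~ _).
  apply: corr_agree => l; rewrite !inE => /or4P[] /eqP ->;
  by rewrite /nadd /upd /arr /= addr0.
apply: Zgen_min => // _ [i' [l [u [li' Qu ->]]]].
elim: Qu => [|_ [j' [l' [u' [lj' Qu' ->]]]]|u1 u2 _ Q1 _ Q2].
- by rewrite (Yr0 H); exact: Zgen0.
- elim: Qu' => [|_ ->|u1 u2 _ Q1 _ Q2].
  + by rewrite !(Yr0 H); exact: Zgen0.
  + by apply: Zgen_in; exists i', j', l, l'; split=> //; move: li' lj' => /=; lia.
  + by rewrite !(YrB H); exact: sgB.
- by rewrite !(YrB H); exact: sgB.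
Qed.

Let N_in g delta D a b c d : (D = g + delta)%N -> (2 * delta < g)%N -> (4 * delta + 3 < D)%N ->
  (a + b + c + d = D)%N ->
  Zgen (pair_products g D) (N a b c d *+ (2 * (delta`! ^ delta.+1) ^ 2)).
Proof.
move=> eD lg lD e4.
exact: (four_point (Zgen_subgroup _) sym12 sym23 sym34 eD lg lD (@two_collapses g D) e4).
Qed.

Let word4 (a b c d : int) : Zgen (fun v => exists n, v = cor s4 n) (Y y a (Y y b (Y y c (Y y d vac)))).
Proof.
by have := word_corr H evP loc (s := s4) erefl (fun l => nth 0 [:: a; b; c; d] l).
Qed.

Variables (c : rat) (c0 : c != 0) (yy : q 0 = c *: vac).

Let q_corr m : Zgen (fun v => exists n, v = cor s4 n) (c *: q m).
Proof.
have -> : c *: q m = Y (q 0) (-1) (q m) by rewrite yy (YlZ H) (voa_vacl H).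
apply: (iterate_Z H) => [|i j|i j]; first exact: Zgen_subgroup.
all: by rewrite /q -{4}[y](proj1 (voa_creation H y)).
Qed.

Let q_wt (m : nat) : wt Y om m%:Z (q m).
Proof. by have := wt_Y H (P%:Z - 1 - m%:Z) wy wy; congr (wt _ _ _ _); rewrite /P; lia. Qed.

(** A four-point coefficient of weight m has total exponent m + 4P: the letters contribute 4h = 2P
    to the weight, and the six factors (z_i - z_j)^P subtract 6P. *)
Let q_N m : Zgen (fun v => exists a b c d, (a + b + c + d = m + 4 * P)%N /\ v = N a b c d) (c *: q m).
Proof.
have <- : pr H m (c *: q m) = c *: q m by rewrite (pr_hom H m (wtZ H c (q_wt m))) eqxx.
apply: (pr_P (k := m%:Z)) (q_corr m); first exact: Zgen_subgroup.
move=> _ [n ->]; have := corr_wt H evP (P := P) n (s := s4) erefl (fun=> wy).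
set k := (_ - _ - _) => wk; rewrite (pr_hom H _ wk); case: eqP => [ek|_]; last exact: Zgen0.
have [neg|] := boolP (all (fun i => n i < 0) s4); last first.
  by case/allPn => i is4; rewrite -leNgt => ni; rewrite (corr_vanish H evP loc (i := i)) //; exact: Zgen0.
apply: Zgen_in; pose e i := absz (n i + 1).
exists (e 0%N), (e 1%N), (e 2%N), (e 3%N); split.
  move: ek neg; rewrite /k /e (_ : 'C(size s4, 2) = 6%N) // !big_cons !big_nil /= andbT.
  move=> ek0 /and4P[]; move: ek0; rewrite /P; move: (n 0%N) (n 1%N) (n 2%N) (n 3%N) => n0 n1 n2 n3; clear; lia.
by apply: corr_agree => l ls; move: (allP neg _ ls); move: ls; rewrite !inE => /or4P[] /eqP ->;
  rewrite /arr /e /=; clear; lia.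
Qed.

Variables (A : V -> Prop) (HA : subgroup A) (A1 : A vac).
Hypothesis AY : forall a b n, A a -> A b -> A (Y a n b).
Hypothesis Aq : forall m, exists2 k, (0 < k)%N & A (q m *+ k).

Lemma self_denominators : exists2 K, (0 < K)%N & forall m, A (q m *+ K ^ m.+1).
Proof.
(* [K ^ f m] with [f m = max 1 (m - delta)] suffices: [f i + f j < f m] for i, j < m - 1 with
   i + j < m + delta, which leaves one factor K for the denominator [L] of [four_point]. *)
pose delta := (4 * P).+1; pose m0 := (3 * delta + 5)%N.
(* The multiplier of [four_point], times the numerator of c, which is needed to pass from c q_m to
   q_m. *)
pose L := (2 * (delta`! ^ delta.+1) ^ 2 * absz (numq c))%N.
have [K0 K0pos HK0] : exists2 K0, (0 < K0)%N & forall m, (m < m0)%N -> A (q m *+ K0).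
  elim: m0 => [|m1 [K0 K0pos HK0]]; first by exists 1%N.
  have [k kpos Ak] := Aq m1; exists (K0 * k)%N => [|m]; first by rewrite muln_gt0 K0pos.
  rewrite ltnS leq_eqVlt => /orP[/eqP ->|lm]; first by rewrite mulnC mulrnA; exact: sgMn.
  by rewrite mulrnA; apply: sgMn => //; exact: HK0.
have Lpos : (0 < L)%N.
  have : (0 < delta`! ^ delta.+1)%N by rewrite expn_gt0 fact_gt0.
  by rewrite /L; move: (delta`! ^ _)%N => z z0; rewrite !muln_gt0 !z0 absz_gt0 numq_eq0 c0.
exists (K0 * L)%N => [|m]; first by rewrite muln_gt0 K0pos.
set K := (K0 * L)%N; pose f m := (m - delta.+1).+1.
suff Af : A (q m *+ K ^ f m).
  rewrite -(subnK (n := m.+1) (m := f m)) ?expnD; last by rewrite /f; lia.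
  by rewrite mulnC mulrnA; exact: sgMn.
elim: {m}m.+1 {-2}m (ltnSn m) => // m1 IH m; rewrite ltnS => lm.
have [lm0|gm0] := ltnP m m0.
  by rewrite expnS mulrnA; apply: sgMn => //; rewrite mulrnA; apply: sgMn => //; exact: HK0.
(* Then D = g + delta, as [four_point] requires, and the products involve only orders below m -
   1. *)
pose g := m.-1; pose D := (m + 4 * P)%N.
have Aprod v : Zgen (pair_products g D) v -> A (v *+ K ^ (f m).-1).
  apply: (Zgen_min (subgroup_Mn _ HA)) => _ [i [j [l [l' [li lj lij ->]]]]].
  have [Ai Aj] : A (q i *+ K ^ f i) /\ A (q j *+ K ^ f j) by split; apply: IH; rewrite /g in li lj; lia.
  have le : (f i + f j <= (f m).-1)%N.
    by rewrite /f; move: gm0 li lj lij; rewrite /m0 /g /D /delta; clear; lia.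
  rewrite -(subnK le) expnD mulnC mulrnA; apply: sgMn => //.
  rewrite expnD mulrnA -(YlMn H (Y _ _ _)) -(YrMn H _ _ (Y _ _ _)) -(YlMn H vac); apply: AY => //; exact: AY.
have q_prod : Zgen (pair_products g D) (q m *+ L).
  have HZ := Zgen_subgroup (pair_products g D).
  rewrite /L mulrnA; suff: Zgen (pair_products g D) (q m *+ (2 * (delta`! ^ delta.+1) ^ 2) *~ numq c).
    by case: (numq c) => [k|k] //=; move/(sgN HZ); rewrite opprK.
  have -> : q m *+ (2 * (delta`! ^ delta.+1) ^ 2) *~ numq c = (c *: q m) *+ (2 * (delta`! ^ delta.+1) ^ 2) *~ denq c.
    rewrite -!scaler_nat -!scaler_int !scalerA; congr (_ *: _).
    by rewrite numqE; ring.
  apply: sgMz => //; apply: (Zgen_min (subgroup_Mn _ HZ)) (q_N m) => _ [a [b [c' [d [e4 ->]]]]].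
  apply: (@N_in g delta D) e4; rewrite /g /D /delta; move: gm0; rewrite /m0 /delta; clear; lia.
rewrite (_ : K ^ f m = L * (K0 * K ^ (f m).-1))%N; last by rewrite mulnCA mulnA /f /= expnS.
by rewrite mulrnA mulrnA mulrnAC; apply: sgMn => //; exact: Aprod.
Qed.

End SelfCorrelation.

(** * Denominators of words of weight zero *)
Section Pairing.
Variables (T : eqType) (x : nat -> T) (e : nat -> nat) (d : nat).
Implicit Types (s t : seq nat) (L : seq (nat * nat)).

Definition flat L : seq nat := flatten [seq [:: q.1; q.2] | q <- L].
Definition gap L := \sum_(q <- L) (e q.1 - e q.2)%N.

(** Telescoping: the first two indices i, j contribute at most e j - b, and the rest, whose values
    start at e j, at most d - e j. *)
Lemma pair_sorted t b : ~~ odd (size t) -> sorted (fun i j => e i <= e j)%N t ->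
  (forall i, i \in t -> b <= e i <= d)%N ->
  exists L, [/\ perm_eq (flat L) t, all (fun q => (e q.2 <= e q.1)%N) L & (gap L <= d - b)%N].
Proof.
have [m] := ubnP (size t); elim: m t b => // m IH [|i [|j t]] b //=.
  by move=> _ _ _ _; exists [::]; rewrite /gap big_nil.
rewrite !ltnS negbK => st ot /andP[eij pjt] He.
have tr : transitive (fun i j => e i <= e j)%N by move=> ? ? ?; exact: leq_trans.
have := pjt; rewrite path_sortedE // => /andP[/allP ejt sjt].
have Ht k : k \in t -> (e j <= e k <= d)%N.
  by move=> kt; rewrite ejt //=; have /andP[] : (b <= e k <= d)%N by apply: He; rewrite !inE kt !orbT.
have [L [pL aL gL]] := IH t (e j) (ltnW st) ot sjt Ht.
exists ((j, i) :: L); split=> /=; last 1 first.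
- rewrite /gap big_cons /= -/(gap L).
  have /andP[_ ejd] : (b <= e j <= d)%N by apply: He; rewrite !inE eqxx orbT.
  have /andP[bei _] : (b <= e i <= d)%N by apply: He; rewrite mem_head.
  move: eij gL ejd bei; clear; lia.
- by rewrite /flat /= (perm_catCA [:: j] [:: i] (flat L)) /= !perm_cons.
- by rewrite eij.
Qed.

(** Indices are sorted separately for each letter, which costs at most d per letter however often it
    occurs. *)
Lemma pair_same_letter (ys : seq T) s : (forall i, i \in s -> x i \in ys) ->
  (forall y, ~~ odd (count (fun i => x i == y) s)) -> (forall i, i \in s -> e i <= d)%N ->
  exists L, [/\ perm_eq (flat L) s, all (fun q => (e q.2 <= e q.1)%N && (x q.1 == x q.2)) L &
    (gap L <= size ys * d)%N].
Proof.
elim: ys s => [|y ys IH] s sys ev He.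
  exists [::]; split=> //; last by rewrite /gap big_nil.
  by case: s sys {ev He} => // i s /(_ i (mem_head _ _)).
pose a i := x i == y.
have ev' y' : ~~ odd (count (fun i => x i == y') (filter (predC a) s)).
  rewrite count_filter; case: (eqVneq y' y) => [->|ny].
    by rewrite (eq_count (a2 := pred0)) ?count_pred0 // => i; rewrite /= /a; case: eqP.
  rewrite (eq_count (a2 := fun i => x i == y')) // => i /=; rewrite /a.
  by case: eqVneq => // ->; rewrite (negbTE ny).
have sys' i : i \in filter (predC a) s -> x i \in ys.
  by rewrite mem_filter /= /a => /andP[nx /sys]; rewrite inE (negbTE nx).
have He' i : i \in filter (predC a) s -> (e i <= d)%N by rewrite mem_filter => /andP[_ /He].
have [L [pL aL gL]] := IH _ sys' ev' He'.
pose le i j := (e i <= e j)%N.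
have [L0 [pL0 aL0 gL0]] : exists L, [/\ perm_eq (flat L) (sort le (filter a s)),
    all (fun q => (e q.2 <= e q.1)%N) L & (gap L <= d - 0)%N].
  apply: pair_sorted.
  - by rewrite size_sort size_filter; exact: ev.
  - by apply: sort_sorted => i j; exact: leq_total.
  - by move=> i; rewrite mem_sort mem_filter => /andP[_ /He].
rewrite perm_sym perm_sort perm_sym in pL0; exists (L0 ++ L); split.
- rewrite /flat map_cat flatten_cat; apply: (@perm_trans _ (filter a s ++ filter (predC a) s)).
    exact: perm_cat.
  by rewrite perm_filterC.
- rewrite all_cat aL andbT; apply/allP => q qL; rewrite (allP aL0 _ qL) /=.
  have aq i : i \in [:: q.1; q.2] -> x i = y.
    move=> iq; apply/eqP; have : i \in filter a s.
      by rewrite -(perm_mem pL0); apply/flattenP; exists [:: q.1; q.2] => //; apply/mapP; exists q.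
    by rewrite mem_filter => /andP[].
  by rewrite !aq ?inE ?eqxx ?orbT.
- by rewrite /gap big_cat /= mulSn; apply: leq_add => //; rewrite subn0 in gL0.
Qed.
End Pairing.

(** Moving two exponents apart by t at constant sum raises the sum of their squares by at least
    t. *)
Lemma two_squares b delta t : (t <= b)%N ->
  ((b + delta) ^ 2 + b ^ 2 + t <= (b + delta + t) ^ 2 + (b - t) ^ 2)%N.
Proof.
move=> /subnK; move: (b - t)%N => u <-.
have -> : ((u + t + delta + t) ^ 2 + u ^ 2 = (u + t + delta) ^ 2 + (u + t) ^ 2 + t * (t + delta).*2)%N.
  by rewrite -!mulnn -muln2; ring.
by rewrite leq_add2l; case: t => // t; rewrite leq_pmulr.
Qed.

Section Spread.
Variables (V : lmodType rat) (S : V -> Prop) (HS : subgroup S).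
Implicit Types (n : nat -> int) (F : (nat -> int) -> V) (t : seq nat) (p : wpair) (M : seq wpair).

(** The sum of the squares of the exponents [- n l - 1]: the denominators of correlators are bounded by
    descending induction on it. *)
Definition spread t n : nat := \sum_(l <- t) absz (n l + 1)%R ^ 2.

Definition spiked n p := exists b delta : nat,
  [/\ pair_sum p = (b + (b + delta))%N, n (fst_label p) = - (b + delta)%N%:Z - 1,
      n (snd_label p) = - b%:Z - 1, forall e, (b <= e < b + delta)%N -> pair_weight p e = 0 &
      pair_weight p (b + delta)%N = 1].

(** In [Lam M F n] the term F n has coefficient 1. The spikes kill the less spread choices in each
    pair, so every other surviving term has the same total and a strictly larger spread. *)
Lemma Lam_spread M F n : uniq (labels M) -> allp (spiked n) M ->
  (forall n', (forall l, l \notin labels M -> n' l = n l) ->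
     \sum_(l <- labels M) n' l = \sum_(l <- labels M) n l ->
     (spread (labels M) n < spread (labels M) n')%N -> S (F n')) ->
  S (Lam M F n) -> S (F n).
Proof.
elim: M F => [|[i j A d w] M IH] F //= us [[b [delta /= [eA ni nj w0 w1]]] sM] HF SL.
have /and3P[nis njs us'] := us; rewrite inE negb_or in nis; case/andP: nis => nij nis.
have nji : j != i by rewrite eq_sym.
pose n2 n' e := upd i j (- e%:Z - 1) (- (A - e)%N%:Z - 1) n'.
have n2i n' e : n2 n' e i = - e%:Z - 1 by rewrite /n2 /upd eqxx.
have n2j n' e : n2 n' e j = - (A - e)%N%:Z - 1 by rewrite /n2 /upd (negbTE nji) eqxx.
have n2o n' e l : l != i -> l != j -> n2 n' e l = n' l.
  by move=> /negbTE li /negbTE lj; rewrite /n2 /upd li lj.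
have n2s n' e l : l \in labels M -> n2 n' e l = n' l.
  by move=> ls; apply: n2o; [apply: contraNneq nis => <- | apply: contraNneq njs => <-].
have Sterm n' e : (forall l, l \notin labels M -> n' l = n l) ->
    \sum_(l <- labels M) n' l = \sum_(l <- labels M) n l -> (e <= A)%N ->
    (e != b + delta)%N && (spread (labels M) n <= spread (labels M) n')%N ||
      (spread (labels M) n < spread (labels M) n')%N ->
    S (F (n2 n' e) *~ w e).
  move=> no ns leA lt; have [/w0 ->|ne] := boolP (b <= e < b + delta)%N; first by rewrite mulr0z; exact: sg0.
  apply: sgMz => //; apply: HF => [l||].
  - by rewrite !inE !negb_or => /and3P[li lj /no <-]; exact: n2o.
  - rewrite !big_cons n2i n2j ni nj -ns (eq_big_seq n') => [|l /n2s //].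
    rewrite !addrA; congr (_ + _); move: leA; rewrite eA; clear; lia.
  - rewrite /spread !big_cons n2i n2j ni nj -!/(spread _ _) /spread.
    have -> : (\sum_(l <- labels M) absz (n2 n' e l + 1)%R ^ 2 = spread (labels M) n')%N.
      by apply: eq_big_seq => l /n2s ->.
    rewrite -!/(spread _ _) !subrK !abszN !absz_nat.
    have [t [tb tA t0]] : exists t : nat, [/\ (t <= b)%N,
        (e = b + delta + t /\ A - e = b - t \/ e = b - t /\ A - e = b + delta + t)%N &
        (e != b + delta)%N -> (0 < t)%N].
      have [lbe|ltb] := leqP (b + delta) e.
        by exists (e - (b + delta))%N; split; [|left|]; move: lbe leA ne; rewrite eA; clear; lia.
      by exists (b - e)%N; split; [|right|]; move: ltb leA ne; rewrite eA; clear; lia.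
    have sq : ((b + delta) ^ 2 + b ^ 2 + t <= e ^ 2 + (A - e) ^ 2)%N.
      by have := two_squares delta tb; case: tA => [[-> ->]|[-> ->]] //; rewrite [leqRHS]addnC.
    rewrite addnA [ltnRHS]addnA; case/orP: lt => [/andP[/t0 tp]|] lt.
      by rewrite -addSn; apply: leq_add => //; apply: leq_trans sq; rewrite -addn1 leq_add2l.
    by rewrite -addnS; apply: leq_add => //; exact: leq_trans (leq_addr _ _) sq.
have SG n' : (forall l, l \notin labels M -> n' l = n l) ->
     \sum_(l <- labels M) n' l = \sum_(l <- labels M) n l ->
     (spread (labels M) n < spread (labels M) n')%N -> S (Lam1 (WPair i j A d w) F n').
  move=> no ns lt; rewrite /Lam1 /=; apply: sg_sum => // e _; apply: Sterm => //; [by rewrite -ltnS | by rewrite lt orbT].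
have := IH _ us' sM SG SL; rewrite /Lam1 /=.
have lbA : (b + delta < A.+1)%N by rewrite eA; clear; lia.
rewrite (bigD1 (Ordinal lbA)) //= w1 mulr1z; set u := F _; have -> : u = F n.
  congr F; apply: functional_extensionality => l; rewrite /upd.
  case: eqP => [-> //|_]; case: eqP => [-> //|_] //; rewrite nj eA; congr (- _ - 1); clear; lia.
apply: sg_addr => //; apply: sg_sum => // e ne; apply: Sterm => //; first by rewrite -ltnS.
by rewrite leqnn andbT; apply/orP; left; apply: contra_neq ne => ee; apply/val_inj.
Qed.

End Spread.

(** If b is the denominator of q, the m-th power shows that b^m divides m, which is impossible for b
    > 1. *)
Lemma rat_int_of_powers (q : rat) (m : nat) : (0 < m)%N ->
  (forall i, q ^+ i * m%:R \is a Num.int) -> q \is a Num.int.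
Proof.
move=> m0 Hq; set b := absz (denq q).
suff b1 : b = 1%N.
  have d1 : denq q = 1 by have := denq_gt0 q; move: b1; rewrite /b; lia.
  by rewrite -[q]divq_num_den d1 divr1 intr_int.
have /intrP[z Hz] := Hq m.
have E : (numq q) ^+ m * m%:Z = z * (denq q) ^+ m.
  apply/eqP; rewrite -(eqr_int rat) !rmorphM !rmorphXn /= -Hz numqE exprMn pmulrn.
  by rewrite mulrAC.
have : (b ^ m %| m)%N.
  have := congr1 absz E; rewrite !abszM !abszX -/b /= => E'.
  have cop : coprime (b ^ m) (absz (numq q) ^ m).
    by rewrite coprimeXl // coprimeXr // coprime_sym; exact: coprime_num_den.
  by rewrite -(Gauss_dvdr _ cop) E' dvdn_mull.
move=> /(dvdn_leq m0) le; have b0 : (0 < b)%N by rewrite absz_gt0 denq_neq0.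
apply/eqP; rewrite eqn_leq b0 andbT leqNgt; apply/negP => /(ltn_expl m); rewrite ltnNge => /negP[].
exact: le.
Qed.

Lemma rat_int_of_sqr (q : rat) : q ^+ 2 \is a Num.int -> q \is a Num.int.
Proof.
move=> q2; apply: (@rat_int_of_powers _ (absz (denq q))); first by rewrite absz_gt0 denq_neq0.
(* q^i is an integer times 1 or q, and the denominator of q clears the latter. *)
move=> i; rewrite -(odd_double_half i) exprD -mul2n exprM mulrAC.
apply: rpredM; last exact: rpredX.
have dE : (absz (denq q))%:R = (denq q)%:~R :> rat.
  by rewrite pmulrn; congr (_%:~R); have := denq_gt0 q; case: (denq q).
rewrite dE; case: (odd i); last by rewrite expr0 mul1r intr_int.
by rewrite expr1 -numqE intr_int.
Qed.

Section Denominators.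
Variables (V : lmodType rat) (Y : V -> int -> V -> V) (vac om : V).
Hypotheses (H : is_VOA Y vac om).
Variables (bil : V -> V -> rat) (HV0 : dim_V0_one Y om) (HB : is_inv_form Y vac om bil).
Variables (P : nat) (evP : ~~ odd P) (ys : seq V) (h : V -> nat).
Hypothesis wy : forall y, y \in ys -> wt Y om (h y)%:Z y.
Hypothesis locy : forall y y' (n : int), y \in ys -> y' \in ys -> P%:Z <= n -> Y y n y' = 0.
Variables (A : V -> Prop) (HA : subgroup A) (A1 : A vac).
Hypothesis AY : forall a b (n : int), A a -> A b -> A (Y a n b).
Variables (K : nat).
Hypothesis AK : forall y m, y \in ys -> A (Y y (P%:Z - 1 - m%:Z) y *+ K ^ m.+1).

Lemma spiked_pairs (x : nat -> V) (e : nat -> nat) (n : nat -> int) L :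
  all (fun q => (e q.2 <= e q.1)%N && (x q.1 == x q.2)) L ->
  (forall l, l \in flat L -> n l = - (e l)%:Z - 1) ->
  exists M, [/\ labels M = flat L, allp (fun p => newton (pair_deg p).+1 (pair_weight p)) M,
    allp (spiked n) M, allp (fun p => x (fst_label p) = x (snd_label p)) M &
    (\sum_(p <- M) (pair_deg p).+1 = gap e L + size L)%N].
Proof.
elim: L => [|[i j] L IH] /=; first by exists [::]; rewrite /gap !big_nil.
move=> /andP[/andP[/= eij /eqP xij] aL] nL.
have [|M [lM nM sM xM dM]] := IH aL; first by move=> l lL; apply: nL; rewrite /flat /= !inE -/(flat L) lL !orbT.
have [w Hw [w0 w1]] := newton_spike (e j) (e i - e j).
exists (WPair i j (e j + (e j + (e i - e j))) (e i - e j) w :: M); split=> //=.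
- by rewrite lM.
- split=> //; exists (e j), (e i - e j)%N; split=> //=; last by rewrite nL // /flat /= !inE eqxx ?orbT.
  by rewrite subnKC // nL // /flat /= !inE eqxx.
- by rewrite /gap !big_cons /= dM /gap addSn addnS addnA.
Qed.

(** In a nonzero correlator all exponents are at most d, so the spread is at most B and descending
    induction on it is possible. The cost is the total gap, at most size ys times d = P size s, plus
    one for each pair. *)
Lemma corr_denominators (x : nat -> V) s n : (forall i, x i \in ys) -> uniq s ->
  (forall y, ~~ odd (count (fun i => x i == y) s)) ->
  \sum_(i <- s) ((h (x i))%:Z - 1) - \sum_(i <- s) n i - (P * 'C(size s, 2))%N%:Z = 0 ->
  A (corr Y vac P x s n *+ K ^ (size s * (size ys * P).+1)).
Proof.
move=> xys us ev; set E := (K ^ _)%N.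
have loc i j (m : int) : P%:Z <= m -> Y (x i) m (x j) = 0 by exact: locy.
have wx i : wt Y om (h (x i))%:Z (x i) by exact: wy.
pose d := (P * size s)%N; pose B := (size s * d ^ 2)%N.
have [m] := ubnP (B.+1 - spread s n); elim: m n => // m IH n; rewrite ltnS => lm n0.
have w0 : wt Y om 0 (corr Y vac P x s n) by have := corr_wt H evP n us wx; rewrite n0.
have [neg|] := boolP (all (fun i => n i < 0) s); last first.
  by case/allPn => i ins; rewrite -leNgt => ni; rewrite (corr_vanish H evP loc us ins ni) mul0rn; exact: sg0.
pose e i := absz (n i + 1).
have ne i : i \in s -> n i = - (e i)%:Z - 1 by move=> /(allP neg); rewrite /e; lia.
have [big|] := boolP (all (fun i => e i <= d)%N s); last first.
  case/allPn => i ins; rewrite -ltnNge => di.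
  rewrite (corr_adj_vanish H evP loc HV0 HB us wx ins w0) ?mul0rn; first exact: sg0.
  have sz : (0 < size s)%N by case: (s) ins.
  rewrite ne // mulnC; move: di; rewrite /d -(prednK sz) mulnS /=; move: (P * _)%N => z.
  by clear; lia.
have [L [pL aL gL]] := pair_same_letter (fun i _ => xys i) ev (fun i => allP big i).
have [l lL|M [lM nM sM xM dM]] := spiked_pairs (n := n) aL.
  by apply: ne; rewrite -(perm_mem pL).
have uM : uniq (labels M) by rewrite lM (perm_uniq pL).
have eM (F : nat -> nat) : (\sum_(l <- labels M) F l = \sum_(l <- s) F l)%N.
  by rewrite lM; exact: perm_big.
have ccM : corr Y vac P x s = corr Y vac P x (labels M).
  by apply: (corr_perm H evP loc us); rewrite lM perm_sym.
have szL : size s = (size L).*2.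
  by rewrite -(perm_size pL); elim: (L) => //= q L' ->.
apply: (@Lam_spread _ (fun v => A (v *+ E)) _ M (corr Y vac P x s)) => //.
- exact: subgroup_Mn.
- move=> n' no ns lt; apply: IH.
    rewrite /spread eM -/(spread s n) in lt.
    have ltB : (spread s n <= B)%N.
      rewrite /spread big_seq /B -sum1_size big_distrl /= big_seq leq_sum // => i /(allP big).
      by rewrite mul1n leq_exp2r.
    rewrite eM -/(spread s n') in lt.
    by move: lm lt ltB; clear; lia.
  have := ns; rewrite !lM !(perm_big _ pL) /= => ->; exact: n0.
have := Lam_Qs H evP loc uM nM (fun=> 0%N) n; set v := Lam _ _ _; have -> : Lam M (corr Y vac P x s) n = v.
  rewrite /v ccM; congr (Lam M _ n); apply: functional_extensionality => n'; congr (corr _ _ _ _ _ _).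
  by apply: functional_extensionality => l; rewrite /nadd addr0.
move/(Qs_mem (K := K) H HA A1 AY) => Av.
rewrite /E (_ : (_ * _)%N = (size s * (size ys * P).+1 - (gap e L + size L)) + (gap e L + size L))%N; last first.
  rewrite subnK //; have := gL; rewrite /d szL; move: (gap e L) (size L) (size ys) => g l k.
  by rewrite mulnS mulnA => le; rewrite addnC; apply: leq_add; [lia | rewrite mulnC].
rewrite expnD mulnC mulrnA; apply: sgMn => //; rewrite -dM; apply: Av.
move: xM; elim: (M) => //= p M' IH' [xp xM]; split=> [m' _|]; last exact: IH'.
by rewrite -xp; exact: AK.
Qed.

Definition lword (l : seq (V * int)) : V := foldr (fun p v => Y p.1 p.2 v) vac l.

(* The word is doubled so that every letter occurs an even number of times. *)
Lemma lword_sqr_mem l (q : rat) : (forall p, p \in l -> p.1 \in ys) -> lword l = q *: vac ->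
  A ((q ^+ 2 *: vac) *+ K ^ ((size l).*2 * (size ys * P).+1)).
Proof.
(* A nonempty word supplies a default letter in [ys], so that [x] takes values in [ys] at every
   label. *)
case: l => [|p0 l'].
  rewrite /= => _ e; have -> : q = 1; last by rewrite expr1n scale1r mul0n.
  apply/eqP; rewrite -subr_eq0; have /eqP : (q - 1) *: vac = 0 by rewrite scalerBl -e scale1r subrr.
  by rewrite scaler_eq0 (negbTE (vac_neq0 HB)) orbF.
set l := p0 :: l' => lys e; pose l2 := l ++ l; pose x i := (nth p0 l2 i).1; pose n i := (nth p0 l2 i).2.
have l2ys p : p \in l2 -> p.1 \in ys by rewrite mem_cat => /orP[] /lys.
have xys i : x i \in ys.
  rewrite /x; have [li|li] := ltnP i (size l2); first exact/l2ys/mem_nth.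
  by rewrite nth_default // lys // mem_head.
have loc i j (m : int) : P%:Z <= m -> Y (x i) m (x j) = 0 by exact: locy.
pose s := iota 0 (size l2).
have us : uniq s by exact: iota_uniq.
have ev y : ~~ odd (count (fun i => x i == y) s).
  rewrite -(count_map (nth p0 l2) (fun p => p.1 == y)) -/(mkseq _ _) mkseq_nth count_cat addnn.
  by rewrite odd_double.
have wE : word Y vac x s n = q ^+ 2 *: vac.
  have <- : lword l2 = q ^+ 2 *: vac.
    rewrite /l2 /lword foldr_cat -/(lword l) e.
    have -> t : foldr (fun p v => Y p.1 p.2 v) (q *: vac) t = q *: lword t.
      by elim: t => //= p t ->; rewrite (YrZ H).
    by rewrite e scalerA.
  rewrite /s -[in RHS](drop0 l2).
  have : (0 + size l2 = size l2)%N by [].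
  elim: {1 3}(size l2) 0%N => [|k IHk] j ejk; first by rewrite drop_oversize // -ejk addn0.
  have lj : (j < size l2)%N by rewrite -ejk; lia.
  by rewrite (drop_nth p0 lj) /= IHk // -ejk; lia.
have <- : pr H 0 (q ^+ 2 *: vac) = q ^+ 2 *: vac by rewrite (pr_hom H 0 (wtZ H _ (wt_vac H))) eqxx.
rewrite -wE -addnn -(size_cat l l) -/l2 -(size_iota 0 (size l2)) -/s.
pose Q v := A (v *+ K ^ (size s * (size ys * P).+1)).
apply: (pr_P (P := Q)) (word_corr H evP loc us n); first exact: subgroup_Mn.
move=> _ [n' ->]; have := corr_wt H evP n' us (fun i => wy (xys i)); set k := (_ - _ - _) => wk.
rewrite (pr_hom H 0 wk) /Q; case: eqP => [k0|_]; last by rewrite mul0rn; exact: sg0.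
by apply: corr_denominators => //; rewrite -/k.
Qed.

(** The square mu of the claimed integer satisfies mu 1 in A. Products at mode -1 put every mu^i 1
    in A, so near integrality bounds the denominators of all powers of mu at once. *)
Lemma lword_denominators (l : seq (V * int)) (q : rat) : nearly_lattice_integral bil A ->
  (forall p, p \in l -> p.1 \in ys) -> lword l = q *: vac ->
  q * (K ^ (size ys * P).+1)%:R ^+ size l \is a Num.int.
Proof.
move=> [m [m0 Am]] lys e; set c := (_ * _).+1; apply: rat_int_of_sqr; set mu := _ ^+ 2.
have Amu : A (mu *: vac).
  have := lword_sqr_mem lys e; rewrite -scaler_nat scalerA; congr (A (_ *: vac)).
  by rewrite /mu exprMn -!natrX -!expnM -muln2 -/c (mulnC c) mulnAC mulrC.
apply: (@rat_int_of_powers _ (m * m)); first by rewrite muln_gt0 m0.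
move=> i; have Ai : A (mu ^+ i *: vac).
  elim: i => [|i IH]; first by rewrite scale1r.
  by have := AY (-1) Amu IH; rewrite (YlZ H) (voa_vacl H) eqxx scalerA -exprS.
have := Am _ _ (ex_intro _ _ (conj Ai erefl)) (ex_intro _ _ (conj A1 erefl)).
by rewrite -!scaler_nat !(bilZl HB, bilZr HB) (bil_vac HB) mulr1 natrM mulrC mulrA (mulrC m%:R).
Qed.

End Denominators.

Lemma Zgen_finite (V : zmodType) (G : V -> Prop) v : Zgen G v ->
  exists s : seq V, (forall u, u \in s -> G u) /\ Zgen (fun u => u \in s) v.
Proof.
elim=> [|u Gu|u w _ [s [Gs us]] _ [s' [Gs' ws]]].
- by exists [::]; split=> //; exact: Zgen0.
- by exists [:: u]; split=> [w|]; [rewrite inE => /eqP -> | apply: Zgen_in; rewrite mem_head].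
- exists (s ++ s'); split=> [t|]; first by rewrite mem_cat => /orP[/Gs|/Gs'].
  apply: ZgenB; [move: us | move: ws]; apply: Zgen_mono => t ts; apply: Zgen_in; rewrite mem_cat ts ?orbT //.
Qed.

Lemma common_multiple (T : eqType) (r : seq T) (Q : T -> nat -> Prop) :
  (forall t k l, Q t k -> Q t (k * l)%N) -> (forall t, t \in r -> exists2 k, (0 < k)%N & Q t k) ->
  exists2 K, (0 < K)%N & forall t, t \in r -> Q t K.
Proof.
move=> QM; elim: r => [|t r IH] Hr; first by exists 1%N.
have [|K K0 HK] := IH; first by move=> u ur; apply: Hr; rewrite inE ur orbT.
have [k k0 Hk] := Hr t (mem_head _ _).
exists (k * K)%N => [|u]; first by rewrite muln_gt0 k0.
by rewrite inE => /orP[/eqP -> |/HK]; [|rewrite mulnC]; exact: QM.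
Qed.

Definition rat_multiple (V : lmodType rat) (P : V -> Prop) (v : V) := exists2 k, (0 < k)%N & P (v *+ k).

Lemma rat_multiple_lin (V : lmodType rat) (P : V -> Prop) q u v : subgroup P -> rat_multiple P u -> rat_multiple P v ->
  rat_multiple P (q *: u + v).
Proof.
move=> HP [k k0 Pu] [l l0 Pv]; exists (k * l * absz (denq q))%N.
  by rewrite !muln_gt0 k0 l0 absz_gt0 denq_neq0.
rewrite mulrnDl; apply: sgD => //; last by rewrite mulnAC mulnC mulrnA; exact: sgMn.
rewrite (_ : _ *+ _ = (u *+ k) *~ numq q *+ l); first by apply: sgMn => //; exact: sgMz.
rewrite -!scaler_nat -scaler_int !scalerA; congr (_ *: _); rewrite !natrM numqE.
have -> : (absz (denq q))%:R = (denq q)%:~R :> rat.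
  by rewrite pmulrn; congr (_%:~R); have := denq_gt0 q; case: (denq q).
ring.
Qed.

(** * Good letters *)
Section GoodLetters.
Variables (V : lmodType rat) (Y : V -> int -> V -> V) (vac om : V).
Hypotheses (H : is_VOA Y vac om).
Variables (bil : V -> V -> rat) (HV0 : dim_V0_one Y om) (HB : is_inv_form Y vac om bil).
Variables (gT : finGroupType) (D : {set gT}) (rho : gT -> V -> V).
Hypothesis rho_aut : forall d, d \in D -> is_VOA_aut Y om (rho d).
Hypothesis rho2 : forall d v, d \in D -> rho d (rho d v) = v.
Hypothesis rhoC : forall d d' v, d \in D -> d' \in D -> rho d (rho d' v) = rho d' (rho d v).
Variables (A : V -> Prop) (HA : subgroup A) (A1 : A vac).
Hypothesis AY : forall a b (n : int), A a -> A b -> A (Y a n b).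
Hypothesis Aden : forall v, fixed_pts rho D v -> exists2 k, (0 < k)%N & A (v *+ k).
Implicit Types (s : gT -> rat) (u v w y : V) (h k : nat).

Definition charged s v := forall d, d \in D -> rho d v = s d *: v.
Definition signs s := forall d, d \in D -> s d = 1 \/ s d = -1.

Definition good h y := wt Y om h%:Z y /\
  exists2 K, (0 < K)%N & forall m : nat, A (Y y (h.*2%:Z - 1 - m%:Z) y *+ K ^ m.+1).

Definition self_pairing h y := bil (Y y (h.*2%:Z - 1) y) vac.

Lemma charged_lin s q u v : charged s u -> charged s v -> charged s (q *: u + v).
Proof.
move=> cu cv d dD; case: (rho_aut dD) => lin _ _ _; rewrite lin cu // cv // scalerDr !scalerA.
by rewrite mulrC.
Qed.

(** The [rho d] are commuting involutions, so the vector can be split into halves (w + rho d w)/2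
    and (w - rho d w)/2, one d at a time. *)
Lemma charged_decomposition h v : wt Y om h%:Z v ->
  Zgen (fun w => wt Y om h%:Z w /\ exists2 s, signs s & charged s w) v.
Proof.
move=> wv; pose G (ds : seq gT) w := wt Y om h%:Z w /\
  exists s, forall d, d \in ds -> (s d = 1 \/ s d = -1) /\ rho d w = s d *: w.
suff GD ds : {subset ds <= D} -> Zgen (G ds) v.
  have eD : {subset enum D <= D} by move=> d; rewrite mem_enum.
  apply: Zgen_mono (GD _ eD) => w [ww [s Hs]]; apply: Zgen_in; split=> //.
  by exists s => d dD; case: (Hs d) => //; rewrite mem_enum.
elim: ds => [|d ds IH] sD; first by apply: Zgen_in; split=> //; exists (fun=> 1).
have dD : d \in D by apply: sD; rewrite mem_head.
have {}sD : {subset ds <= D} by move=> d' dd; apply: sD; rewrite inE dd orbT.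
apply: Zgen_mono (IH sD) => w [ww [s Hs]].
have half : w = 2^-1 *: (w + rho d w) + 2^-1 *: (w - rho d w).
  by rewrite -scalerDr addrACA subrr addr0 -mulr2n -scaler_nat scalerA mulVf ?scale1r.
have lind := rho_aut dD.
have part (e : rat) : e = 1 \/ e = -1 -> G (d :: ds) (2^-1 *: (w + e *: rho d w)).
  move=> e1; split; first by apply: (wtZ H); apply: (wtD H) => //; apply: (wtZ H); exact: aut_wt.
  exists (fun d' => if d' == d then e else s d') => d'; rewrite inE; case: (eqVneq d' d) => [->|_ /= dd].
    split=> //; rewrite (autZ lind) (autD lind) (autZ lind) rho2 // scalerA mulrC -scalerA; congr (_ *: _).
    by rewrite scalerDr scalerA; case: e1 => ->; rewrite ?mulr1 ?mulrNN ?mul1r ?scale1r addrC.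
  have [sd ed] := Hs d' dd; split=> //.
  have lind' := rho_aut (sD _ dd); rewrite (autZ lind') (autD lind') (autZ lind') (rhoC _ (sD _ dd) dD) ed.
  by rewrite (autZ lind) !scalerDr !scalerA; congr (_ + _); congr (_ *: _); ring.
rewrite half; apply: (sgD (Zgen_subgroup _)); apply: Zgen_in.
  by rewrite -[rho d w]scale1r; apply: part; left.
by rewrite -scaleN1r; apply: part; right.
Qed.

Lemma mode_fixed s y n : signs s -> charged s y -> fixed_pts rho D (Y y n y).
Proof.
move=> ss cy d dD; rewrite (autY (rho_aut dD)) cy // (YlZ H) (YrZ H) scalerA.
by case: (ss d dD) => ->; rewrite ?mulrNN mul1r scale1r.
Qed.

Lemma self_pairingE h y : wt Y om h%:Z y -> Y y (h.*2%:Z - 1) y = self_pairing h y *: vac.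
Proof.
move=> wy; apply: (wt0E H HV0 HB).
by have := wt_Y H (h.*2%:Z - 1) wy wy; congr (wt _ _ _ _); lia.
Qed.

Lemma good_nonisotropic h y s : wt Y om h%:Z y -> signs s -> charged s y ->
  self_pairing h y != 0 -> good h y.
Proof.
move=> wy ss cy c0; split=> //.
apply: (self_denominators H HV0 HB wy c0) => //; first by rewrite subr0 self_pairingE.
by move=> m; apply: Aden; exact: mode_fixed ss cy.
Qed.

Lemma good_fixed h y : wt Y om h%:Z y -> fixed_pts rho D y -> good h y.
Proof.
move=> wy fy; split=> //; have [k k0 Ay] := Aden fy; exists (k ^ 2)%N => [|m]; first by rewrite expn_gt0 k0.
rewrite expnS mulrnA; apply: sgMn => //; rewrite -mulnn mulrnA -(YrMn H) -(YlMn H (y *+ k)).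
exact: AY.
Qed.

(** Moving both derivatives out multiplies the self-pairing by -2h(2h+1), which is nonzero for h >
    0. *)
Lemma self_pairing_L h y : (0 < h)%N -> wt Y om h%:Z y -> self_pairing h y != 0 ->
  self_pairing h.+1 (Vir Y om (-1) y) != 0.
Proof.
move=> h0 wy; rewrite /self_pairing !(voa_deriv H) !(bilZl HB).
set w := Y _ _ _ => py.
have -> : Y y (h.+1.*2%:Z - 1 - 1) (Vir Y om (-1) y) = (h.*2%:Z)%:~R *: w.
  have := Lm1_Y H y (h.*2%:Z) y; rewrite (Y_top H HV0 HB wy wy (n := h.*2%:Z)); last by lia.
  rewrite [Vir _ _ _ 0](Yr0 H) (voa_deriv H) -/w => /esym /eqP; rewrite addrC addr_eq0 => /eqP.
  rewrite scaleNr opprK => <-; congr (Y _ _ _); lia.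
rewrite (bilZl HB) !mulf_neq0 // ?oppr_eq0 intr_eq0; lia.
Qed.

(** In the least weight k where the charge s occurs, L(1) kills the vectors of charge s, so the
    self-pairing is the form up to sign. The form is nondegenerate on this space, which therefore
    has a non-isotropic vector, and L(-1) carries it up to weight h. *)
Lemma charged_nonisotropic s h y d0 : signs s -> d0 \in D -> s d0 = -1 ->
  y != 0 -> wt Y om h%:Z y -> charged s y ->
  exists v, [/\ wt Y om h%:Z v, charged s v & self_pairing h v != 0].
Proof.
move=> ss d0D sd0 y0 wy cy.
pose Q k := exists u, [/\ u != 0, wt Y om k%:Z u & charged s u].
have [k [Qk minQ]] : exists k, Q k /\ forall l, (l < k)%N -> ~ Q l.
  have : exists k, Q k by exists h, y.
  case=> k; elim/ltn_ind: k => k IH Qk.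
  by have [[l [lk Ql]]|no] := classic (exists l, (l < k)%N /\ Q l); [exact: IH lk Ql | exists k; split=> // l lk Ql; apply: no; exists l].
have lekh : (k <= h)%N by rewrite leqNgt; apply/negP => /minQ; apply; exists y.
have k0 : (0 < k)%N.
  (* Weight zero consists of multiples of the vacuum, which every automorphism fixes, whereas d0
     acts by -1. *)
  rewrite lt0n; apply/eqP => k0; case: Qk => u [u0 wu cu]; rewrite k0 in wu.
  have := cu d0 d0D; rewrite (wt0E H HV0 HB wu) (autZ (rho_aut d0D)) (aut_vac H (rho_aut d0D)) sd0.
  rewrite scaleN1r -(wt0E H HV0 HB wu) => /eqP; rewrite -subr_eq0 opprK -mulr2n -scaler_nat scaler_eq0.
  by rewrite (negbTE u0).
have L1u u : wt Y om k%:Z u -> charged s u -> Vir Y om 1 u = 0.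
  move=> wu cu; apply: NNPP => /eqP n0; apply: (minQ k.-1); first by rewrite prednK.
  exists (Vir Y om 1 u); split=> //.
    by have := L_wt H 1 wu; congr (wt _ _ _ _); lia.
  move=> d dD; rewrite /Vir (autY (rho_aut dD)) cu // (YrZ H); congr (_ *: Y _ _ _).
  by case: (rho_aut dD).
have pairE u v : wt Y om k%:Z u -> charged s u -> wt Y om k%:Z v ->
    Y u (k.*2%:Z - 1) v = ((-1) ^+ k * bil u v) *: vac.
  move=> wu cu wv; rewrite [LHS](wt0E H HV0 HB); last first.
    by have := wt_Y H (k.*2%:Z - 1) wu wv; congr (wt _ _ _ _); lia.
  congr (_ *: _); rewrite (bil_inv_wt H HV0 HB _ _ _ wu); congr (_ * _).
  rewrite big_ord_recl /= big1 ?addr0 => [|j _].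
    rewrite fact0 invr1 mul1r (bil_sym HB); congr bil; rewrite (_ : _ - _ = -1); last by lia.
    by case: (voa_creation H u).
  by rewrite -iterS iterSr L1u // (_ : iter _ _ 0 = 0) ?(Yl0 H) ?(bil0r HB) ?mulr0 //; elim: (nat_of_ord j) => //= t ->; exact: (Yr0 H).
have [u [wu cu uu]] : exists u, [/\ wt Y om k%:Z u, charged s u & bil u u != 0].
  have [u0 [u0n wu0 cu0]] := Qk.
  have [v [wv [cv uv]]] : exists v, wt Y om k%:Z v /\ charged s v /\ bil u0 v != 0.
    apply: NNPP => no; case/eqP: u0n; apply: (bil_nondeg HB) => v.
    have [ls [_ ->]] := pr_dec H v; rewrite (bil_sumr HB) big1 // => l _.
    have [->|nl] := eqVneq l k%:Z; last by apply: (bil_wt H HB wu0 (pr_wt H l v)); rewrite eq_sym.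
    apply: (Zgen_min (P := fun v => bil u0 v = 0)) (charged_decomposition (pr_wt H k%:Z v)).
      by split=> [|a b ea eb]; rewrite ?(bil0r HB) // (bilBr HB) ea eb subrr.
    move=> w [ww [s' ss' cw]]; apply: NNPP => /eqP b0; apply: no; exists w; split=> //; split=> // d dD.
    (* Applying [rho d] to the product of u0 and w, a nonzero multiple of the vacuum, forces the two
       charges to agree at d. *)
    have := congr1 (rho d) (pairE _ _ wu0 cu0 ww); have lin := rho_aut dD.
    rewrite (autY lin) (autZ lin) (aut_vac H lin) cu0 // cw // (YlZ H) (YrZ H) pairE // !scalerA => /eqP.
    rewrite -subr_eq0 -scalerBl scaler_eq0 (negbTE (vac_neq0 HB)) orbF subr_eq0 mulrA -[X in _ == X]mul1r.
    have nb : (-1) ^+ k * bil u0 w != 0 by rewrite mulf_neq0 ?signr_eq0 //; apply/eqP.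
    move/eqP; rewrite -(mulrA _ _ (bil _ _)) => /(mulIf nb); case: (ss d dD) => ->; case: (ss' d dD) => ->; rewrite ?mulr1 ?mul1r //; lra.
  have [e0|e0] := eqVneq (bil u0 u0) 0; last by exists u0.
  have [e1|e1] := eqVneq (bil v v) 0; last by exists v.
  exists (u0 + v); split; first exact: (wtD H).
    by rewrite -[u0]scale1r; exact: charged_lin.
  rewrite !(bilDl HB) !(bilDr HB) e0 e1 (bil_sym HB v) addr0 add0r -mulr2n -mulr_natl mulf_neq0 //.
have base : self_pairing k u != 0.
  by rewrite /self_pairing pairE // (bilZl HB) (bil_vac HB) mulr1 mulf_neq0 ?signr_eq0.
rewrite -(subnK lekh); elim: (h - k)%N => [|j [v [wv cv pv]]]; first by exists u.
exists (Vir Y om (-1) v); split.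
- by rewrite addSn; have := L_wt H (-1) wv; congr (wt _ _ _ _); lia.
- move=> d dD; rewrite /Vir (autY (rho_aut dD)) cv // (YrZ H); congr (_ *: Y _ _ _).
  by case: (rho_aut dD).
- by rewrite addSn; apply: self_pairing_L => //; lia.
Qed.

(** An isotropic y is corrected by a non-isotropic v of the same charge: by the parallelogram
    identity y + v or y - v is non-isotropic. *)
Lemma charged_span_good s h y : signs s -> wt Y om h%:Z y -> charged s y -> Zgen (good h) y.
Proof.
move=> ss wy cy; have [->|y0] := eqVneq y 0; first exact: Zgen0.
have [[d0 d0D sd0]|no] := classic (exists2 d, d \in D & s d = -1); last first.
  apply: Zgen_in; apply: good_fixed => // d dD; rewrite cy //.
  by case: (ss d dD) => [->|e]; [rewrite scale1r | case: no; exists d].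
have [e0|e0] := eqVneq (self_pairing h y) 0; last by apply: Zgen_in; exact: good_nonisotropic ss cy e0.
have [v [wv cv pv]] := charged_nonisotropic ss d0D sd0 y0 wy cy.
have gv : good h v by exact: good_nonisotropic ss cv pv.
have cD : charged s (y + v) by rewrite -[y]scale1r; exact: charged_lin.
have cB : charged s (y - v) by rewrite addrC -scaleN1r; exact: charged_lin.
have [e1|e1] := eqVneq (self_pairing h (y + v)) 0.
  have e2 : self_pairing h (y - v) != 0.
    apply: contraNneq pv => e2; have : self_pairing h (y + v) + self_pairing h (y - v) = 2 * self_pairing h v.
      rewrite /self_pairing !(YlD H, YlN H, YrD H, YrN H) !(bilDl HB) -!scaleN1r !(bilZl HB) !(bilDl HB) !(bilZl HB).
      by move: e0; rewrite /self_pairing => ->; ring.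
    by rewrite e1 e2 addr0 => /esym/eqP; rewrite mulf_eq0.
  rewrite -[y](subrK v); apply: (sgD (Zgen_subgroup _)); apply: Zgen_in => //.
  by apply: good_nonisotropic ss cB e2; exact: (wtB H).
rewrite -[y](addrK v); apply: ZgenB; apply: Zgen_in => //.
by apply: good_nonisotropic ss cD e1; exact: (wtD H).
Qed.

Lemma span_good h v : wt Y om h%:Z v -> Zgen (good h) v.
Proof.
move=> wv; apply: Zgen_mono (charged_decomposition wv) => w [ww [s ss cw]].
exact: charged_span_good ss ww cw.
Qed.

Hypothesis Anli : nearly_lattice_integral bil A.

Lemma good_basis (h : nat) : exists s : seq V, (forall y, y \in s -> good h y) /\
  forall v, wt Y om h%:Z v -> rat_multiple (Zgen (fun y => y \in s)) v.
Proof.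
have [b Hb] := voa_findim H h%:Z.
have [s [Gs bs]] : exists s : seq V, (forall y, y \in s -> good h y) /\
    forall w, w \in b -> Zgen (fun y => y \in s) (pr H h%:Z w).
  elim: {Hb}b => [|w b [s [Gs bs]]]; first by exists [::].
  have [s' [Gs' ws]] := Zgen_finite (span_good (pr_wt H h%:Z w)).
  exists (s' ++ s); split=> [t|t]; first by rewrite mem_cat => /orP[/Gs'|/Gs].
  rewrite inE => /orP[/eqP ->|/bs]; [move: ws|]; apply: Zgen_mono => y ys; apply: Zgen_in;
    by rewrite mem_cat ys ?orbT.
exists s; split=> // v wv; have [c ev] := Hb v wv.
have -> : v = pr H h%:Z v by rewrite (pr_hom H _ wv) eqxx.
rewrite ev (pr_sum H); set P := Zgen _; have HP : subgroup P by exact: Zgen_subgroup.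
apply: (big_ind (rat_multiple P)) => [|u w Pu Pw|i _].
- by exists 1%N => //; exact: sg0.
- by rewrite -[u]scale1r; exact: rat_multiple_lin.
- rewrite (prZ H) -[_ *: _]addr0; apply: rat_multiple_lin => //; last by exists 1%N => //; exact: sg0.
  by exists 1%N => //; apply: bs; exact: mem_nth.
Qed.

Lemma common_denominator (gs : seq (nat * V)) : (forall p, p \in gs -> good p.1 p.2) ->
  exists2 K, (0 < K)%N & forall p (m : nat), p \in gs ->
    A (Y p.2 (p.1.*2%:Z - 1 - m%:Z) p.2 *+ K ^ m.+1).
Proof.
move=> Gs; have [p k l Hk m|p /Gs[_] //|K K0 HK] := common_multiple (r := gs)
  (Q := fun p K => forall m : nat, A (Y p.2 (p.1.*2%:Z - 1 - m%:Z) p.2 *+ K ^ m.+1)).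
  by rewrite expnMn mulrnA; apply: (sgMn HA); exact: Hk.
by exists K => // p m /HK.
Qed.

Lemma letters_exist (h0 : nat) : exists (gs : seq (nat * V)) (C : nat), [/\ (0 < C)%N,
  forall p, p \in gs -> (p.1 <= h0)%N /\ wt Y om p.1%:Z p.2,
  forall h v, (h <= h0)%N -> wt Y om h%:Z v ->
    rat_multiple (Zgen (fun y => (h, y) \in gs)) v &
  forall (l : seq (V * int)) q, (forall p, p \in l -> exists h, (h, p.1) \in gs) ->
    lword Y vac l = q *: vac -> q * C%:R ^+ size l \is a Num.int].
Proof.
have [gs [gsh gsg gsb]] : exists gs : seq (nat * V), [/\ forall p, p \in gs -> (p.1 <= h0)%N,
    forall p, p \in gs -> good p.1 p.2 &
    forall h v, (h <= h0)%N -> wt Y om h%:Z v -> rat_multiple (Zgen (fun y => (h, y) \in gs)) v].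
  elim: h0 => [|h1 [gs [gsh gsg gsb]]].
    have [s [Gs Hs]] := good_basis 0; exists [seq (0%N, y) | y <- s]; split.
    - by move=> p /mapP[y _ ->].
    - by move=> p /mapP[y ys ->]; exact: Gs.
    - move=> h v; rewrite leqn0 => /eqP -> /Hs[k k0 Hk]; exists k => //; apply: Zgen_mono Hk => y ys.
      by apply: Zgen_in; apply: map_f.
  have [s [Gs Hs]] := good_basis h1.+1; exists ([seq (h1.+1, y) | y <- s] ++ gs); split.
  - by move=> p; rewrite mem_cat => /orP[/mapP[y _ ->] //|/gsh /leqW].
  - by move=> p; rewrite mem_cat => /orP[/mapP[y ys ->]|/gsg //]; exact: Gs.
  - move=> h v; rewrite leq_eqVlt ltnS => /orP[/eqP -> /Hs|lh /(gsb _ _ lh)] [k k0 Hk]; exists k => //;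
      apply: Zgen_mono Hk => y ys; apply: Zgen_in; rewrite mem_cat ?ys ?orbT //.
    by apply/orP; left; apply: map_f.
have [K K0 HK] := common_denominator gsg.
pose ys := map snd gs; pose P := h0.*2.
pose h y := epsilon (inhabits 0%N) (fun h => (h, y) \in gs).
have hy y : y \in ys -> (h y, y) \in gs.
  by move=> /mapP[[h1 y1] gy /= ->]; exact: (epsilon_spec (inhabits 0%N) (fun h => (h, y1) \in gs) (ex_intro _ h1 gy)).
have wy y : y \in ys -> wt Y om (h y)%:Z y by move=> /hy /gsg[].
exists gs, (K ^ (size ys * P).+1)%N; split=> //; first by rewrite expn_gt0 K0.
  by move=> p pg; split; [exact: gsh | case: (gsg p pg)].
have evP : ~~ odd P by rewrite odd_double.
have locy y y' (n : int) : y \in ys -> y' \in ys -> P%:Z <= n -> Y y n y' = 0.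
  move=> /[dup] /hy /gsh /= l1 /wy w1 /[dup] /hy /gsh /= l2 /wy w2 ln.
  by apply: (Y_top H HV0 HB w1 w2); move: ln l1 l2; rewrite /P; lia.
have AK y (m : nat) : y \in ys -> A (Y y (P%:Z - 1 - m%:Z) y *+ K ^ m.+1).
  move=> yys; have := gsh _ (hy y yys) => /= lh.
  (* The common locality order P may exceed twice the weight of y. The difference shifts the order
     of the product, and the orders below the shift give 0. *)
  have [lm|lm] := ltnP m (P - (h y).*2).
    rewrite (Y_top H HV0 HB (wy y yys) (wy y yys)) ?mul0rn; first exact: sg0.
    by move: lm; rewrite /P; lia.
  have := HK (h y, y) (m - (P - (h y).*2))%N (hy y yys) => /= AKy.
  rewrite -(subnK (n := m.+1) (m := (m - (P - (h y).*2)).+1)); last by lia.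
  rewrite expnD mulnC mulrnA; apply: sgMn => //; move: AKy; congr (A (Y _ _ _ *+ _)).
  by move: lm; rewrite /P; lia.
move=> l q lg e; apply: (lword_denominators H HV0 HB evP wy locy HA A1 AY AK Anli _ e).
by move=> p /lg[h1 pg]; apply/mapP; exists (h1, p.1).
Qed.

End GoodLetters.

(** * Lattices spanned by words *)
Section WordLattice.
Variables (V : lmodType rat) (Y : V -> int -> V -> V) (vac om : V).
Hypotheses (H : is_VOA Y vac om).
Variables (bil : V -> V -> rat) (HV0 : dim_V0_one Y om) (HB : is_inv_form Y vac om bil).
Variable Z : V -> Prop.
Hypothesis Zwt : forall z, Z z -> exists2 h : nat, wt Y om h%:Z z &
  forall j : nat, Zgen Z ((j`!%:R)^-1 *: iter j (Vir Y om 1) z).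
Hypothesis Zint : forall (l : seq (V * int)) q, (forall p, p \in l -> Z p.1) ->
  lword Y vac l = q *: vac -> q \is a Num.int.

Definition words := Zgen (fun v => exists l : seq (V * int), (forall p, p \in l -> Z p.1) /\ v = lword Y vac l).

Let HW : subgroup words. Proof. exact: Zgen_subgroup. Qed.

Lemma words_vac : words vac.
Proof. by apply: Zgen_in; exists [::]. Qed.

Lemma words_letter z n v : Z z -> words v -> words (Y z n v).
Proof.
move=> Zz; elim=> [|_ [l [Zl ->]]|u w _ Hu _ Hw].
- by rewrite (Yr0 H); exact: sg0.
- apply: Zgen_in; exists ((z, n) :: l); split=> // p.
  by rewrite inE => /orP[/eqP ->|/Zl].
- by rewrite (YrB H); exact: sgB.
Qed.

Lemma words_ind (P : V -> Prop) : subgroup P -> P vac ->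
  (forall z n v, Z z -> words v -> P v -> P (Y z n v)) -> forall v, words v -> P v.
Proof.
move=> HP P1 PY; apply: (Zgen_min HP) => _ [l [Zl ->]]; elim: l Zl => // p l IH Zl.
have Zl' q : q \in l -> Z q.1 by move=> ql; apply: Zl; rewrite inE ql orbT.
apply: PY; [exact/Zl/mem_head | by apply: Zgen_in; exists l | exact: IH].
Qed.

(** Associativity, whose coefficients are integers, reduces products by a word to products by its
    letters. *)
Lemma words_Y a n b : words a -> words b -> words (Y a n b).
Proof.
move=> Wa; move: a Wa n b; apply: (words_ind (P := fun a => forall n b, words b -> words (Y a n b))).
- split=> [n b _|u v Hu Hv n b Wb]; first by rewrite (Yl0 H); exact: sg0.
  by rewrite (YlB H); apply: sgB => //; [exact: Hu | exact: Hv].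
- by move=> n b Wb; rewrite (voa_vacl H); case: eqP => // _; exact: sg0.
- move=> z k v Zz _ IH n b Wb; apply: (iterate_Z H) => // i j; first exact/words_letter/IH.
  by apply: IH; exact: words_letter.
Qed.

Lemma words_homog (l : seq (V * int)) : (forall p, p \in l -> Z p.1) -> exists k, wt Y om k (lword Y vac l).
Proof.
elim: l => [|p l IH] Zl; first by exists 0; exact: (wt_vac H).
have [k wk] := IH (fun q ql => Zl q (mem_behead (s := p :: l) ql)).
have [h wh _] := Zwt (Zl p (mem_head _ _)).
by exists (h%:Z + k - p.2 - 1); exact: (wt_Y H).
Qed.

Lemma words_pr k v : words v -> words (pr H k v).
Proof.
apply: pr_P => // _ [l [Zl ->]]; have [k' wk] := words_homog Zl.
by rewrite (pr_hom H _ wk); case: eqP => _; [apply: Zgen_in; exists l | exact: sg0].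
Qed.

(** Invariance moves the letters of u to the other side one by one; the divided powers of L(1) that
    appear preserve the span of Z. What remains is the pairing of the vacuum with weight zero
    words. *)
Lemma words_integral u v : words u -> words v -> bil u v \is a Num.int.
Proof.
move=> Wu; move: u Wu v; apply: (words_ind (P := fun u => forall v, words v -> bil u v \is a Num.int)).
- split=> [v _|u w Hu Hw v Wv]; first by rewrite (bil0l HB).
  by rewrite (bilBl HB) rpredB ?Hu ?Hw.
- apply: (Zgen_min (P := fun v => bil vac v \is a Num.int)).
    split=> [|u v]; first by rewrite (bil0r HB).
    by rewrite (bilBr HB); exact: rpredB.
  move=> _ [l [Zl ->]]; have [k wk] := words_homog Zl.
  have [k0|nk] := eqVneq k 0; last by rewrite (bil_wt H HB (wt_vac H) wk) // eq_sym.
  rewrite k0 in wk; apply: (Zint Zl); rewrite (bil_sym HB); exact: (wt0E H HV0 HB).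
- move=> z n w Zz _ IH v Wv; have [h wh Zj] := Zwt Zz.
  rewrite (bil_inv_wt H HV0 HB _ _ _ wh); apply: rpredM; first by rewrite rpredX ?rpredN ?rpred1.
  apply: rpred_sum => j _; rewrite -(bilZr HB) -(YlZ H); apply: IH.
  move: (Zj j); apply: (Zgen_min (P := fun u => words (Y u _ v))).
    split=> [|a b Ha Hb]; first by rewrite (Yl0 H); exact: sg0.
    by rewrite (YlB H); exact: sgB.
  by move=> a Za; exact: words_letter.
Qed.

Lemma words_full (S : seq V) : (forall P : V -> Prop,
    (forall s, s \in S -> P s) -> P vac ->
    (forall (q : rat) u w, P u -> P w -> P (q *: u + w)) ->
    (forall a n b, P a -> P b -> P (Y a n b)) -> forall v, P v) ->
  (forall s, s \in S -> rat_multiple words s) -> forall v, rat_multiple words v.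
Proof.
move=> gen WS; apply: gen => // [|q u w|a n b [k k0 Wa] [l l0 Wb]].
- by exists 1%N => //; exact: words_vac.
- exact: rat_multiple_lin.
- exists (k * l)%N; first by rewrite muln_gt0 k0.
  by rewrite mulrnA -(YlMn H b) -(YrMn H _ _ b); exact: words_Y.
Qed.

End WordLattice.

(** * Bases of subgroups separated by integral functionals *)

Section LatticeBasis.
Variable V : lmodType rat.

Lemma int_subgroup_gen (I : int -> Prop) : subgroup I -> exists2 d : int, I d & forall z, I z -> exists q, z = d * q.
Proof.
move=> HI; have [[z [Iz z0]]|no] := classic (exists z, I z /\ z != 0); last first.
  exists 0 => [|z Iz]; first exact: sg0.
  by exists 0; rewrite mul0r; apply: NNPP => /eqP z0; apply: no; exists z.
have [d [d0 Id dmin]] : exists d : nat, [/\ (0 < d)%N, I d%:Z & forall e : nat, (0 < e)%N -> I e%:Z -> (d <= e)%N].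
  have Iabs : I (absz z)%:Z.
    by move: Iz; case: {z0} z => k // /(sgN HI); rewrite NegzE opprK.
  move: Iabs; have : (0 < absz z)%N by rewrite absz_gt0.
  elim/ltn_ind: (absz z) => k IH k0 Ik.
  have [[e [e0 Ie ek]]|no] := classic (exists e : nat, [/\ (0 < e)%N, I e%:Z & (e < k)%N]); first exact: IH ek e0 Ie.
  by exists k; split=> // e e0 Ie; rewrite leqNgt; apply/negP => ek; apply: no; exists e.
exists d%:Z => // y Iy; exists (divz y d%:Z); apply/eqP; rewrite mulrC -subr_eq0.
have := divz_eq y d%:Z => e; have r0 := modz_ge0 y (d := d%:Z); have rd := ltz_pmod y (d := d%:Z).
have -> : y - divz y d%:Z * d%:Z = modz y d%:Z by rewrite {1}e addrC addKr.
have Ir : I (modz y d%:Z).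
  have -> : modz y d%:Z = y - d%:Z *~ divz y d%:Z by rewrite {2}e mulrzz mulrC addrC addKr.
  by apply: sgB => //; exact: sgMz.
have dn0 : d%:Z != 0 by rewrite eqz_nat -lt0n.
have dp : 0 < d%:Z by rewrite ltz_nat.
move: {r0 rd}(r0 dn0) (rd dp) Ir; move: (modz y _) => [r|//] _ ltr Ir.
rewrite eqz_nat -leqn0 leqNgt; apply/negP => rp; have := dmin r rp Ir; rewrite leqNgt.
by move: ltr; rewrite ltz_nat => ->.
Qed.

Definition lattice_basis (G : V -> Prop) (bs : seq V) :=
  [/\ uniq bs, forall b, b \in bs -> G b,
      forall v, G v -> exists c : V -> int, v = \sum_(b <- bs) b *~ c b &
      forall c : V -> rat, \sum_(b <- bs) c b *: b = 0 -> forall b, b \in bs -> c b = 0].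

(** Induction on the functionals: a basis of the kernel of the first one is completed by a vector
    whose value generates its image in the integers. *)
Lemma lattice_basis_exists (T : eqType) (F : T -> V -> rat) (ts : seq T) (G : V -> Prop) : subgroup G ->
  (forall t, t \in ts -> forall q u v, F t (q *: u + v) = q * F t u + F t v) ->
  (forall t v, t \in ts -> G v -> F t v \is a Num.int) ->
  (forall v, G v -> (forall t, t \in ts -> F t v = 0) -> v = 0) ->
  exists bs, lattice_basis G bs.
Proof.
elim: ts G => [|t0 ts IH] G HG Flin Fint Finj.
  exists [::]; split=> // v Gv; exists (fun=> 0); rewrite big_nil; exact: Finj.
pose f := F t0; have f_lin : forall q u v, f (q *: u + v) = q * f u + f v by apply: Flin; exact: mem_head.
have f0 : f 0 = 0 by have := f_lin 1 0 0; rewrite scaler0 addr0 mul1r; lra.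
have fD u v : f (u + v) = f u + f v by rewrite -{1}[u]scale1r f_lin mul1r.
have fZ q u : f (q *: u) = q * f u by rewrite -[q *: u]addr0 f_lin f0 addr0.
have fB u v : f (u - v) = f u - f v by rewrite fD -scaleN1r fZ mulN1r.
have fMz u z : f (u *~ z) = z%:~R * f u by rewrite -scaler_int fZ.
pose G' v := G v /\ f v = 0.
have HG' : subgroup G'.
  split; first by split; [exact: sg0 |].
  by move=> u v [Gu fu] [Gv fv]; split; [exact: sgB | rewrite fB fu fv subrr].
have [|||bs [ub Gb bspan bind]] := IH G' HG'.
- by move=> t tts; apply: Flin; rewrite inE tts orbT.
- by move=> t v tts [Gv _]; apply: Fint => //; rewrite inE tts orbT.
- by move=> v [Gv fv] Hv; apply: Finj => // t; rewrite inE => /orP[/eqP -> //|]; exact: Hv.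
pose I z := exists2 v, G v & f v = z%:~R.
have HI : subgroup I.
  split; first by exists 0; [exact: sg0 |].
  by move=> y z [u Gu fu] [v Gv fv]; exists (u - v); [exact: sgB | rewrite fB fu fv rmorphB].
have [d [v0 Gv0 fv0] Id] := int_subgroup_gen HI.
have fG v : G v -> exists q : int, f v = d%:~R * q%:~R.
  move=> Gv; have /intrP[z fz] := Fint t0 v (mem_head _ _) Gv.
  by have [|q eq] := Id z; [exists v | exists q; rewrite /f fz eq rmorphM].
have [d0|d0] := eqVneq d 0.
  exists bs; split=> //; first by move=> b /Gb[].
  by move=> v Gv; apply: bspan; split=> //; have [q ->] := fG v Gv; rewrite d0 mul0r.
have nv0 : v0 \notin bs.
  by apply/negP => /Gb[_]; rewrite fv0 => /eqP; rewrite intr_eq0 (negbTE d0).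
exists (v0 :: bs); split.
- by rewrite /= nv0.
- by move=> b; rewrite inE => /orP[/eqP ->|/Gb[]].
- move=> v Gv; have [q fq] := fG v Gv.
  have [|c ev] := bspan (v - v0 *~ q).
    by split; [apply: sgB => //; exact: sgMz | rewrite fB fMz fv0 fq mulrC subrr].
  exists (fun b => if b == v0 then q else c b); rewrite big_cons eqxx -[LHS](subrK (v0 *~ q)) ev addrC; congr (_ + _).
  by apply: eq_big_seq => b bb; case: eqP => // eb; rewrite eb (negbTE nv0) in bb.
- move=> c; rewrite big_cons => e.
  have fs0 : f (\sum_(b <- bs) c b *: b) = 0.
    elim: (bs) Gb => [|b bs' IHb] Gb'; first by rewrite big_nil.
    rewrite big_cons fD fZ (proj2 (Gb' b (mem_head _ _))) mulr0 add0r.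
    by apply: IHb => b' bb; apply: Gb'; rewrite inE bb orbT.
  have c0 : c v0 = 0.
    have := congr1 f e; rewrite fD fs0 fZ fv0 f0 addr0 => /eqP.
    by rewrite mulf_eq0 intr_eq0 (negbTE d0) orbF => /eqP.
  rewrite c0 scale0r add0r in e.
  by move=> b; rewrite inE => /orP[/eqP -> //|]; exact: bind.
Qed.

End LatticeBasis.

Section IntegralForm.
Variables (V : lmodType rat) (Y : V -> int -> V -> V) (vac om : V).
Hypotheses (H : is_VOA Y vac om).
Variables (bil : V -> V -> rat) (HB : is_inv_form Y vac om bil).
Variables (B : V -> Prop) (HG : subgroup B) (B1 : B vac).
Hypothesis BY : forall a b (n : int), B a -> B b -> B (Y a n b).
Hypothesis Bpr : forall k v, B v -> B (pr H k v).
Hypothesis Bfull : forall v, rat_multiple B v.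
Hypothesis Bint : lattice_integral bil B.

Lemma weight_basis k : exists bs, lattice_basis (fun v => B v /\ wt Y om k v) bs.
Proof.
have [b Hb] := voa_findim H k.
have [K K0 HK] : exists2 K, (0 < K)%N & forall u, u \in b -> B (pr H k u *+ K).
  apply: common_multiple => [u m l Bu|u _]; first by rewrite mulrnA; exact: sgMn.
  exact: Bfull.
apply: (@lattice_basis_exists _ _ (fun u v => bil (pr H k u *+ K) v) b).
- split; first by split; [exact: (sg0 HG) | exact: (wt0 H)].
  by move=> u v [Bu wu] [Bv wv]; split; [exact: (sgB HG) | exact: (wtB H)].
- by move=> u _ q v w; rewrite (bilDr HB) (bilZr HB).
- by move=> u v /HK Bu [Bv _]; exact: Bint.
- move=> v [_ wv] v0; apply: (bil_nondeg HB) => u; have [ls [_ ->]] := pr_dec H u.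
  rewrite (bil_sumr HB) big1 // => l _; have [->|nl] := eqVneq l k; last first.
    by apply: (bil_wt H HB wv (pr_wt H l u)); rewrite eq_sym.
  have [c ec] := Hb _ (pr_wt H k u).
  have -> : pr H k u = pr H k (pr H k u) by rewrite (pr_hom H _ (pr_wt H k u)) eqxx.
  rewrite ec (pr_sum H) (bil_sumr HB) big1 // => i _; rewrite (prZ H) (bilZr HB) (bil_sym HB).
  have /eqP := v0 _ (mem_nth 0 (ltn_ord i)).
  rewrite -scaler_nat (bilZl HB) mulf_eq0 pnatr_eq0 eqn0Ngt K0 /= => /eqP ->.
  by rewrite mulr0.
Qed.

Let bs k := proj1_sig (constructive_indefinite_description _ (weight_basis k)).
Let bsP k : lattice_basis (fun v => B v /\ wt Y om k v) (bs k).
Proof. exact: (proj2_sig (constructive_indefinite_description _ (weight_basis k))). Qed.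

Let Bs v := exists k, v \in bs k.

Lemma pr_basis k v : Bs v -> pr H k v = if v \in bs k then v else 0.
Proof.
case=> l vl; have [_ Bl _ _] := bsP l; have [_ wv] := Bl v vl.
rewrite (pr_hom H k wv); case: ifP => [/eqP -> |nk]; first by rewrite vl.
case: ifP => // vk; have [_ Bk _ _] := bsP k; have [_ wv'] := Bk v vk.
by apply: esym; apply: (wt_uniq wv wv'); rewrite eq_sym nk.
Qed.

Lemma basis_Zspan v : B v -> Zspan_set Bs v.
Proof.
move=> Bv; have [ls [_ ->]] := pr_dec H v.
apply: (big_ind (Zspan_set Bs)) => [|u w [s [Hs ->]] [t [Ht ->]]|l _].
- by exists [::]; rewrite big_nil.
- exists (s ++ t); rewrite big_cat; split=> // p; rewrite mem_cat => /orP[/Hs|/Ht] //.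
- have [_ _ span _] := bsP l; have [|c ->] := span (pr H l v).
    by split; [exact: Bpr | exact: (pr_wt H)].
  exists [seq (b, c b) | b <- bs l]; rewrite big_map; split=> // p /mapP[b bl ->]; by exists l.
Qed.

Lemma basis_indep : Qindep Bs.
Proof.
move=> s us Hs e p ps; have [k pk] := Hs p ps; have [ub _ _ ind] := bsP k.
pose c b := \sum_(q <- s | q.1 == b) q.2.
have c0 : \sum_(b <- bs k) c b *: b = 0.
  transitivity (\sum_(q <- s) pr H k (q.2 *: q.1)); last by rewrite -pr_sum e (pr0 H).
  rewrite [LHS](eq_bigr (fun b => \sum_(q <- s | q.1 == b) q.2 *: b)); last first.
    by move=> b _; rewrite scaler_suml.
  rewrite (exchange_big_dep xpredT) //= big_seq [RHS]big_seq; apply: eq_bigr => q qs.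
  rewrite (prZ H) (pr_basis _ (Hs q qs)); case: ifP => qk.
    by rewrite big_mkcond (bigD1_seq q.1) //= eqxx big1 ?addr0 // => b /negbTE; rewrite eq_sym => ->.
  rewrite scaler0 big_seq_cond big1 // => b /andP[bk /eqP eb]; by rewrite eb bk in qk.
have := ind c c0 _ pk; rewrite /c.
rewrite big_mkcond (bigD1_seq p) ?(map_uniq us) //= eqxx big_seq_cond big1 ?addr0 // => q /andP[qs nq].
(* First components are distinct in [s], so equal first components mean equal positions. *)
case: eqP => // eq; case/eqP: nq; suff ei : index q s = index p s by rewrite -(nth_index p qs) ei nth_index.
have li (r : V * rat) : r \in s -> (index r s < size (map fst s))%N by rewrite size_map index_mem.
apply/eqP; rewrite -(nth_uniq p.1 (li q qs) (li p ps) us) !(nth_map p) ?index_mem // !nth_index //.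
exact/eqP.
Qed.

Lemma lattice_is_IVOA : is_IVOA Y vac om (fun _ => True) B.
Proof.
split=> //; split=> //.
- exists Bs; split=> //; first exact: basis_indep.
    move=> v; split=> // _; have [k k0 Bv] := Bfull v; have [s [Hs ev]] := basis_Zspan Bv.
    exists [seq (p.1, k%:R^-1 * p.2%:~R) | p <- s]; split; first by move=> _ /mapP[p ps ->]; exact: Hs.
    rewrite big_map /=; transitivity (k%:R^-1 *: (v *+ k)).
      by rewrite -scaler_nat scalerA mulVf ?scale1r // pnatr_eq0 -lt0n.
    by rewrite ev scaler_sumr; apply: eq_bigr => p _; rewrite -scaler_int scalerA.
  move=> v; split; first exact: basis_Zspan.
  case=> s [Hs ->]; apply: (sg_sumS HG) => p ps; apply: (sgMz HG).
  by have [k pk] := Hs p ps; have [_ Bk _ _] := bsP k; case: (Bk _ pk).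
- by move=> a n b; exact: BY.
- by exists 1%N.
- by have [k k0 Bk] := Bfull om; exists k.
Qed.

End IntegralForm.

(** * Rescaling of the letters and the invariant lattice *)

Section ScaledLetters.
Variables (V : lmodType rat) (Y : V -> int -> V -> V) (vac om : V).
Hypotheses (H : is_VOA Y vac om).
Variables (bil : V -> V -> rat) (HV0 : dim_V0_one Y om) (HB : is_inv_form Y vac om bil).
Variables (h0 : nat) (gs : seq (nat * V)) (C : nat) (C0 : (0 < C)%N).
Hypothesis gs_wt : forall p, p \in gs -> (p.1 <= h0)%N /\ wt Y om p.1%:Z p.2.
Hypothesis gs_span : forall (h : nat) v, (h <= h0)%N -> wt Y om h%:Z v ->
  rat_multiple (Zgen (fun y => (h, y) \in gs)) v.
Hypothesis gs_int : forall (l : seq (V * int)) q, (forall p, p \in l -> exists h, (h, p.1) \in gs) ->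
  lword Y vac l = q *: vac -> q * C%:R ^+ size l \is a Num.int.

Let L1 j v := (j`!%:R)^-1 *: iter j (Vir Y om 1) v.

Let L1Mn j v k : L1 j (v *+ k) = L1 j v *+ k.
Proof.
rewrite /L1 -scaler_nat (_ : iter j _ _ = k%:R *: iter j (Vir Y om 1) v).
  by rewrite scalerA mulrC -scalerA scaler_nat.
by elim: j => [|j IH] /=; [rewrite scaler_nat | rewrite IH /Vir (YrZ H)].
Qed.

Let L1_wt h j v : wt Y om h%:Z v -> wt Y om (h%:Z - j%:Z) (L1 j v).
Proof. by move=> wv; apply: (wtZ H); exact: (L1_iter_wt H). Qed.

(** A letter of weight h is multiplied by C M^h. The factor C pays for the denominators of weight
    zero words, one per letter. For j > 0, L(1)^j lowers the weight by j and so frees M^j, of which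
    one M clears the denominators of L(1)^j / j! on the letters. *)
Lemma scaled_letters : exists Z : V -> Prop, [/\
  forall z, Z z -> exists2 h : nat, wt Y om h%:Z z & forall j, Zgen Z (L1 j z),
  forall (l : seq (V * int)) q, (forall p, p \in l -> Z p.1) ->
    lword Y vac l = q *: vac -> q \is a Num.int &
  forall (h : nat) v, (h <= h0)%N -> wt Y om h%:Z v -> rat_multiple (Zgen Z) v].
Proof.
have [M M0 HM] : exists2 M, (0 < M)%N & forall t : (nat * V) * nat, t \in [seq (p, j) | p <- gs, j <- iota 0 h0.+1] ->
    (t.2 <= t.1.1)%N -> Zgen (fun y => ((t.1.1 - t.2)%N, y) \in gs) (L1 t.2 t.1.2 *+ M).
  apply: common_multiple => [t k l Ht lt|t /allpairsP[[p j] /= [pg jh ->]] /=].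
    by rewrite mulrnA; apply: (sgMn (Zgen_subgroup _)); exact: Ht.
  have [ph wp] := gs_wt pg; have [jp|pj] := leqP j p.1; last by exists 1%N.
  have [|k k0 Hk] := @gs_span (p.1 - j) (L1 j p.2) (leq_trans (leq_subr _ _) ph).
    by have := L1_wt j wp; rewrite subzn.
  by exists k.
pose Z z := exists2 p, p \in gs & z = p.2 *+ (C * M ^ p.1).
have scaleZ h v : Zgen (fun y => (h, y) \in gs) v -> Zgen Z (v *+ (C * M ^ h)).
  apply: (Zgen_min (subgroup_Mn _ (Zgen_subgroup _))) => y yg; apply: Zgen_in.
  by exists (h, y).
exists Z; split.
- move=> _ [[h y] /= pg ->]; have [/= lh wy] := gs_wt pg; exists h.
    by rewrite -scaler_nat; exact: (wtZ H).
  move=> j; rewrite L1Mn; have [->|j0] := posnP j.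
    by rewrite /L1 fact0 invr1 scale1r; apply: scaleZ; apply: Zgen_in.
  have [jh|hj] := leqP j h; last first.
    rewrite (wt_lt0 H HV0 HB _ (L1_wt j wy)) ?mul0rn; first exact: Zgen0.
    by rewrite subr_lt0.
  have Hj : Zgen (fun y => ((h - j)%N, y) \in gs) (L1 j y *+ M).
    apply: (HM ((h, y), j)) => //; apply/allpairsP; exists ((h, y), j); split=> //.
    by rewrite mem_iota /= add0n ltnS; exact: leq_trans lh.
  rewrite (_ : C * M ^ h = M * (C * M ^ (h - j)) * M ^ j.-1)%N.
    by rewrite !mulrnA; apply: (sgMn (Zgen_subgroup _)); rewrite -mulrnA; exact: scaleZ.
  rewrite mulnCA -!mulnA; congr (C * _)%N; rewrite mulnCA -expnS prednK // -expnD subnK //.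
- move=> l q Zl e; have [l' [e' [sl lg ll]]] : exists (l' : seq (V * int)) (e' : nat), [/\ size l' = size l,
      forall p, p \in l' -> exists h, (h, p.1) \in gs &
      lword Y vac l = lword Y vac l' *+ (C ^ size l * M ^ e')].
    elim: l {q e} Zl => [|[z n] l IH] Zl; first by exists [::], 0%N; split=> //; rewrite mulr1n.
    have [|l' [e' [sl lg ll]]] := IH; first by move=> p pl; apply: Zl; rewrite inE pl orbT.
    have [[h y] /= pg zy] := Zl _ (mem_head _ _); exists ((y, n) :: l'), (h + e')%N; split=> /=.
    + by rewrite sl.
    + by move=> p; rewrite inE => /orP[/eqP ->|/lg //]; exists h.
    + by rewrite ll zy (YlMn H) (YrMn H) -mulrnA; congr (_ *+ _); rewrite expnS expnD; ring.
  have c0 : (C ^ size l * M ^ e')%:R != 0 :> rat.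
    by rewrite pnatr_eq0 -lt0n muln_gt0 !expn_gt0 C0 M0.
  have := @gs_int l' (q / (C ^ size l * M ^ e')%:R) lg; rewrite sl.
  have -> : lword Y vac l' = (q / (C ^ size l * M ^ e')%:R) *: vac.
    by rewrite mulrC -scalerA -e ll -scaler_nat scalerA mulVf // scale1r.
  move=> /(_ erefl) Hq; rewrite (_ : q = q / (C ^ size l * M ^ e')%:R * C%:R ^+ size l * (M ^ e')%:R).
    by apply: rpredM => //; exact: rpred_nat.
  by rewrite -!mulrA -natrX -natrM mulVf ?mulr1.
- move=> h v lh wv; have [k k0 Hk] := gs_span lh wv.
  exists (k * (C * M ^ h))%N; first by rewrite !muln_gt0 k0 C0 expn_gt0 M0.
  by rewrite mulrnA; exact: scaleZ.
Qed.

End ScaledLetters.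

(** Components of negative weight vanish, so h0 bounds the weights that occur in finitely many
    generators. The additive induction principle lets any subgroup closed under rational multiples
    be tested on homogeneous vectors. *)
Lemma generator_weights (V : lmodType rat) (Y : V -> int -> V -> V) (vac om : V) (bil : V -> V -> rat)
    (H : is_VOA Y vac om) (S : seq V) : dim_V0_one Y om -> is_inv_form Y vac om bil ->
  exists h0 : nat, forall s, s \in S -> forall P : V -> Prop, P 0 -> (forall u v, P u -> P v -> P (u + v)) ->
    (forall (h : nat) v, (h <= h0)%N -> wt Y om h%:Z v -> P v) -> P s.
Proof.
move=> HV0 HB; elim: S => [|s S [h1 Hh]]; first by exists 0%N.
have [ls [_ es]] := pr_dec H s; pose h2 := (\max_(l <- ls) absz l)%N.
exists (maxn h1 h2) => t; rewrite inE => /orP[/eqP ->|tS] P P0 PD Pwt; last first.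
  by apply: (Hh t tS P) => // h v lh; apply: Pwt; rewrite leq_max lh.
rewrite es big_seq; apply: (big_ind P) => // l lls.
case: l lls => [h|h] lls; last by rewrite (wt_lt0 H HV0 HB _ (pr_wt H _ s)).
apply: (Pwt h); last exact: (pr_wt H).
by rewrite leq_max /h2 (@leq_bigmax_seq _ ls xpredT absz h) ?orbT.
Qed.

Unset Implicit Arguments.

Theorem theorem2p10 (V : lmodType rat) (Y : V -> int -> V -> V) (vac om : V)
    (bil : V -> V -> rat) (gT : finGroupType) (N E D : {group gT})
    (rho : gT -> V -> V) (r : nat) :
  is_VOA Y vac om -> VOA_fin_gen Y vac -> dim_V0_one Y om ->
  is_inv_form Y vac om bil ->
  (* N is a finite subgroup of Aut(V), via the faithful action rho *)
  (forall g, g \in N -> is_VOA_aut Y om (rho g)) ->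
  (forall g h, g \in N -> h \in N -> forall v, rho (g * h)%g v = rho g (rho h v)) ->
  (forall g, g \in N -> (forall v, rho g v = v) -> g = 1%g) ->
  (* E normal in N, E = (Z/2)^r, r >= 3 *)
  (E <| N)%g -> (2.-abelem E)%g -> #|E| = (2 ^ r)%N -> (3 <= r)%N ->
  doubly_trans_lin N E ->
  (* D <= E with rank(E/D) >= 2 *)
  D \subset E -> (2 <= logn 2 #|E : D|%g)%N ->
  forall A : V -> Prop,
    is_IVOA Y vac om (fixed_pts rho D) A ->
    (forall g, g \in 'N_N(D)%g -> forall v, A v -> A (rho g v)) ->
    nearly_lattice_integral bil A ->
  exists B : V -> Prop,
    [/\ is_IVOA Y vac om (fun _ => True) B,
        (forall g, g \in N -> forall v, B v -> B (rho g v)) &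
        nearly_lattice_integral bil B].
Proof.
move=> H [S gen] HV0 HB aut rhoM _ nEN abE _ _ _ sDE _ A [[[Bs [_ _ Uspan Aspan]] AY _ _] A1] _ Anli.
have sEN : E \subset N by exact: normal_sub.
have sDN d : d \in D -> d \in N by move=> dD; apply: (subsetP sEN); exact: (subsetP sDE).
have rho1 v : rho 1%g v = v.
  have [_ [f fK _] _ _] := aut _ (group1 N).
  (* [rho 1] is idempotent and injective. *)
  by apply: (can_inj fK); rewrite -rhoM ?group1 // mulg1.
have rho2 d v : d \in D -> rho d (rho d v) = v.
  move=> dD; rewrite -rhoM ?sDN //; have /(subsetP sDE) dE := dD.
  have [_ exp2] := abelemP (isT : prime 2) abE.
  by rewrite (_ : (d * d)%g = 1%g) ?rho1 // -(exp2 d dE) expgS expg1.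
have rhoC d d' v : d \in D -> d' \in D -> rho d (rho d' v) = rho d' (rho d v).
  move=> dD dD'; rewrite -!rhoM ?sDN //; congr (rho _ v).
  by apply: (centsP (abelem_abelian abE)); exact: (subsetP sDE).
have HA : subgroup A.
  split; first by apply/Aspan; exists [::]; rewrite big_nil.
  move=> u v /Aspan[s [Hs ->]] /Aspan[t [Ht ->]]; apply/Aspan.
  exists (s ++ [seq (p.1, - p.2) | p <- t]); split.
    by move=> p; rewrite mem_cat => /orP[/Hs //|/mapP[q /Ht Bq ->]].
  by rewrite big_cat big_map -sumrN; congr (_ + _); apply: eq_bigr => p _; rewrite mulrNz.
have Aden v : fixed_pts rho D v -> rat_multiple A v.
  move=> /Uspan[s [Hs ->]]; rewrite big_seq; apply: (big_ind (rat_multiple A)) => [|u w Au Aw|p ps].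
  - by exists 1%N => //; exact: sg0.
  - by rewrite -[u]scale1r; exact: rat_multiple_lin.
  - rewrite -[_ *: _]addr0; apply: rat_multiple_lin => //; last by exists 1%N => //; exact: sg0.
    exists 1%N => //; apply/Aspan; exists [:: (p.1, 1)]; rewrite big_seq1; split=> // q.
    by rewrite inE => /eqP ->; exact: Hs.
have [h0 Hgen] := generator_weights H S HV0 HB.
have [gs [C [C0 gs_wt gs_span gs_int]]] :=
  letters_exist H HV0 HB (fun d dD => aut d (sDN d dD)) rho2 rhoC HA A1 (fun a b n => AY a n b) Aden Anli h0.
have [Z [Zwt Zint Zspan]] := scaled_letters H HV0 HB C0 gs_wt gs_span gs_int.
pose W := words Y vac Z; have HW : subgroup W by exact: Zgen_subgroup.
have W1 : W vac by exact: words_vac.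
have WY a b n : W a -> W b -> W (Y a n b) by exact: (words_Y H).
have Wfull v : rat_multiple W v.
  apply: (words_full H gen) => s sS; apply: (Hgen s sS).
  - by exists 1%N => //; exact: sg0.
  - by move=> u w Wu Ww; rewrite -[u]scale1r; exact: rat_multiple_lin.
  - move=> h w lh ww; have [k k0 Hk] := Zspan h w lh ww; exists k => //; move: Hk.
    apply: Zgen_min => // z Zz; have [<- _] := voa_creation H z.
    exact: (words_letter H).
pose B v := forall g, g \in N -> W (rho g v).
have BW v : B v -> W v by move=> /(_ 1%g (group1 N)); rewrite rho1.
have Bint : lattice_integral bil B.
  by move=> u v /BW Wu /BW Wv; exact: (words_integral H HV0 HB Zwt Zint).
exists B; split.
- apply: (lattice_is_IVOA (H := H) HB) => //.
  + split=> [g gN|u v Bu Bv g gN]; first by rewrite (aut0 (aut g gN)); exact: sg0.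
    by rewrite (autB (aut g gN)); apply: sgB => //; [exact: Bu | exact: Bv].
  + by move=> g gN; rewrite (aut_vac H (aut g gN)).
  + by move=> a b n Ba Bb g gN; rewrite (autY (aut g gN)); apply: WY; [exact: Ba | exact: Bb].
  + by move=> k v Bv g gN; rewrite -(aut_pr H (aut g gN)); apply: (words_pr H Zwt); exact: Bv.
  (* As N is finite, one multiple brings all translates of v into W. *)
  + move=> v; have [K K0 HK] : exists2 K, (0 < K)%N & forall g, g \in enum N -> W (rho g v *+ K).
      by apply: common_multiple => [g k l Wg|g _]; [rewrite mulrnA; exact: sgMn | exact: Wfull].
    by exists K => // g gN; rewrite (autMn (aut g gN)); apply: HK; rewrite mem_enum.
- by move=> g gN v Bv g' gN'; rewrite -rhoM //; apply: Bv; rewrite groupM.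
- by exists 1%N; split=> // _ _ [a [Ba ->]] [b [Bb ->]]; exact: Bint.
Qed.
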